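(* Fix a volume $V \in [0,\frac{1}{2}]$. Let $X \subset [0,1]^3$ be a cubical subset with $\mathrm{Vol}(X) = V$ that has minimal relative perimeter among all cubical subsets of $[0,1]^3$ of measure $V$, i.e. $\mathrm{RelPer}(X) \le \mathrm{RelPer}(Y)$ for every cubical subset $Y \subset [0,1]^3$ with $\mathrm{Vol}(Y) = V$. Then, up to isometries of $[0,1]^3$ and sets of measure $0$, $X$ is of the form $[0,a]^m \times [0,1]^{3-m}$ for some $a \in [0,\frac{1}{2}]$ and $m \in \{1,2,3\}$.
   Context: $[0,1]^n \subset \mathbb{R}^n$ carries the Euclidean metric, and $e_1,\dots,e_n$ is the standard basis of $\mathbb{R}^n$. A compact subset $X \subset [0,1]^n$ is called cubical if its boundary is contained in the union of finitely many hyperplanes, all of whose outer normal vectors lie in $\{\pm e_1,\dots,\pm e_n\}$. $\mathrm{Vol}$ is $n$-dimensional Lebesgue measure. For a measurable set $U \subset [0,1]^n$ of locally finite perimeter, the relative perimeter $\mathrm{RelPer}(U)$ is the $(n-1)$-dimensional Hausdorff measure of the part of the essential boundary of $U$ that does not lie on $\partial [0,1]^n$. *)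

(* Defs.v *)
From HB Require Import structures.
From mathcomp Require Import all_boot all_order all_algebra.
From mathcomp Require Import all_classical all_reals all_analysis.

Set Implicit Arguments.
Unset Strict Implicit.
Unset Printing Implicit Defensive.

Import Order.TTheory GRing.Theory Num.Theory.
Import numFieldNormedType.Exports.

Local Open Scope classical_set_scope.
Local Open Scope ring_scope.

Section tuple_measure.
Context {R : realType} (n : nat).
Local Notation T := (measurableTypeR R).

Definition tuple_cons (p : T * n.-tuple T) : n.+1.-tuple T :=
  [tuple of p.1 :: p.2].

Lemma measurable_tuple_cons : measurable_fun [set: T * n.-tuple T] tuple_cons.
Proof. exact: measurable_cons. Qed.

Variable m : {sigma_finite_measure set (n.-tuple T) -> \bar R}.

Definition lebesgue_cons : set (n.+1.-tuple T) -> \bar R :=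
  pushforward (lebesgue_measure \x m)%E tuple_cons.

Let lebesgue_cons0 : lebesgue_cons set0 = 0%E.
Proof. by rewrite /lebesgue_cons /pushforward preimage_set0 measure0. Qed.

Let lebesgue_cons_ge0 A : (0 <= lebesgue_cons A)%E.
Proof. by rewrite /lebesgue_cons /pushforward measure_ge0. Qed.

Let lebesgue_cons_semi_sigma_additive : semi_sigma_additive lebesgue_cons.
Proof.
move=> F mF tF mUF; rewrite /lebesgue_cons /pushforward preimage_bigcup.
have mcons B : measurable B -> measurable (tuple_cons @^-1` B).
  by move=> mB; rewrite -[_ @^-1` _]setTI; exact: measurable_tuple_cons.
apply: measure_semi_sigma_additive.
- by move=> k; exact: mcons.
- apply/trivIsetP => /= i j _ _ ij; rewrite -preimage_setI.
  by move/trivIsetP : tF => -> //; rewrite preimage_set0.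
- by rewrite -preimage_bigcup; exact: mcons.
Qed.

HB.instance Definition _ := isMeasure.Build _ _ _ lebesgue_cons
  lebesgue_cons0 lebesgue_cons_ge0 lebesgue_cons_semi_sigma_additive.

Let lebesgue_cons_sigma_finite : sigma_finite setT lebesgue_cons.
Proof.
have /sigma_finiteP[F [TF ndF mF]] := sigma_finiteT (@lebesgue_measure R).
have /sigma_finiteP[G [TG ndG mG]] := sigma_finiteT m.
pose s (t : n.+1.-tuple T) : T * n.-tuple T := (thead t, [tuple of behead t]).
have sK : cancel tuple_cons s.
  by move=> [x t]; rewrite /s /tuple_cons theadE; congr pair; exact: val_inj.
have ms : measurable_fun [set: n.+1.-tuple T] s.
  apply/measurable_fun_pairP; split; first exact: measurable_tnth.
  exact: measurable_behead.
exists (fun k => s @^-1` (F k `*` G k)).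
  apply/esym/seteqP; split => // t _.
  have [i _ Fi] : (\bigcup_i F i) (s t).1 by rewrite -TF.
  have [j _ Gj] : (\bigcup_i G i) (s t).2 by rewrite -TG.
  exists (maxn i j) => //; split.
    by move: Fi; exact/subsetPset/ndF/leq_maxl.
  by move: Gj; exact/subsetPset/ndG/leq_maxr.
move=> k; have [mFk Fkoo] := mF k; have [mGk Gkoo] := mG k; split.
  by rewrite -[_ @^-1` _]setTI; apply: ms => //; exact: measurableX.
rewrite /lebesgue_cons /pushforward (_ : _ @^-1` _ = F k `*` G k); last first.
  by apply/funext => p; rewrite -[in RHS](sK p).
by rewrite product_measure1E// lte_mul_pinfty// ge0_fin_numE.
Qed.

HB.instance Definition _ := Measure_isSigmaFinite.Build _ _ _ lebesgue_cons
  lebesgue_cons_sigma_finite.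

End tuple_measure.

(* Lebesgue measure on R^n.+1 as the product of those on R and R^n. *)
Fixpoint lebesgue_tuple {R : realType} n :
    {sigma_finite_measure set (n.-tuple (measurableTypeR R)) -> \bar R} :=
  match n with
  | 0 => \d_ [tuple]
  | n'.+1 => lebesgue_cons (lebesgue_tuple n')
  end.

Section cubical_sets.
Context {R : realType}.

(* The topology of 'rV[R]_n is induced by the sup norm, hence it is the
   Euclidean one; the Euclidean distance itself is spelled out below. *)
Definition edist n (x y : 'rV[R]_n) : R :=
  Num.sqrt (\sum_i (x 0 i - y 0 i) ^+ 2).

Definition eball n (x : 'rV[R]_n) (r : R) : set 'rV[R]_n :=
  [set y | edist x y < r].

Definition boundary n (A : set 'rV[R]_n) : set 'rV[R]_n :=
  closure A `\` interior A.

(* Meaningful on Borel sets only: the measure is not completed, and its values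
   outside of the product sigma-algebra are junk. *)
Definition Vol n (A : set 'rV[R]_n) : \bar R :=
  lebesgue_tuple n [set t | A (\row_i tnth t i)].

(* Supremum of the distances, with value 0 at the empty set. *)
Definition diam n (A : set 'rV[R]_n) : \bar R :=
  ereal_sup (0%E |` [set (edist p.1 p.2)%:E | p in A `*` A]).

(* The k-dimensional volume of a k-dimensional ball of diameter diam A;
   the empty set counts for 0 even when k = 0. *)
Definition hausdorff_weight n (k : nat) (A : set 'rV[R]_n) : \bar R :=
  if A == set0 then 0%E
  else (@Vol k (eball 0 1) * (diam A * (2^-1)%:E) ^+ k)%E.

Definition hausdorff_content n (k : nat) (delta : R) (A : set 'rV[R]_n) :
    \bar R :=
  ereal_inf [set (\sum_(0 <= j <oo) hausdorff_weight k (F j))%E |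
    F in [set F : nat -> set 'rV[R]_n |
      A `<=` \bigcup_j F j /\ forall j, (diam (F j) <= delta%:E)%E]].

(* The contents are nonincreasing in delta, so that their limit as delta
   tends to 0 is their supremum. *)
Definition hausdorff_measure n (k : nat) (A : set 'rV[R]_n) : \bar R :=
  ereal_sup [set hausdorff_content k delta A | delta in [set d | 0 < d]].

Definition has_density n (A : set 'rV[R]_n) (x : 'rV[R]_n) (theta : R) : Prop :=
  fine (Vol (A `&` eball x r)) / fine (Vol (eball x r)) @[r --> 0^'+] --> theta.

Definition essential_boundary n (A : set 'rV[R]_n) : set 'rV[R]_n :=
  [set x | ~ has_density A x 0 /\ ~ has_density A x 1].

Definition cube n : set 'rV[R]_n := [set x | forall i, 0 <= x 0 i <= 1].

Definition RelPer n (U : set 'rV[R]_n) : \bar R :=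
  hausdorff_measure n.-1 (essential_boundary U `\` boundary (@cube n)).

(* The hyperplanes with normal vectors in {e_i, - e_i}. *)
Definition coordinate_hyperplane n (i : 'I_n) (c : R) : set 'rV[R]_n :=
  [set x | x 0 i = c].

Definition cubical n (X : set 'rV[R]_n) : Prop :=
  [/\ compact X, X `<=` @cube n &
      exists s : seq ('I_n * R),
        boundary X `<=` \bigcup_(h in [set` s]) coordinate_hyperplane h.1 h.2].

(* f restricts to an isometry of the cube onto itself; its values elsewhere
   are irrelevant. *)
Definition cube_isometry n (f : 'rV[R]_n -> 'rV[R]_n) : Prop :=
  f @` @cube n = @cube n /\
  forall x y, @cube n x -> @cube n y -> edist (f x) (f y) = edist x y.

(* [0, a]^m x [0, 1]^(n - m) *)
Definition corner_box n (m : nat) (a : R) : set 'rV[R]_n :=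
  [set x | forall i : 'I_n, 0 <= x 0 i <= if (i < m)%N then a else 1].

End cubical_sets.

(* Main.v *)
(* The hyperplanes of a cubical set X cut the cube into finitely many open cells,
   each contained in X or disjoint from X. The open faces between cells of
   different kinds lie in the essential boundary, so RelPer X is at least c times
   a weighted number of such faces, where c > 0 is the Hausdorff measure of a unit
   square; for a box [0, a]^m x [0, 1]^(3 - m), RelPer is at most c m a^(m - 1).
   This reduces the theorem to a combinatorial statement about cells.
   Slice X orthogonally to one axis, and let m <= M be the extreme areas of the
   slices. The faces orthogonal to the axis contribute at least M - m, and each
   slice of area v at least J(v) = min(1, 2 sqrt v, 2 sqrt (1 - v)), which is
   concave. Comparing the chord of J with the perimeters 1, 2 V^(1/2), 3 V^(2/3)
   of the boxes of volume V forces m = M or m = 0, and in both cases X is the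
   product of a slice with a subinterval of [0, 1] having 0 or 1 as an endpoint.
   Applying this to the three axes shows that X is a box at a corner of the cube;
   the equality case of the arithmetic-geometric mean inequality then gives equal
   side lengths. *)
Require Import Defs.
From mathcomp Require Import all_boot all_order all_algebra all_fingroup.
From mathcomp Require Import all_classical all_reals all_analysis.
From mathcomp Require Import measurable_realfun.
From mathcomp Require Import ring lra zify.
(* [edist] is also a constant of MathComp-Analysis. *)
Import Defs.

Set Implicit Arguments.
Unset Strict Implicit.
Unset Printing Implicit Defensive.

Import Order.TTheory GRing.Theory Num.Theory.
Import numFieldNormedType.Exports.

Local Open Scope classical_set_scope.
Local Open Scope ring_scope.

(** * The combinatorial isoperimetric inequality *)

(** Minimality is used against three competitors only: the boxes with [m = 1, 2, 3] whose side [a]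
    is [V], its square root or its cube root, whether or not [a <= 1/2]. All the rest, including the
    final bound on [a], is extracted from the three resulting upper bounds on the perimeter and from
    [V <= 1/2]. For [0 < m < M] the slicing bound, [M - m] plus the average of [J] over the slices,
    strictly exceeds the least of the three. For [m = 0] no strict inequality can hold, since boxes
    occur there; the shape is then read off from equality in every step of the estimate. Hausdorff
    measure enters through coverings alone. Upper bounds come from subadditivity, lower bounds from
    additivity on sets at positive distance. Adjacent faces touch, so they are shrunk by [e] before
    their areas are added, and [e] tends to 0. The cells determine a cubical set only off the grid
    planes. These are null, which is why the conclusion concerns a symmetric difference. *)

Definition jumps (q : nat) (T : nat -> bool) : nat :=
  (\sum_(j < q) (T j != T j.+1))%N.

Lemma jumps0 q (T : nat -> bool) : jumps q T = 0%N -> forall j, (j <= q)%N -> T j = T 0%N.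
Proof.
elim: q => [|q IH]; first by move=> _ [].
rewrite /jumps big_ord_recr /= => /eqP; rewrite addn_eq0 => /andP[/eqP /IH Tq].
rewrite eqb0 negbK => /eqP eqT j; rewrite leq_eqVlt => /predU1P[->|/Tq//].
by rewrite -eqT Tq.
Qed.

Lemma jumps_gt0 q (T : nat -> bool) i j : (i <= q)%N -> (j <= q)%N -> T i -> ~~ T j ->
  (0 < jumps q T)%N.
Proof.
move=> iq jq Ti Tj; rewrite lt0n; apply/eqP => /jumps0 T0.
by move: Tj; rewrite (T0 j)// -(T0 i)// Ti.
Qed.

(** A constant pattern is included: its switch [r] is placed at [q.+1], just beyond the last
    cell. *)
Lemma jumps_le1 q (T : nat -> bool) : (jumps q T <= 1)%N ->
  exists2 r, (0 < r <= q.+1)%N & forall j, (j <= q)%N -> T j = T 0%N (+) (r <= j)%N.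
Proof.
elim: q => [|q IH] Tq.
  by exists 1%N => // -[|//] _; rewrite addbF.
have [J0|J0] := eqVneq (jumps q T) 0%N.
  have Tc := jumps0 J0.
  have [eqT|neT] := eqVneq (T q) (T q.+1).
    exists q.+2; first by rewrite !leqnn.
    move=> j; rewrite leq_eqVlt => /predU1P[->|jq].
      by rewrite ltnn addbF -eqT Tc.
    by rewrite leqNgt (leq_trans jq)// addbF Tc.
  exists q.+1; first by rewrite /= leqnSn.
  move=> j; rewrite leq_eqVlt => /predU1P[->|jq].
    by rewrite leqnn addbT -(Tc q)//; case: (T q) (T q.+1) neT => [] [].
  by rewrite leqNgt jq addbF Tc.
move: Tq; rewrite /jumps big_ord_recr /=; rewrite -/(jumps q T) => Tq.
have /IH[r /andP[r0 rq] Tr] : (jumps q T <= 1)%N by lia.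
have eqT : T q = T q.+1.
  apply/eqP; apply: contraT => neT; move: Tq J0; rewrite neT; lia.
move: rq; rewrite leq_eqVlt => /predU1P[rq|rq].
  case/eqP: J0; rewrite /jumps big1// => j _; apply/eqP.
  have jq := ltn_ord j; rewrite eqb0 negbK (Tr _ (ltnW jq)) (Tr _ jq) rq.
  by rewrite [(q < j)%N]ltnNge [(q < j.+1)%N]ltnNge jq (ltnW jq).
exists r; first by rewrite r0 /=; lia.
move=> j; rewrite leq_eqVlt => /predU1P[->|jq]; last exact: Tr.
by rewrite ltnS in rq; rewrite -eqT Tr// rq (leqW rq).
Qed.

Section Discrete.
(* b j k l tells whether the cell (j, k, l) of a grid with spacings w belongs to
   the set. *)
Variables (R : rcfType) (q : nat) (w : nat -> R).
Hypothesis w_gt0 : forall j, (j <= q)%N -> 0 < w j.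
Hypothesis w_sum : \sum_(j < q.+1) w j = 1.

(* Perimeters of the strip, the corner square and its complement. *)
Definition profile2 (v : R) : R :=
  Num.min 1 (Num.min (2 * Num.sqrt v) (2 * Num.sqrt (1 - v))).

Definition area (a : nat -> nat -> bool) : R :=
  \sum_(j < q.+1) \sum_(k < q.+1) w j * w k * (a j k)%:R.

(** Only the [q] walls between cells count: sides on the boundary of the square are free, as for a
    relative perimeter. *)
Definition edges2 (a : nat -> nat -> bool) : R :=
  \sum_(k < q.+1) w k * (jumps q (a ^~ k))%:R.

Definition volume (b : nat -> nat -> nat -> bool) : R :=
  \sum_(j < q.+1) w j * area (b j).

Definition edges3 (b : nat -> nat -> nat -> bool) : R :=
  \sum_(k < q.+1) \sum_(l < q.+1) w k * w l * (jumps q (fun j => b j k l))%:R.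

Definition perimeter2 a := edges2 a + edges2 (fun j k => a k j).

Definition perimeter3 b :=
  edges3 b + edges3 (fun j k l => b k j l) + edges3 (fun j k l => b k l j).

Let w_ge0 (j : 'I_q.+1) : 0 <= w j.
Proof. by rewrite ltW// w_gt0// -ltnS. Qed.

Lemma sum_prod (F G : 'I_q.+1 -> R) :
  \sum_(j < q.+1) \sum_(k < q.+1) w j * w k * (F j * G k) =
  (\sum_(j < q.+1) w j * F j) * \sum_(k < q.+1) w k * G k.
Proof.
rewrite mulr_suml; apply: eq_bigr => j _; rewrite mulr_sumr.
by apply: eq_bigr => k _; ring.
Qed.

Lemma sum_weights2 : \sum_(j < q.+1) \sum_(k < q.+1) w j * w k = 1.
Proof.
rewrite -[RHS]mul1r -[in RHS]w_sum mulr_suml; apply: eq_bigr => j _.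
by rewrite mulr_sumr.
Qed.

Lemma area_ge0 a : 0 <= area a.
Proof. by do 2![apply: sumr_ge0 => ? _]; rewrite !mulr_ge0. Qed.

Lemma area_le1 a : area a <= 1.
Proof.
rewrite -sum_weights2; do 2![apply: ler_sum => ? _].
by rewrite ler_piMr ?mulr_ge0// lern1 leq_b1.
Qed.

(** The left-hand side is 1 exactly for a line meeting both the set and its complement, and such a
    line changes at least once. *)
Lemma jumps_lb (T : nat -> bool) :
  [exists j : 'I_q.+1, T j]%:R - [forall j : 'I_q.+1, T j]%:R <=
  (jumps q T)%:R :> R.
Proof.
have [/existsP[i Ti]|_] := boolP [exists j : 'I_q.+1, T j]; last first.
  by rewrite sub0r lerNl (le_trans (y := 0)) ?oppr_le0.
have [_|/forallPn[j Tj]] := boolP [forall j : 'I_q.+1, T j]; first by rewrite subrr.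
rewrite subr0 ler1n; by apply: (@jumps_gt0 _ _ i j) => //; rewrite -ltnS.
Qed.

Lemma edges2_ge0 a : 0 <= edges2 a.
Proof. by apply: sumr_ge0 => k _; rewrite mulr_ge0. Qed.

(** Summed with the weights, [colE] gives the length of the projection of the set along the columns,
    [colA] the total width of the full columns. *)
Let colE (a : nat -> nat -> bool) (k : nat) : R := [exists j : 'I_q.+1, a j k]%:R.
Let colA (a : nat -> nat -> bool) (k : nat) : R := [forall j : 'I_q.+1, a j k]%:R.

Lemma edges2_lb a : \sum_(k < q.+1) w k * colE a k - \sum_(k < q.+1) w k * colA a k
  <= edges2 a.
Proof.
rewrite -sumrB; apply: ler_sum => k _; rewrite -mulrBr ler_wpM2l//.
exact: jumps_lb.
Qed.

(** A full column meets every row. *)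
Lemma colA_row_full a : 0 < \sum_(k < q.+1) w k * colA a k ->
  \sum_(j < q.+1) w j * colE (fun j k => a k j) j = 1.
Proof.
move=> Q0; have [k /forallP ak] : exists k : 'I_q.+1, [forall j : 'I_q.+1, a j k].
  apply/existsP; apply: contraLR Q0 => /existsPn nk; rewrite -leNgt big1// => k _.
  by rewrite /colA (negbTE (nk k)) mulr0.
rewrite -w_sum; apply: eq_bigr => j _; rewrite /colE.
by case: existsP => [_|[]]; [rewrite mulr1|exists k].
Qed.

Lemma sqr_sum_ge (x y v : R) : 0 <= x -> 0 <= y -> 0 <= v -> v <= x * y ->
  2 * Num.sqrt v <= x + y.
Proof.
move=> x0 y0 v0 vxy.
have s0 := sqrtr_ge0 v; have /esym sE := sqr_sqrtr v0.
have : 4 * Num.sqrt v ^+ 2 <= (x + y) ^+ 2.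
  rewrite -sE -subr_ge0.
  have -> : (x + y) ^+ 2 - 4 * v = (x - y) ^+ 2 + 4 * (x * y - v) by ring.
  by rewrite addr_ge0 ?sqr_ge0// mulr_ge0// subr_ge0.
move=> H; rewrite -(@ler_pXn2r _ 2)// ?nnegrE ?addr_ge0 ?mulr_ge0//.
by rewrite exprMn; apply: le_trans H; rewrite -natrX.
Qed.

(** The set lies in the product of its projections, of lengths [P1] and [P2]; its complement lies in
    the product of the complements of the full columns and full rows, of lengths [1 - Q1] and
    [1 - Q2]. The perimeter is at least [(P1 - Q1) + (P2 - Q2)]. Without full lines, AM-GM for
    [P1 P2] applies; with full lines in one direction only, the other projection has length 1; with
    both, AM-GM applies to the complement. *)
Lemma perimeter2_ge_profile a : profile2 (area a) <= perimeter2 a.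
Proof.
set at' := fun j k => a k j.
pose P1 := \sum_(k < q.+1) w k * colE a k.
pose Q1 := \sum_(k < q.+1) w k * colA a k.
pose P2 := \sum_(k < q.+1) w k * colE at' k.
pose Q2 := \sum_(k < q.+1) w k * colA at' k.
have E1 : P1 - Q1 <= edges2 a := edges2_lb a.
have E2 : P2 - Q2 <= edges2 at' := edges2_lb at'.
have Q10 : 0 <= Q1 by apply: sumr_ge0 => k _; rewrite mulr_ge0.
have Q20 : 0 <= Q2 by apply: sumr_ge0 => k _; rewrite mulr_ge0.
have P10 : 0 <= P1 by apply: sumr_ge0 => k _; rewrite mulr_ge0.
have P20 : 0 <= P2 by apply: sumr_ge0 => k _; rewrite mulr_ge0.
have QP (f : nat -> R) : (forall k, 0 <= f k <= 1) ->
    \sum_(k < q.+1) w k * f k <= 1.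
  move=> f01; rewrite -w_sum; apply: ler_sum => k _.
  by rewrite ler_piMr//; case/andP: (f01 k).
have Q11 : Q1 <= 1 by apply: QP => k; rewrite /colA ler0n lern1 leq_b1.
have Q21 : Q2 <= 1 by apply: QP => k; rewrite /colA ler0n lern1 leq_b1.
have vP : area a <= P2 * P1.
  rewrite -sum_prod; apply: ler_sum => j _; apply: ler_sum => k _.
  rewrite ler_wpM2l ?mulr_ge0// /colE -natrM ler_nat mulnb.
  case ajk : (a j k) => //; rewrite lt0b.
  by apply/andP; split; apply/existsP; [exists k|exists j].
have vQ : 1 - area a <= (1 - Q2) * (1 - Q1).
  have -> : 1 - Q2 = \sum_(j < q.+1) w j * (1 - colA at' j).
    by rewrite -{1}w_sum -sumrB; apply: eq_bigr => j _; rewrite mulrBr mulr1.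
  have -> : 1 - Q1 = \sum_(j < q.+1) w j * (1 - colA a j).
    by rewrite -{1}w_sum -sumrB; apply: eq_bigr => j _; rewrite mulrBr mulr1.
  rewrite -sum_prod -{1}sum_weights2 -sumrB; apply: ler_sum => j _.
  rewrite -sumrB; apply: ler_sum => k _.
  rewrite -[X in X - _]mulr1 -mulrBr ler_wpM2l ?mulr_ge0// /colA.
  case ajk : (a j k).
    by rewrite subrr mulr_ge0// subr_ge0 lern1 leq_b1.
  have -> : [forall i : 'I_q.+1, at' i j] = false.
    by apply/forallP => /(_ k); rewrite /at' ajk.
  have -> : [forall i : 'I_q.+1, a i k] = false.
    by apply/forallP => /(_ j); rewrite ajk.
  by rewrite !subr0 mulr1.
rewrite /perimeter2 -/at' /profile2 !ge_min.
have [Q1z|Q1p] := eqVneq Q1 0; have [Q2z|Q2p] := eqVneq Q2 0.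
- apply/orP; right; apply/orP; left.
  have := sqr_sum_ge P20 P10 (area_ge0 a) vP; move: E1 E2; rewrite Q1z Q2z.
  lra.
- apply/orP; left; have : P1 = 1.
    by apply: (colA_row_full (a := at')); rewrite lt_def Q2p.
  move: E1 (edges2_ge0 at'); rewrite Q1z => ? ? ?; lra.
- apply/orP; left; have : P2 = 1.
    by apply: colA_row_full; rewrite lt_def Q1p.
  move: E2 (edges2_ge0 a); rewrite Q2z => ? ? ?; lra.
- have P2E : P2 = 1 by apply: colA_row_full; rewrite lt_def Q1p.
  have P1E : P1 = 1.
    by apply: (colA_row_full (a := at')); rewrite lt_def Q2p.
  apply/orP; right; apply/orP; right.
  have := @sqr_sum_ge (1 - Q2) (1 - Q1) (1 - area a).
  rewrite !subr_ge0 => /(_ Q21 Q11 (area_le1 a) vQ); lra.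
Qed.

End Discrete.

(* A, B and D stand for the square roots of the least slice area m, of the
   greatest slice area M and of 1 - M; s and t for the square root and the cube
   root of the volume. *)
Section Gap.
Variable R : rcfType.
Implicit Types A B D M V P s t m : R.

(* As a function of A, the perimeter bound is concave on [0, s], with values at
   least 3 t^2 at A = 0 and 2 s at A = s. *)
Lemma gap_low_low A B s t P : 0 < A -> A < B -> A <= s -> s <= B -> 0 <= t ->
  t ^+ 3 = s ^+ 2 -> P <= 2 * s -> P <= 3 * t ^+ 2 ->
  P * (B ^+ 2 - A ^+ 2) <
  (B ^+ 2 - s ^+ 2) * (2 * A) + (s ^+ 2 - A ^+ 2) * (2 * B) +
    (B ^+ 2 - A ^+ 2) ^+ 2.
Proof.
move=> A0 AB As sB t0 ts Ps Pt.
have s0 : 0 < s by apply: lt_le_trans As.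
have B0 : 0 < B by apply: lt_trans AB.
rewrite -subr_gt0.
have -> : (B ^+ 2 - s ^+ 2) * (2 * A) + (s ^+ 2 - A ^+ 2) * (2 * B) +
    (B ^+ 2 - A ^+ 2) ^+ 2 - P * (B ^+ 2 - A ^+ 2) =
  (B - A) * (2 * (A * B + s ^+ 2) + (A + B) * (B ^+ 2 - A ^+ 2) - P * (A + B)).
  by ring.
rewrite pmulr_rgt0; last by rewrite subr_gt0.
(* The product below is the defect in AM-GM for [B ^+ 3], [t ^+ 3], [t ^+ 3]. *)
have PB : 0 <= B ^+ 3 + 2 * s ^+ 2 - P * B.
  have : 0 <= (B - t) ^+ 2 * (B + 2 * t).
    by rewrite mulr_ge0 ?sqr_ge0// addr_ge0 ?mulr_ge0// ltW.
  have -> : (B - t) ^+ 2 * (B + 2 * t) = B ^+ 3 + 2 * t ^+ 3 - 3 * t ^+ 2 * B.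
    by ring.
  rewrite ts => /le_trans; apply; rewrite lerB// ler_wpM2r//; exact: ltW.
(* Interpolation between [A = 0] and [A = s] with denominators cleared: the first summand carries
   the value at [A = 0], the second the bound [P <= 2 * s] at [A = s], and the other two are a
   nonnegative surplus. *)
rewrite -(@pmulr_rgt0 _ (s * B)); last by rewrite mulr_gt0.
have -> : s * B * (2 * (A * B + s ^+ 2) + (A + B) * (B ^+ 2 - A ^+ 2)
      - P * (A + B)) =
    (A + B) * (s - A) * (B ^+ 3 + 2 * s ^+ 2 - P * B)
  + (A + B) * B * A * (2 * s - P)
  + (A + B) * B * A * ((B - s) * (B + s) + s * (s - A))
  + 2 * s * A * ((B - s) * (s - A)) by ring.
have h0 : 0 < A + B by rewrite addr_gt0.
have sA : 0 <= s - A by rewrite subr_ge0.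
have Bs : 0 <= B - s by rewrite subr_ge0.
have k0 : 0 < (A + B) * B * A by rewrite !mulr_gt0.
have k1 : 0 < B + s by rewrite addr_gt0.
have H : 0 < (B - s) * (B + s) + s * (s - A).
  have [<-|nsA] := eqVneq A s.
    by rewrite subrr mulr0 addr0 mulr_gt0 ?subr_gt0// addr_gt0.
  apply: ltr_wpDl; first by rewrite mulr_ge0// ltW.
  by rewrite mulr_gt0// subr_gt0 lt_def eq_sym nsA.
have c1 : 0 <= (A + B) * (s - A) * (B ^+ 3 + 2 * s ^+ 2 - P * B).
  by rewrite !mulr_ge0// ltW.
have c2 : 0 <= (A + B) * B * A * (2 * s - P).
  by rewrite mulr_ge0// ?subr_ge0// ltW.
have c3 : 0 < (A + B) * B * A * ((B - s) * (B + s) + s * (s - A)).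
  by rewrite mulr_gt0.
have c4 : 0 <= 2 * s * A * ((B - s) * (s - A)).
  by rewrite !mulr_ge0// ltW.
by rewrite ltr_wpDr// ltr_wpDl// addr_ge0.
Qed.

(** For [s < 1/2], replacing [P] by [2 s] leaves the difference [(M - A^2 - (s - A))^2 + 2 A (s - A)
    (1 - s - A)]. For [s >= 1/2], replacing [P] by 1 leaves [(M - A^2)^2 > (M - s^2) (1 - 2 A)],
    which follows from AM-GM for the summands [M - 1/4] and [1/4 - A^2] of [M - A^2]. *)
Lemma gap_low_mid A M s P : 0 < A -> A <= 2^-1 -> A <= s -> s ^+ 2 <= M ->
  4^-1 <= M -> A ^+ 2 < M -> P <= 1 -> P <= 2 * s ->
  P * (M - A ^+ 2) <
  (M - s ^+ 2) * (2 * A) + (s ^+ 2 - A ^+ 2) + (M - A ^+ 2) ^+ 2.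
Proof.
move=> A0 A2 As sM M4 AM P1 Ps.
rewrite ltNge; apply/negP => H.
have h0 : 0 < M - A ^+ 2 by rewrite subr_gt0.
have hh : 0 < (M - A ^+ 2) ^+ 2 by rewrite exprn_gt0.
have [s2|s2] := lerP (2^-1) s.
  have w0 : 0 <= M - 4^-1 by rewrite subr_ge0.
  have e0 : 0 <= 2^-1 - A by rewrite subr_ge0.
  have H1 : (M - A ^+ 2) ^+ 2 <= (M - s ^+ 2) * (2 * (2^-1 - A)).
    have := ler_wpM2r (ltW h0) P1; lra.
  have H2 : (M - s ^+ 2) * (2 * (2^-1 - A)) <= (M - 4^-1) * (2 * (2^-1 - A)).
    rewrite ler_wpM2r ?mulr_ge0// lerB//.
    have : 0 <= (s - 2^-1) * (s + 2^-1) by rewrite mulr_ge0; lra.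
    lra.
  have H3 : 0 < (M - 4^-1) * (2^-1 - A) by lra.
  have H4 : 0 < (M - 4^-1) * (2^-1 - A) * A by rewrite mulr_gt0.
  have H5 := sqr_ge0 (M - 4^-1 - (2^-1 - A) + (2^-1 - A) ^+ 2).
  lra.
have d0 : 0 <= s - A by rewrite subr_ge0.
have H1 := ler_wpM2r (ltW h0) Ps.
have H2 := sqr_ge0 (M - A ^+ 2 - (s - A)).
have [E|nE] := eqVneq A s.
  by move: H H1 H2; rewrite E in h0 hh *; lra.
have d1 : 0 < s - A by rewrite subr_gt0 lt_def eq_sym nE.
have H3 : 0 < A * (s - A) * (1 - s - A) by rewrite !mulr_gt0//; lra.
lra.
Qed.

Lemma gap_low_high A D s P : 0 < A -> A <= 2^-1 -> A <= s -> s ^+ 2 <= 2^-1 ->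
  0 <= s -> 0 <= D -> D <= 2^-1 -> P <= 1 -> P <= 2 * s ->
  P * (1 - D ^+ 2 - A ^+ 2) <
  (1 - D ^+ 2 - s ^+ 2) * (2 * A) + (s ^+ 2 - A ^+ 2) * (2 * D) +
    (1 - D ^+ 2 - A ^+ 2) ^+ 2.
Proof.
move=> A0 A2 As V2 s0 D0 D2 P1 Ps.
rewrite ltNge; apply/negP => H.
have AA : A ^+ 2 <= A / 2 by rewrite expr2 ler_wpM2l// ltW.
have DD : D ^+ 2 <= D / 2 by rewrite expr2 ler_wpM2l.
have AD : A * D <= 4^-1.
  by apply: le_trans (ler_pM (ltW A0) D0 A2 D2) _; lra.
have ADD : A * D * (A + D) <= (A + D) / 4.
  by rewrite mulrC ler_wpM2l// addr_ge0// ltW.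
have ADA : A * D * (A + D) <= A * D.
  by apply: ler_piMr; [rewrite mulr_ge0// ltW|lra].
have ADh : A * D <= A / 2 by rewrite ler_wpM2l// ltW.
have p2 : 0 < (A ^+ 2 + D ^+ 2) ^+ 2.
  by rewrite exprn_gt0// ltr_wpDr ?sqr_ge0// exprn_gt0.
set p := A ^+ 2 + D ^+ 2 in p2.
(* For [P = 1] the difference of the two sides is affine in [s ^+ 2]; [E0] and [E1] are its values
   at 1/4 and 1/2. *)
pose E1 := (A + D) * (1 - 2 * (A * D)) - p + p ^+ 2.
pose E0 := 3 / 2 * A + D / 2 - p - 2 * (A * D * (A + D)) + p ^+ 2.
have E1p : 0 < E1 by rewrite /E1 /p in p2 *; lra.
have E0p : 0 < E0 by rewrite /E0 /p in p2 *; lra.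
have h0 : 0 < 1 - D ^+ 2 - A ^+ 2 by lra.
have [V4|V4] := lerP (4^-1) (s ^+ 2).
  have := ler_wpM2r (ltW h0) P1 => H1.
  have c0 : 0 <= E0 * (2 - 4 * s ^+ 2) by apply: mulr_ge0; [exact: ltW|lra].
  have c1 : 0 <= E1 * (4 * s ^+ 2 - 1) by apply: mulr_ge0; [exact: ltW|lra].
  have c : 0 < E0 * (2 - 4 * s ^+ 2) + E1 * (4 * s ^+ 2 - 1).
    have [V2'|V2'] := ltrP (s ^+ 2) (2^-1).
      by rewrite ltr_wpDr// mulr_gt0//; lra.
    by rewrite ltr_wpDl// mulr_gt0//; lra.
  by move: c; rewrite /E0 /E1 /p; lra.
(* The tangent at 1/4 to [2 * s] as a function of [s ^+ 2]. It keeps the difference affine in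
   [s ^+ 2], now between its values at [A ^+ 2] and 1/4, which are the factors in [c1] and [c0]. *)
have Ps' : P <= 2 * s ^+ 2 + 2^-1 by have := sqr_ge0 (s - 2^-1); lra.
have H1 := ler_wpM2r (ltW h0) Ps'.
have yA : A ^+ 2 <= s ^+ 2.
  by rewrite ler_pXn2r// nnegrE ltW.
have c0 : 0 <= E0 * (s ^+ 2 - A ^+ 2) by rewrite mulr_ge0 ?subr_ge0// ltW.
have c1 : 0 < (1 - D ^+ 2 - A ^+ 2) *
   (2^-1 - 3 * A ^+ 2 + 2 * A - D ^+ 2) * (4^-1 - s ^+ 2).
  by rewrite !mulr_gt0//; lra.
have c2 : 0 <= (P * (1 - D ^+ 2 - A ^+ 2) - ((1 - D ^+ 2 - s ^+ 2) * (2 * A)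
   + (s ^+ 2 - A ^+ 2) * (2 * D) + (1 - D ^+ 2 - A ^+ 2) ^+ 2)) *
   (4^-1 - A ^+ 2).
  by rewrite mulr_ge0 ?subr_ge0//; lra.
have c3 : 0 <= ((2 * s ^+ 2 + 2^-1) * (1 - D ^+ 2 - A ^+ 2) -
   P * (1 - D ^+ 2 - A ^+ 2)) * (4^-1 - A ^+ 2).
  by rewrite mulr_ge0 ?subr_ge0//; lra.
move: c0 c1 c2 c3; rewrite /E0 /p; lra.
Qed.

(** With [P <= 1] the claim becomes [(V - m) (1 - 2 D) < (1 - D^2 - m)^2]. For [x = 1/2 - m], the
    left side is at most [x], the base on the right is at least [x + 1/4], and
    [(x + 1/4)^2 - x = (x - 1/4)^2]. Strictness comes from [D < 1/2]; for [D = 1/2] the left side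
    vanishes. *)
Lemma gap_mid_high m D V P : m <= V -> V <= 2^-1 -> m < 1 - D ^+ 2 ->
  0 <= D -> D <= 2^-1 -> P <= 1 ->
  P * (1 - D ^+ 2 - m) <
  (1 - D ^+ 2 - V) + (V - m) * (2 * D) + (1 - D ^+ 2 - m) ^+ 2.
Proof.
move=> mV V2 mD D0 D2 P1; rewrite ltNge; apply/negP => H.
have h0 : 0 < 1 - D ^+ 2 - m by rewrite subr_gt0.
have := ler_wpM2r (ltW h0) P1 => H1.
have hh : 0 < (1 - D ^+ 2 - m) ^+ 2 by rewrite exprn_gt0.
have DD : D ^+ 2 <= D / 2 by rewrite expr2 ler_wpM2l.
have [E|nE] := eqVneq D 2^-1.
  by move: H H1 hh; rewrite E; lra.
have D2' : D < 2^-1 by rewrite lt_def eq_sym nE.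
have : (V - m) * (1 - 2 * D) <= (2^-1 - m) * 1.
  by rewrite ler_pM ?subr_ge0//; lra.
have : 0 < (1 - D ^+ 2 - m - (2^-1 - m + 4^-1)) * (1 - D ^+ 2 - m + (2^-1 - m + 4^-1)).
  by rewrite mulr_gt0//; lra.
have := sqr_ge0 (2^-1 - m - 4^-1).
lra.
Qed.

End Gap.

(** * Concavity of the planar profile and its comparison with boxes *)

Section Profile.
Variable R : rcfType.
Implicit Types m M v V P s t : R.

Lemma sqrt_half_le (v : R) : v <= 4^-1 -> 2 * Num.sqrt v <= 1.
Proof.
move=> v4; have : Num.sqrt v <= Num.sqrt (4^-1) by exact: ler_wsqrtr.
have -> : 4^-1 = 2^-1 ^+ 2 :> R by field.
by rewrite sqrtr_sqr ger0_norm ?invr_ge0//; lra.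
Qed.

Lemma sqrt_half_ge (v : R) : 4^-1 <= v -> 1 <= 2 * Num.sqrt v.
Proof.
move=> v4; have : Num.sqrt (4^-1) <= Num.sqrt v by exact: ler_wsqrtr.
have -> : 4^-1 = 2^-1 ^+ 2 :> R by field.
by rewrite sqrtr_sqr ger0_norm ?invr_ge0//; lra.
Qed.

Lemma profile2_low v : v <= 4^-1 -> profile2 v = 2 * Num.sqrt v.
Proof.
move=> v4; have h1 := sqrt_half_le v4.
have h2 : 1 <= 2 * Num.sqrt (1 - v) by apply: sqrt_half_ge; lra.
by rewrite /profile2 [X in Num.min 1 X]min_l ?min_r//; apply: le_trans h2.
Qed.

Lemma profile2_mid v : 4^-1 <= v -> v <= 3 / 4 -> profile2 v = 1.
Proof.
move=> v4 v3; have h1 := sqrt_half_ge v4.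
have h2 : 1 <= 2 * Num.sqrt (1 - v) by apply: sqrt_half_ge; lra.
by rewrite /profile2 min_l// le_min h1.
Qed.

Lemma profile2_high v : 3 / 4 <= v -> profile2 v = 2 * Num.sqrt (1 - v).
Proof.
move=> v3; have h1 : 2 * Num.sqrt (1 - v) <= 1 by apply: sqrt_half_le; lra.
have h2 : 1 <= 2 * Num.sqrt v by apply: sqrt_half_ge; lra.
by rewrite /profile2 [X in Num.min 1 X]min_r ?min_r//; apply: le_trans h2.
Qed.

Lemma profile2_le v : [/\ profile2 v <= 1, profile2 v <= 2 * Num.sqrt v
  & profile2 v <= 2 * Num.sqrt (1 - v)].
Proof. by rewrite /profile2 !ge_min !lexx ?orbT. Qed.

(** Concavity without division: in terms of the roots [a <= b <= c], the defect is
    [(c - b) (b - a) (c - a)]. *)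
Lemma sqrt_chord m v M : 0 <= m -> m <= v -> v <= M ->
  (M - v) * Num.sqrt m + (v - m) * Num.sqrt M <= (M - m) * Num.sqrt v.
Proof.
move=> m0 mv vM; have v0 := le_trans m0 mv; have M0 := le_trans v0 vM.
have ab : Num.sqrt m <= Num.sqrt v by exact: ler_wsqrtr.
have bc : Num.sqrt v <= Num.sqrt M by exact: ler_wsqrtr.
rewrite -[X in (X - v) * _]sqr_sqrtr// -[X in (_ - X) * Num.sqrt m]sqr_sqrtr//.
rewrite -[X in (X - m) * Num.sqrt M]sqr_sqrtr//.
rewrite -[X in (_ - X) * Num.sqrt M]sqr_sqrtr//.
rewrite -[X in (X - m) * Num.sqrt v]sqr_sqrtr//.
rewrite -[X in (_ - X) * Num.sqrt v]sqr_sqrtr//.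
set a := Num.sqrt m in ab *; set b := Num.sqrt v in ab bc *.
set c := Num.sqrt M in bc *; rewrite -subr_ge0.
have -> : (c ^+ 2 - a ^+ 2) * b - ((c ^+ 2 - b ^+ 2) * a + (b ^+ 2 - a ^+ 2) * c)
  = (c - b) * (b - a) * (c - a) by ring.
by rewrite !mulr_ge0 ?subr_ge0// (le_trans ab).
Qed.

(** A minimum of concave functions is concave: each branch at [v] is compared with the same branch
    at [m] and [M]. *)
Lemma profile2_chord m v M : 0 <= m -> m <= v -> v <= M -> M <= 1 ->
  (M - v) * profile2 m + (v - m) * profile2 M <= (M - m) * profile2 v.
Proof.
move=> m0 mv vM M1.
have [am bm cm] := profile2_le m; have [aM bM cM] := profile2_le M.
have vM' : 0 <= M - v by rewrite subr_ge0.
have mv' : 0 <= v - m by rewrite subr_ge0.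
have mM' : 0 <= M - m by rewrite subr_ge0 (le_trans mv).
move: (profile2 m) (profile2 M) am bm cm aM bM cM => x y am bm cm aM bM cM.
rewrite /profile2 !minr_pMr// !le_min; apply/and3P; split.
- apply: le_trans (lerD (ler_wpM2l vM' am) (ler_wpM2l mv' aM)) _; lra.
- apply: le_trans (lerD (ler_wpM2l vM' bm) (ler_wpM2l mv' bM)) _.
  have := sqrt_chord m0 mv vM; lra.
- apply: le_trans (lerD (ler_wpM2l vM' cm) (ler_wpM2l mv' cM)) _.
  have := @sqrt_chord (1 - M) (1 - v) (1 - m); lra.
Qed.

(** Divided by [v], each of the three branches decreases strictly. The strictness later forces every
    slice to be empty or of maximal area. *)
Lemma profile2_star v M : 0 < v -> v < M -> M <= 1 ->
  v * profile2 M < M * profile2 v.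
Proof.
move=> v0 vM M1; have [aM bM cM] := profile2_le M.
have M0 := lt_trans v0 vM.
move: (profile2 M) aM bM cM => z aM bM cM.
rewrite /profile2 !minr_pMr ?(ltW M0)// !lt_min.
have key (x y : R) : z <= x -> x <= y -> 0 < y -> v * z < M * y.
  move=> Px xy y0; apply: (@le_lt_trans _ _ (v * y)).
    by rewrite ler_wpM2l ?(ltW v0)// (le_trans Px).
  by rewrite ltr_pM2r.
apply/and3P; split.
- by apply: key aM _ _.
- apply: (@le_lt_trans _ _ (v * (2 * Num.sqrt M))).
    by rewrite ler_wpM2l// ltW.
  have -> : v * (2 * Num.sqrt M) = 2 * (Num.sqrt v ^+ 2 * Num.sqrt M).
    by rewrite sqr_sqrtr ?(ltW v0)//; ring.
  have -> : M * (2 * Num.sqrt v) = 2 * (Num.sqrt M ^+ 2 * Num.sqrt v).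
    by rewrite sqr_sqrtr ?(ltW M0)//; ring.
  have sv : 0 < Num.sqrt v by rewrite sqrtr_gt0.
  have sM : 0 < Num.sqrt M by rewrite sqrtr_gt0.
  have svM : Num.sqrt v < Num.sqrt M by rewrite ltr_sqrt.
  have : 0 < Num.sqrt v * Num.sqrt M * (Num.sqrt M - Num.sqrt v).
    by rewrite !mulr_gt0// subr_gt0.
  lra.
- apply: key cM _ _; last by rewrite mulr_gt0// sqrtr_gt0 subr_gt0 (lt_le_trans vM).
  by rewrite ler_wpM2l// ler_wsqrtr//; lra.
Qed.

(** Divided by [M - m], the right-hand side is the value at [V] of the chord of [profile2], plus
    [M - m]. The cases are cut at 1/4 and 3/4, where [profile2] changes branch; [m <= V <= 1/2]
    keeps [m] out of the last range. *)
Lemma chord_gap m V M s t P : 0 < m -> m <= V -> V <= M -> m < M -> M <= 1 ->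
  V <= 2^-1 -> 0 <= s -> 0 <= t -> s ^+ 2 = V -> t ^+ 3 = V ->
  P <= 1 -> P <= 2 * s -> P <= 3 * t ^+ 2 ->
  P * (M - m) < (M - V) * profile2 m + (V - m) * profile2 M + (M - m) ^+ 2.
Proof.
move=> m0 mV VM mM M1 V2 s0 t0 sV tV P1 Ps Pt.
have V0 : 0 < V := lt_le_trans m0 mV; have M0 : 0 < M := lt_le_trans V0 VM.
have mA : Num.sqrt m ^+ 2 = m by rewrite sqr_sqrtr// ltW.
have MB : Num.sqrt M ^+ 2 = M by rewrite sqr_sqrtr// ltW.
have MD : Num.sqrt (1 - M) ^+ 2 = 1 - M by rewrite sqr_sqrtr// subr_ge0.
have A0 : 0 < Num.sqrt m by rewrite sqrtr_gt0.
have AB : Num.sqrt m < Num.sqrt M by rewrite ltr_sqrt.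
have D0 := sqrtr_ge0 (1 - M).
have sE : s = Num.sqrt V by rewrite -sV sqrtr_sqr ger0_norm.
have As : Num.sqrt m <= s by rewrite sE ler_wsqrtr.
have sB : s <= Num.sqrt M by rewrite sE ler_wsqrtr.
have [m4|m4] := lerP m 4^-1.
  have A2 : Num.sqrt m <= 2^-1 by have := sqrt_half_le m4; lra.
  rewrite (profile2_low m4).
  have [M4|M4] := lerP M 4^-1.
    rewrite (profile2_low M4).
    have := @gap_low_low _ (Num.sqrt m) (Num.sqrt M) s t P A0 AB As sB t0.
    by rewrite sV tV => /(_ erefl Ps Pt); rewrite mA MB.
  have [M3|M3] := lerP M (3 / 4).
    rewrite (profile2_mid (ltW M4) M3) mulr1.
    have := @gap_low_mid _ (Num.sqrt m) M s P A0 A2 As.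
    by rewrite sV mA => /(_ VM (ltW M4) mM P1 Ps).
  have D2 : Num.sqrt (1 - M) <= 2^-1 by have := @sqrt_half_le (1 - M); lra.
  rewrite (profile2_high (ltW M3)).
  have := @gap_low_high _ (Num.sqrt m) (Num.sqrt (1 - M)) s P A0 A2 As.
  by rewrite sV mA MD subKr => /(_ V2 s0 D0 D2 P1 Ps).
rewrite (profile2_mid (ltW m4)); last by lra.
have [M3|M3] := lerP M (3 / 4).
  rewrite profile2_mid//; last by lra.
  have h : 0 < M - m by rewrite subr_gt0.
  have := ler_wpM2r (ltW h) P1; have : 0 < (M - m) ^+ 2 by rewrite exprn_gt0.
  lra.
have D2 : Num.sqrt (1 - M) <= 2^-1 by have := @sqrt_half_le (1 - M); lra.
rewrite (profile2_high (ltW M3)) mulr1.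
have := @gap_mid_high _ m (Num.sqrt (1 - M)) V P mV V2.
by rewrite MD subKr => /(_ mM D0 D2 P1).
Qed.

(** The chord through the origin. The inequality is weak because boxes attain it: a small cube of
    side [t] has [M = t^2] and [P = 3 t^2]. For small [M] the defect is again that of AM-GM; for
    middle [M] it is [(M - s)^2]. *)
Lemma star_gap V M s t P : 0 < V -> V <= M -> M <= 1 ->
  V <= 2^-1 -> 0 <= s -> 0 <= t -> s ^+ 2 = V -> t ^+ 3 = V ->
  P <= 1 -> P <= 2 * s -> P <= 3 * t ^+ 2 ->
  P * M <= M ^+ 2 + V * profile2 M.
Proof.
move=> V0 VM M1 V2 s0 t0 sV tV P1 Ps Pt.
have M0 : 0 < M := lt_le_trans V0 VM.
have [M4|M4] := lerP M 4^-1.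
  rewrite (profile2_low M4).
  have B0 : 0 < Num.sqrt M by rewrite sqrtr_gt0.
  have ME : Num.sqrt M ^+ 2 = M by rewrite sqr_sqrtr// ltW.
  apply: (@le_trans _ _ (3 * t ^+ 2 * M)); first by rewrite ler_wpM2r// ltW.
  rewrite -tV -ME sqrtr_sqr ger0_norm ?sqrtr_ge0//.
  set B := Num.sqrt M in B0 *; rewrite -subr_ge0.
  have -> : (B ^+ 2) ^+ 2 + t ^+ 3 * (2 * B) - 3 * t ^+ 2 * B ^+ 2 =
    B * ((B - t) ^+ 2 * (B + 2 * t)) by ring.
  by apply: mulr_ge0; [exact: ltW|apply: mulr_ge0; [exact: sqr_ge0|lra]].
have [M3|M3] := lerP M (3 / 4).
  rewrite (profile2_mid (ltW M4) M3).
  have := ler_wpM2r (ltW M0) Ps; have := sqr_ge0 (M - s); lra.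
have DD : Num.sqrt (1 - M) ^+ 2 = 1 - M by rewrite sqr_sqrtr// subr_ge0.
have D2 : Num.sqrt (1 - M) <= 2^-1 by have := @sqrt_half_le (1 - M); lra.
rewrite (profile2_high (ltW M3)).
have D0 := sqrtr_ge0 (1 - M).
set D := Num.sqrt (1 - M) in DD D2 D0 *.
have D2' : D ^+ 2 <= D / 2 by rewrite expr2 ler_wpM2l.
have ME : M = 1 - D ^+ 2 by lra.
have DM : D ^+ 2 * M <= D ^+ 2 by rewrite ler_piMr ?sqr_ge0.
have [V4|V4] := lerP 4^-1 V.
  have := ler_wpM2r (ltW M0) P1.
  have : 0 <= (V - 4^-1) * D by rewrite mulr_ge0 ?subr_ge0.
  move: DM; rewrite ME; lra.
(* The tangent at [V = 1/4] again, so that only polynomials in [V] and [D] remain. *)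
have Ps' : P <= 2 * V + 2^-1 by have := sqr_ge0 (s - 2^-1); lra.
have := ler_wpM2r (ltW M0) Ps'.
have : 0 <= (4^-1 - V) * M * (M - 2^-1).
  by rewrite mulr_ge0 ?mulr_ge0 ?subr_ge0// ltW//; lra.
have : 0 <= V * (D / 2 - D ^+ 2 * M) by apply: mulr_ge0; [exact: ltW|lra].
move: DM; rewrite ME; lra.
Qed.

End Profile.

(** * Slices of a minimal pattern *)

Section Slicing.
Variables (R : rcfType) (q : nat) (w : nat -> R).
Hypothesis w_gt0 : forall j, (j <= q)%N -> 0 < w j.
Hypothesis w_sum : \sum_(j < q.+1) w j = 1.

Let w_gt0' (j : 'I_q.+1) : 0 < w j.
Proof. by rewrite w_gt0// -ltnS. Qed.

Let w_ge0 (j : 'I_q.+1) : 0 <= w j.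
Proof. exact: ltW. Qed.

Notation area := (area q w).
Notation edges2 := (edges2 q w).
Notation edges3 := (edges3 q w).
Notation volume := (volume q w).
Notation perimeter2 := (perimeter2 q w).
Notation perimeter3 := (perimeter3 q w).

Implicit Type b : nat -> nat -> nat -> bool.

Lemma wsum_eq0 (F : 'I_q.+1 -> R) : (forall j, 0 <= F j) ->
  \sum_(j < q.+1) w j * F j <= 0 -> forall j, F j = 0.
Proof.
move=> F0 S0 j; have S0' : \sum_(j < q.+1) w j * F j = 0.
  by apply/eqP; rewrite eq_le S0/= sumr_ge0// => i _; rewrite mulr_ge0.
have : w j * F j = 0 by apply: (psumr_eq0P _ S0') => // i _; rewrite mulr_ge0.
by move/eqP; rewrite mulf_eq0 gt_eqF//= => /eqP.
Qed.

Lemma wsum2_eq0 (F : 'I_q.+1 -> 'I_q.+1 -> R) : (forall k l, 0 <= F k l) ->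
  \sum_(k < q.+1) \sum_(l < q.+1) w k * w l * F k l <= 0 ->
  forall k l, F k l = 0.
Proof.
move=> F0 S0 k; apply: wsum_eq0 => // .
rewrite (_ : \sum_(l < q.+1) w l * F k l = 0)//.
apply: (@wsum_eq0 (fun k => \sum_(l < q.+1) w l * F k l)).
  by move=> k'; apply: sumr_ge0 => l _; rewrite mulr_ge0.
apply: le_trans S0; rewrite le_eqVlt; apply/predU1P; left.
by apply: eq_bigr => i _; rewrite mulr_sumr; apply: eq_bigr => j _; rewrite mulrA.
Qed.

Lemma edges3_swap b : edges3 (fun j k l => b j l k) = edges3 b.
Proof.
rewrite /edges3 exchange_big; apply: eq_bigr => k _; apply: eq_bigr => l _.
by rewrite [w l * _]mulrC.
Qed.

(** Lets the slicing argument, stated for the first axis, be applied to the others. *)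
Lemma perimeter3_rot b : perimeter3 (fun j k l => b k j l) = perimeter3 b.
Proof.
rewrite /perimeter3 -(edges3_swap (fun j k l => b l k j)).
by rewrite [X in X + _]addrC.
Qed.

Lemma perimeter3_rot2 b : perimeter3 (fun j k l => b k l j) = perimeter3 b.
Proof.
rewrite /perimeter3 -(edges3_swap (fun j k l => b l j k)).
rewrite -(edges3_swap (fun j k l => b j l k)).
by rewrite -addrA addrC.
Qed.

Lemma volumeE b : volume b =
  \sum_(j < q.+1) \sum_(k < q.+1) \sum_(l < q.+1) w j * w k * w l * (b j k l)%:R.
Proof.
apply: eq_bigr => j _; rewrite mulr_sumr; apply: eq_bigr => k _.
by rewrite mulr_sumr; apply: eq_bigr => l _; rewrite !mulrA.
Qed.

Lemma volume_rot b : volume (fun j k l => b k j l) = volume b.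
Proof.
rewrite !volumeE exchange_big; apply: eq_bigr => j _; apply: eq_bigr => k _.
by apply: eq_bigr => l _; rewrite [w k * _]mulrC.
Qed.

Lemma volume_swap b : volume (fun j k l => b j l k) = volume b.
Proof.
rewrite !volumeE; apply: eq_bigr => j _; rewrite exchange_big.
by apply: eq_bigr => k _; apply: eq_bigr => l _; rewrite [w j * w l * _]mulrAC.
Qed.

Lemma volume_rot2 b : volume (fun j k l => b k l j) = volume b.
Proof. by rewrite -(volume_swap b) -(volume_rot (fun j k l => b j l k)). Qed.

(** A face parallel to the slicing axis appears as an edge of the slices that it crosses. *)
Lemma sum_perimeter2 b : \sum_(j < q.+1) w j * perimeter2 (b j) =
  edges3 (fun j k l => b k j l) + edges3 (fun j k l => b k l j).
Proof.
rewrite /edges3 -big_split; apply: eq_bigr => k _.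
rewrite /perimeter2 mulrDr /edges2 !mulr_sumr; congr (_ + _);
by apply: eq_bigr => l _; rewrite mulrA.
Qed.

Lemma area_sub (a a' : nat -> nat -> bool) : area a - area a' =
  \sum_(k < q.+1) \sum_(l < q.+1) w k * w l * ((a k l)%:R - (a' k l)%:R).
Proof.
rewrite -sumrB; apply: eq_bigr => k _; rewrite -sumrB; apply: eq_bigr => l _.
by rewrite mulrBr.
Qed.

Lemma jumps_ge (T : nat -> bool) (i j : 'I_q.+1) :
  (T i)%:R - (T j)%:R <= (jumps q T)%:R :> R.
Proof.
have [Ti|_] := boolP (T i); last by rewrite sub0r lerNl (le_trans (y := 0)) ?oppr_le0.
have [_|Tj] := boolP (T j); first by rewrite subrr.
by rewrite subr0 ler1n; apply: (@jumps_gt0 _ _ i j) => //; rewrite -ltnS.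
Qed.

(** Every line that is inside the set at level [i] and outside at level [j] has a jump. *)
Lemma edges3_ge b (i j : 'I_q.+1) : area (b i) - area (b j) <= edges3 b.
Proof.
rewrite area_sub; apply: ler_sum => k _; apply: ler_sum => l _.
rewrite ler_wpM2l ?mulr_ge0//.
exact: (jumps_ge (fun j => b j k l)).
Qed.

Lemma area_eq0 a : area a = 0 -> forall k l : 'I_q.+1, ~~ a k l.
Proof.
move=> a0 k l; have := @wsum2_eq0 (fun k l => (a k l)%:R).
rewrite -/(area a) a0 => /(_ (fun _ _ => ler0n _ _) (lexx _) k l)/eqP.
by rewrite pnatr_eq0 eqb0.
Qed.

(** [U] is the common shape of the nonempty slices and [T] selects their levels; a single jump at
    most means that these levels fill an interval ending at a face of the cube. *)
Lemma minimal_slices b (V s t : R) : 0 < V -> V <= 2^-1 ->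
  0 <= s -> s ^+ 2 = V -> 0 <= t -> t ^+ 3 = V -> volume b = V ->
  perimeter3 b <= 1 -> perimeter3 b <= 2 * s -> perimeter3 b <= 3 * t ^+ 2 ->
  exists T U, (jumps q T <= 1)%N /\
    forall j k l : 'I_q.+1, b j k l = T j && U k l.
Proof.
move=> V_gt0 V_half s_ge0 s2 t_ge0 t3 bV P1 Ps Pt.
have VV : V <= 1 - V by lra.
pose v (j : 'I_q.+1) := area (b j).
pose jM := [arg max_(j > ord0) v j]%O; pose jm := [arg min_(j < ord0) v j]%O.
have vM j : v j <= v jM by rewrite /jM; case: arg_maxP => // i _; apply.
have vm j : v jm <= v j by rewrite /jm; case: arg_minP => // i _; apply.
have VE : \sum_(j < q.+1) w j * v j = V by rewrite -bV.
have VM : V <= v jM.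
  rewrite -VE -[leRHS]mul1r -w_sum mulr_suml; apply: ler_sum => j _.
  by rewrite ler_wpM2l.
have mV : v jm <= V.
  rewrite -VE -[leLHS]mul1r -w_sum mulr_suml; apply: ler_sum => j _.
  by rewrite ler_wpM2l.
have m0 : 0 <= v jm := area_ge0 w_gt0 (b jm).
have M1 : v jM <= 1 := area_le1 w_gt0 w_sum (b jM).
have E3 : v jM - v jm <= edges3 b := edges3_ge b jM jm.
have PE : perimeter3 b = edges3 b + \sum_(j < q.+1) w j * perimeter2 (b j).
  by rewrite sum_perimeter2 addrA.
have J2 : \sum_(j < q.+1) w j * profile2 (v j) <=
          \sum_(j < q.+1) w j * perimeter2 (b j).
  by apply: ler_sum => j _; rewrite ler_wpM2l// perimeter2_ge_profile.
(* All slices have area [V]. They alone contribute at least [profile2 V], which already bounds the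
   perimeter from above, so no face is orthogonal to the axis. *)
have [mM|mM] := eqVneq (v jm) (v jM).
  have vV j : v j = V.
    by apply/le_anti; rewrite (le_trans (vM j)) -?mM// (le_trans _ (vm j))// mM.
  have : edges3 b <= 0.
    have JV : perimeter3 b <= profile2 V.
      have sE : s = Num.sqrt V by rewrite -s2 sqrtr_sqr ger0_norm.
      rewrite /profile2 !le_min P1 -sE Ps (le_trans Ps)//= ler_wpM2l// sE.
      by rewrite ler_wsqrtr.
    have : \sum_(j < q.+1) w j * profile2 (v j) = profile2 V.
      under eq_bigr do rewrite vV.
      by rewrite -mulr_suml w_sum mul1r.
    lra.
  move=> /wsum2_eq0 J0.
  exists (fun=> true), (b 0%N); split.
    by rewrite /jumps big1.
  move=> j k l /=.
  have /(_ k l)/eqP := J0 (fun k l => ler0n _ _).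
  rewrite pnatr_eq0 => /eqP/jumps0 -> //; by rewrite -ltnS.
have hM : 0 < v jM - v jm by rewrite subr_gt0 lt_def eq_sym mM vm.
(* For a positive least area, averaging the chord inequality over the slices contradicts
   [chord_gap]. *)
have [mz|mp] := eqVneq (v jm) 0; last first.
  have mp' : 0 < v jm by rewrite lt_def mp.
  have chord : (v jM - V) * profile2 (v jm) + (V - v jm) * profile2 (v jM) <=
      (v jM - v jm) * \sum_(j < q.+1) w j * profile2 (v j).
    have -> : (v jM - V) * profile2 (v jm) + (V - v jm) * profile2 (v jM) =
        \sum_(j < q.+1) w j * ((v jM - v j) * profile2 (v jm) +
                               (v j - v jm) * profile2 (v jM)).
      under eq_bigr do rewrite mulrDr !mulrA !mulrBr.
      rewrite big_split /= -!mulr_suml !sumrB -!mulr_suml w_sum VE !mul1r//.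
    rewrite mulr_sumr; apply: ler_sum => j _.
    rewrite mulrCA ler_wpM2l//; exact: profile2_chord.
  have := chord_gap mp' mV VM _ M1 V_half s_ge0 t_ge0 s2 t3 P1 Ps Pt.
  rewrite -subr_gt0 => /(_ hM).
  have : (v jM - v jm) * (v jM - v jm + \sum_(j < q.+1) w j * profile2 (v j)) <=
     (v jM - v jm) * perimeter3 b.
    by rewrite (ler_wpM2l (ltW hM))// PE lerD.
  lra.
have M0 : 0 < v jM by move: hM; rewrite mz subr0.
(* This upper bound on the perimeter meets the lower bounds [EM] and [sum0]. Both are therefore
   equalities: [profile2] lies on the chord through the origin at every slice area, and the faces
   orthogonal to the axis have total area exactly [v jM]. *)
have star := star_gap V_gt0 VM M1 V_half s_ge0 t_ge0 s2 t3 P1 Ps Pt.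
have star_j j : 0 <= v jM * profile2 (v j) - v j * profile2 (v jM).
  rewrite subr_ge0.
  have [->|vj0] := eqVneq (v j) 0.
    by rewrite mul0r profile2_low ?sqrtr0 ?mulr0// invr_ge0.
  have [->//|vjM] := eqVneq (v j) (v jM).
  apply/ltW/profile2_star => //.
    by rewrite lt_def vj0 -mz vm.
  by rewrite lt_def eq_sym vjM vM.
have sumE : \sum_(j < q.+1) w j * (v jM * profile2 (v j) - v j * profile2 (v jM))
    = v jM * (\sum_(j < q.+1) w j * profile2 (v j)) - V * profile2 (v jM).
  under eq_bigr => j _ do rewrite mulrBr mulrCA [w j * (v j * _)]mulrA.
  by rewrite sumrB -mulr_sumr -mulr_suml VE.
have sum0 : 0 <= v jM * (\sum_(j < q.+1) w j * profile2 (v j)) - V * profile2 (v jM).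
  by rewrite -sumE; apply: sumr_ge0 => j _; rewrite mulr_ge0.
have PM : v jM * (edges3 b + \sum_(j < q.+1) w j * profile2 (v j)) <=
     v jM * perimeter3 b.
  by rewrite (ler_wpM2l (ltW M0))// PE lerD.
have EM : v jM * v jM <= v jM * edges3 b.
  by rewrite (ler_wpM2l (ltW M0))//; move: E3; rewrite mz subr0.
have EM' : v jM * edges3 b <= v jM * v jM by lra.
have v01 j : v j = 0 \/ v j = v jM.
  have := @wsum_eq0 _ star_j; rewrite sumE => /(_ _ j)/eqP.
  have -> : v jM * \sum_(j < q.+1) w j * profile2 (v j) - V * profile2 (v jM) <= 0.
    by lra.
  move=> /(_ isT); rewrite subr_eq0 => /eqP e.
  have [|vj0] := eqVneq (v j) 0; first by left.
  have [|vjM] := eqVneq (v j) (v jM); first by right.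
  have := @profile2_star R (v j) (v jM); rewrite e ltxx => /(_ _ _ M1) F.
  by have : false by apply: F; rewrite lt_def ?vj0 -?mz ?vm// eq_sym vjM vM.
have Em : edges3 b <= v jM by rewrite -(ler_pM2l M0).
have bm := area_eq0 mz.
have Jlb (k l : 'I_q.+1) : 0 <= (jumps q (fun j => b j k l))%:R - (b jM k l)%:R :> R.
  rewrite subr_ge0; have := jumps_ge (fun j => b j k l) jM jm.
  by rewrite (negbTE (bm k l)) subr0.
(* Since slice [jm] is empty, each line through slice [jM] jumps at least once; the total leaves
   room for exactly one jump there and none elsewhere. Hence every slice lies in slice [jM], and
   those of equal area coincide with it. *)
have Jeq : forall k l : 'I_q.+1, jumps q (fun j => b j k l) = b jM k l.
  have := @wsum2_eq0 _ Jlb.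
  have -> : \sum_(k < q.+1) \sum_(l < q.+1) w k * w l *
     ((jumps q (fun j => b j k l))%:R - (b jM k l)%:R) = edges3 b - v jM.
    rewrite -sumrB; apply: eq_bigr => k _; rewrite -sumrB.
    by apply: eq_bigr => l _; rewrite mulrBr.
  rewrite subr_le0 => /(_ Em) J k l; apply/eqP.
  by rewrite -(eqr_nat R) -subr_eq0 J.
have bsub (j k l : 'I_q.+1) : b j k l -> b jM k l.
  move=> bj; rewrite -[b jM k l]lt0b -Jeq; apply: (@jumps_gt0 _ (fun j => b j k l) j jm) => //.
  - by rewrite -ltnS.
  - by rewrite -ltnS.
have beq (j k l : 'I_q.+1) : v j = v jM -> b j k l = b jM k l.
  move=> vE; have F0 (k' l' : 'I_q.+1) : 0 <= (b jM k' l')%:R - (b j k' l')%:R :> R.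
    by rewrite subr_ge0 ler_nat; case bj : (b j k' l') => //; rewrite (bsub j).
  have := @wsum2_eq0 _ F0; rewrite -area_sub -/(v j) -/(v jM) vE subrr => /(_ (lexx _) k l).
  by case: (b j k l) (b jM k l) => [] [] // /eqP; rewrite ?subr0 ?sub0r ?oppr_eq0 oner_eq0.
pose T (j : nat) := area (b j) != 0.
have bT (j k l : 'I_q.+1) : b j k l = T j && b jM k l.
  rewrite /T -/(v j); have [vj|vj] := v01 j.
    by rewrite vj eqxx/=; apply/negbTE/area_eq0.
  by rewrite vj gt_eqF//= beq.
exists T, (b jM); split=> //.
(* The line through any cell of the largest slice follows the pattern [T], so [T] inherits its
   single jump. *)
have /existsP[k /existsP[l bkl]] :
    [exists k : 'I_q.+1, [exists l : 'I_q.+1, b jM k l]].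
  apply: contraLR M0 => /existsPn nE; rewrite -leNgt /v /area big1// => k _.
  rewrite big1// => l _; have /existsPn/(_ l)/negbTE -> := nE k.
  by rewrite mulr0.
have -> : jumps q T = jumps q (fun j => b j k l); last by rewrite Jeq bkl.
apply: eq_bigr => j _; congr (nat_of_bool (_ != _)).
  by have := bT (widen_ord (leqnSn q) j) k l; rewrite bkl andbT.
by have := bT (lift ord0 j) k l; rewrite bkl andbT.
Qed.

(** Positive volume provides one cell of the set; its coordinates can be exchanged one at a time,
    which turns the three one-axis factorisations into a product of three factors. *)
Lemma minimal_box b (V s t : R) : 0 < V -> V <= 2^-1 ->
  0 <= s -> s ^+ 2 = V -> 0 <= t -> t ^+ 3 = V -> volume b = V ->
  perimeter3 b <= 1 -> perimeter3 b <= 2 * s -> perimeter3 b <= 3 * t ^+ 2 ->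
  exists T0 T1 T2,
    [/\ (jumps q T0 <= 1)%N, (jumps q T1 <= 1)%N, (jumps q T2 <= 1)%N &
    forall j k l : 'I_q.+1, b j k l = [&& T0 j, T1 k & T2 l]].
Proof.
move=> V_gt0 V_half s_ge0 s2 t_ge0 t3 bV P1 Ps Pt.
have [T0 [U0 [J0 b0]]] := minimal_slices V_gt0 V_half s_ge0 s2 t_ge0 t3 bV P1 Ps Pt.
have [T1 [U1 [J1 b1]]] : exists T U, (jumps q T <= 1)%N /\
    forall j k l : 'I_q.+1, b k j l = T j && U k l.
  apply: (@minimal_slices (fun j k l => b k j l) _ _ _ V_gt0 V_half s_ge0 s2
      t_ge0 t3); by rewrite (volume_rot, perimeter3_rot).
have [T2 [U2 [J2 b2]]] : exists T U, (jumps q T <= 1)%N /\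
    forall j k l : 'I_q.+1, b k l j = T j && U k l.
  apply: (@minimal_slices (fun j k l => b k l j) _ _ _ V_gt0 V_half s_ge0 s2
      t_ge0 t3); by rewrite (volume_rot2, perimeter3_rot2).
exists T0, T1, T2; split=> // j k l.
have /existsP[j' /existsP[k' /existsP[l' bjkl]]] : [exists j : 'I_q.+1,
    [exists k : 'I_q.+1, [exists l : 'I_q.+1, b j k l]]].
  apply: contraLR V_gt0 => /existsPn nE; rewrite -leNgt -bV volumeE big1// => j' _.
  rewrite big1// => k' _; rewrite big1// => l' _.
  have /existsPn/(_ k')/existsPn/(_ l')/negbTE -> := nE j'.
  by rewrite mulr0.
have := bjkl; rewrite b0 => /andP[t0 _]; have := bjkl; rewrite b1 => /andP[t1 _].
have := bjkl; rewrite b2 => /andP[t2 _].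
rewrite b0; congr (_ && _); have := b0 j' k l; rewrite t0 /= => <-.
rewrite b1; congr (_ && _); have := b1 k' j' l; rewrite t1 /= => <-.
by rewrite b2; have := b2 l' j' k'; rewrite bjkl t2 /= => <-; rewrite andbT.
Qed.

End Slicing.

(** * Side lengths of an optimal box *)

Lemma amgm3_eq (R : realFieldType) (x y z u : R) : 0 < x -> 0 < y -> 0 < z ->
  u ^+ 3 = x * y * z -> x + y + z <= 3 * u -> x = y /\ y = z.
Proof.
move=> x0 y0 z0 uE S.
have S0 : 0 < x + y + z by rewrite !addr_gt0.
have S3 : (x + y + z) ^+ 3 <= 27 * (x * y * z).
  have -> : 27 * (x * y * z) = (3 * u) ^+ 3 by rewrite -uE; ring.
  by rewrite ler_pXn2r// nnegrE ltW// (lt_le_trans S0).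
(* A sum of nonnegative multiples of squared differences; by [S3] each of them vanishes. *)
have H : (x + y + z) ^+ 3 - 27 * (x * y * z) =
   (x + y + z) / 2 * (x - y) ^+ 2 + ((x + y + z) / 2 * (y - z) ^+ 2 +
   ((x + y + z) / 2 * (z - x) ^+ 2 + (3 * x * (y - z) ^+ 2 +
   (3 * y * (z - x) ^+ 2 + 3 * z * (x - y) ^+ 2)))) by field.
have h0 : 0 < (x + y + z) / 2 by rewrite divr_gt0.
have sq c a : 0 < c -> 0 <= c * a ^+ 2 :> R.
  by move=> c0; rewrite mulr_ge0 ?sqr_ge0// ltW.
have tx : 0 < 3 * x by rewrite mulr_gt0.
have ty : 0 < 3 * y by rewrite mulr_gt0.
have tz : 0 < 3 * z by rewrite mulr_gt0.
have := sq _ (x - y) h0; have := sq _ (y - z) h0; have := sq _ (z - x) h0.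
have := sq _ (y - z) tx; have := sq _ (z - x) ty; have := sq _ (x - y) tz.
move=> h1 h2 h3 h4 h5 h6.
have z1 : (x + y + z) / 2 * (x - y) ^+ 2 = 0 by apply/le_anti/andP; split=> //; lra.
have z2 : (x + y + z) / 2 * (y - z) ^+ 2 = 0 by apply/le_anti/andP; split=> //; lra.
split; apply/eqP; rewrite -subr_eq0 -sqrf_eq0.
  by move/eqP : z1; rewrite mulf_eq0 gt_eqF.
by move/eqP : z2; rewrite mulf_eq0 gt_eqF.
Qed.

Lemma amgm2_eq (R : realFieldType) (x y s : R) : 0 < x -> 0 < y ->
  s ^+ 2 = x * y -> x + y <= 2 * s -> x = y.
Proof.
move=> x0 y0 sE S; apply/eqP; rewrite -subr_eq0 -sqrf_eq0 eq_le sqr_ge0 andbT.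
have S0 : 0 < x + y by rewrite addr_gt0.
have : (x + y) ^+ 2 <= (2 * s) ^+ 2.
  by rewrite ler_pXn2r// nnegrE ltW// (lt_le_trans S0).
rewrite exprMn sE; lra.
Qed.

Lemma square_box_side (R : realFieldType) (x y V s : R) : 0 < x -> 0 < y ->
  V = x * y -> s ^+ 2 = V -> x + y <= 1 -> x + y <= 2 * s ->
  x = y /\ x <= 2^-1.
Proof.
move=> x0 y0 VE sV P1 Ps; have xy : x = y.
  by apply: (amgm2_eq x0 y0 _ Ps); rewrite sV.
by split=> //; move: P1; rewrite -xy; lra.
Qed.

(** AM-GM is applied to the three face areas, whose product is [(t ^+ 2) ^+ 3]. For equal sides,
    [3 x^2 <= 2 s] and [s^2 = x^3] even give [x <= 4/9]. *)
Lemma cube_box_side (R : realFieldType) (x y z V s t : R) :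
  0 < x -> 0 < y -> 0 < z -> 0 <= s -> 
  V = x * y * z -> s ^+ 2 = V -> t ^+ 3 = V ->
  y * z + x * z + x * y <= 2 * s -> y * z + x * z + x * y <= 3 * t ^+ 2 ->
  [/\ x = y, y = z & x <= 2^-1].
Proof.
move=> x0 y0 z0 s0 VE sV tV Ps Pt.
have [e1 e2] : y * z = x * z /\ x * z = x * y.
  apply: (@amgm3_eq _ _ _ _ (t ^+ 2)); rewrite ?mulr_gt0//.
  by rewrite exprAC tV VE; ring.
have xy : x = y by apply/esym/(mulIf _ e1); rewrite gt_eqF.
have yz : y = z by apply/esym/(mulfI _ e2); rewrite gt_eqF.
split=> //; move: VE Ps; rewrite -yz -xy => VE Ps.
have P0 : 0 < x * x + x * x + x * x by rewrite !addr_gt0 ?mulr_gt0.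
have : (x * x + x * x + x * x) ^+ 2 <= (2 * s) ^+ 2.
  by rewrite ler_pXn2r// nnegrE ltW// (lt_le_trans P0).
rewrite exprMn sV VE.
have -> : (x * x + x * x + x * x) ^+ 2 = (9 * x) * (x * x * x) by ring.
rewrite -natrX ler_pM2r ?mulr_gt0//; lra.
Qed.

(** A side of length 1 has no end inside the cube, hence the indicators in [P]. The eight cases
    record which sides have length 1: all three is excluded by [V <= 1/2], and otherwise the
    competitor of the same type makes the short sides equal. *)
Lemma optimal_box_sides (R : realFieldType) (a : nat -> R) (V s t P : R) :
  (forall i, (i < 3)%N -> 0 < a i <= 1) ->
  V = a 0%N * a 1%N * a 2%N -> V <= 2^-1 -> 0 <= s -> s ^+ 2 = V -> t ^+ 3 = V ->
  P = (a 0%N < 1)%R%:R * (a 1%N * a 2%N) + (a 1%N < 1)%R%:R * (a 0%N * a 2%N)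
    + (a 2%N < 1)%R%:R * (a 0%N * a 1%N) ->
  P <= 1 -> P <= 2 * s -> P <= 3 * t ^+ 2 ->
  exists c : R, [/\ 0 <= c <= 2^-1, exists2 i, (i < 3)%N & a i < 1 &
    forall i, (i < 3)%N -> a i < 1 -> a i = c].
Proof.
move=> a01 VE V2 s0 sV tV -> P1 Ps Pt.
have /andP[x0 x1] := a01 0%N isT; have /andP[y0 y1] := a01 1%N isT.
have /andP[z0 z1] := a01 2%N isT.
have all3 (Q : nat -> Prop) : Q 0%N -> Q 1%N -> Q 2%N -> forall i, (i < 3)%N -> Q i.
  by move=> q0 q1 q2 [|[|[|]]].
move: x1 y1 z1; rewrite 3!le_eqVlt => x1 y1 z1.
move: V2 P1 Ps Pt VE; move: x1 y1 z1.
move=> /orP[/eqP x1|x1] /orP[/eqP y1|y1] /orP[/eqP z1|z1];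
  rewrite ?x1 ?y1 ?z1 ?ltxx /= ?(mulr0n, mulr1n, mul0r, mul1r, mulr1,
    add0r, addr0) => V2 P1 Ps Pt VE.
- by move: V2; rewrite VE; lra.
- by exists (a 2%N); split; [lra|exists 2%N|apply: all3; rewrite ?x1 ?y1 ?z1 ?ltxx].
- by exists (a 1%N); split; [lra|exists 1%N|apply: all3; rewrite ?x1 ?y1 ?z1 ?ltxx].
- have [e ?] : a 2%N = a 1%N /\ a 2%N <= 2^-1.
    by apply: (@square_box_side _ _ _ V s) => //; rewrite mulrC.
  by exists (a 2%N); split; [lra|exists 2%N|apply: all3; rewrite ?x1 ?y1 ?z1 ?ltxx ?e].
- by exists (a 0%N); split; [lra|exists 0%N|apply: all3; rewrite ?x1 ?y1 ?z1 ?ltxx].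
- have [e ?] : a 2%N = a 0%N /\ a 2%N <= 2^-1.
    by apply: (@square_box_side _ _ _ V s) => //; rewrite mulrC.
  by exists (a 2%N); split; [lra|exists 2%N|apply: all3; rewrite ?x1 ?y1 ?z1 ?ltxx ?e].
- have [e ?] : a 1%N = a 0%N /\ a 1%N <= 2^-1.
    by apply: (@square_box_side _ _ _ V s) => //; rewrite mulrC.
  by exists (a 1%N); split; [lra|exists 1%N|apply: all3; rewrite ?x1 ?y1 ?z1 ?ltxx ?e].
- have [e1 e2 ?] := cube_box_side x0 y0 z0 s0 VE sV tV Ps Pt.
  by exists (a 0%N); split; [lra|exists 0%N|apply: all3; rewrite -?e2 -?e1].
Qed.

Section Box.
Variables (R : rcfType) (q : nat) (w : nat -> R).
Hypothesis w_gt0 : forall j, (j <= q)%N -> 0 < w j.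
Hypothesis w_sum : \sum_(j < q.+1) w j = 1.

Let w_gt0' (j : 'I_q.+1) : 0 < w j.
Proof. by rewrite w_gt0// -ltnS. Qed.

Let w_ge0 (j : 'I_q.+1) : 0 <= w j.
Proof. exact: ltW. Qed.

Definition side (T : nat -> bool) : R := \sum_(j < q.+1) w j * (T j)%:R.

Lemma side_ge0 T : 0 <= side T.
Proof. by apply: sumr_ge0 => j _; rewrite mulr_ge0. Qed.

Lemma side_le1 T : side T <= 1.
Proof.
by rewrite -w_sum; apply: ler_sum => j _; rewrite ler_piMr// lern1 leq_b1.
Qed.

Lemma side_lt1 T : 0 < side T -> ((side T < 1)%R%:R <= (jumps q T)%:R :> R).
Proof.
move=> T0; rewrite ler_nat.
have [T1|//] := ltrP (side T) 1.
have /existsP[i Ti] : [exists i : 'I_q.+1, T i].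
  apply: contraLR T0 => /existsPn nT; rewrite -leNgt /side big1// => j _.
  by rewrite (negbTE (nT j)) mulr0.
have /existsP[j Tj] : [exists i : 'I_q.+1, ~~ T i].
  apply: contraLR T1 => /existsPn nT; rewrite -leNgt -w_sum; apply: ler_sum => j _.
  by have := nT j; rewrite negbK => ->; rewrite mulr1.
by apply: (@jumps_gt0 _ _ i j) => //; rewrite -ltnS.
Qed.

Lemma eq_volume (b b' : nat -> nat -> nat -> bool) :
  (forall j k l : 'I_q.+1, b j k l = b' j k l) -> volume q w b = volume q w b'.
Proof.
by move=> bb; rewrite !volumeE; do 3![apply: eq_bigr => ? _]; rewrite bb.
Qed.

Lemma eq_edges3 (b b' : nat -> nat -> nat -> bool) :
  (forall j k l : 'I_q.+1, b j k l = b' j k l) -> edges3 q w b = edges3 q w b'.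
Proof.
move=> bb; do 2![apply: eq_bigr => ? _]; congr (_ * _%:R).
apply: eq_bigr => j _; congr (nat_of_bool (_ != _)).
  exact: (bb (widen_ord (leqnSn q) j)).
exact: (bb (lift ord0 j)).
Qed.

Lemma volume_box (T0 T1 T2 : nat -> bool) :
  volume q w (fun j k l => [&& T0 j, T1 k & T2 l]) = side T0 * side T1 * side T2.
Proof.
rewrite volumeE /side !mulr_suml; apply: eq_bigr => j _.
rewrite -mulrA mulr_suml mulr_sumr; apply: eq_bigr => k _.
rewrite !mulr_sumr; apply: eq_bigr => l _.
by case: (T0 j); case: (T1 k); case: (T2 l); rewrite /=; ring.
Qed.

Lemma edges3_box (T0 T1 T2 : nat -> bool) :
  edges3 q w (fun j k l => [&& T0 j, T1 k & T2 l]) =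
  (jumps q T0)%:R * (side T1 * side T2).
Proof.
rewrite /side mulr_suml mulr_sumr; apply: eq_bigr => k _.
rewrite !mulr_sumr; apply: eq_bigr => l _.
have -> : jumps q (fun j => [&& T0 j, T1 k & T2 l]) =
    (jumps q T0 * (T1 k * T2 l))%N.
  rewrite /jumps big_distrl; apply: eq_bigr => j _ /=.
  by case: (T0 j); case: (T0 j.+1); case: (T1 k); case: (T2 l).
by rewrite !natrM; ring.
Qed.

Lemma perimeter3_box (T0 T1 T2 : nat -> bool) :
  perimeter3 q w (fun j k l => [&& T0 j, T1 k & T2 l]) =
  (jumps q T0)%:R * (side T1 * side T2) + (jumps q T1)%:R * (side T0 * side T2)
  + (jumps q T2)%:R * (side T0 * side T1).
Proof.
rewrite -!edges3_box /perimeter3; congr (_ + _ + _); apply: eq_edges3 => j k l.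
  by rewrite andbCA.
by rewrite [T1 l && _]andbC andbCA.
Qed.

Lemma minimal_corner_box (b : nat -> nat -> nat -> bool) (V s t : R) :
  0 < V -> V <= 2^-1 -> 0 <= s -> s ^+ 2 = V -> 0 <= t -> t ^+ 3 = V ->
  volume q w b = V -> perimeter3 q w b <= 1 -> perimeter3 q w b <= 2 * s ->
  perimeter3 q w b <= 3 * t ^+ 2 ->
  exists T : nat -> nat -> bool,
  [/\ forall i, (i < 3)%N -> (jumps q (T i) <= 1)%N /\ 0 < side (T i),
      forall j k l : 'I_q.+1, b j k l = [&& T 0%N j, T 1%N k & T 2%N l] &
      exists a : R, [/\ 0 <= a <= 2^-1, exists2 i, (i < 3)%N & side (T i) < 1 &
        forall i, (i < 3)%N -> side (T i) < 1 -> side (T i) = a]].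
Proof.
move=> V0 V2 s0 sV t0 tV bV P1 Ps Pt.
have [T0 [T1 [T2 [J0 J1 J2 bT]]]] :=
  minimal_box w_gt0 w_sum V0 V2 s0 sV t0 tV bV P1 Ps Pt.
pose T i := nth T0 [:: T0; T1; T2] i; exists T.
have VE : V = side T0 * side T1 * side T2.
  by rewrite -volume_box -bV; exact: eq_volume.
have PE : perimeter3 q w b = perimeter3 q w (fun j k l => [&& T0 j, T1 k & T2 l]).
  by congr (_ + _ + _); apply: eq_edges3 => j k l; rewrite bT.
have S0 : 0 < side T0.
  by rewrite lt_def side_ge0 andbT; apply: contraTneq V0 => z; rewrite VE z !mul0r ltxx.
have S1 : 0 < side T1.
  by rewrite lt_def side_ge0 andbT; apply: contraTneq V0 => z; rewrite VE z mulr0 mul0r ltxx.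
have S2 : 0 < side T2.
  by rewrite lt_def side_ge0 andbT; apply: contraTneq V0 => z; rewrite VE z mulr0 ltxx.
split=> //; first by move=> [|[|[|]]].
pose P := (side T0 < 1)%R%:R * (side T1 * side T2)
  + (side T1 < 1)%R%:R * (side T0 * side T2)
  + (side T2 < 1)%R%:R * (side T0 * side T1).
(* A side shorter than 1 has at least one jump, so the upper bounds on the perimeter pass to [P]. *)
have PP : P <= perimeter3 q w b.
  by rewrite PE perimeter3_box !lerD// ler_wpM2r ?side_lt1// mulr_ge0// ltW.
apply: (@optimal_box_sides _ (fun i => side (T i)) V s t P) => //.
- by move=> [|[|[|]]]//= _; rewrite side_le1 andbT.
- exact: le_trans PP P1.
- exact: le_trans PP Ps.
- exact: le_trans PP Pt.
Qed.

End Box.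

(** * Volumes of boxes *)

Section Volume.
Context {R : realType}.
Implicit Type n : nat.

Definition vmeasurable n (A : set 'rV[R]_n) :=
  measurable [set t : n.-tuple (measurableTypeR R) | A (\row_i tnth t i)].

Lemma vmeasurableC n (A : set 'rV[R]_n) : vmeasurable A -> vmeasurable (~` A).
Proof. exact: measurableC. Qed.

Lemma vmeasurableI n (A B : set 'rV[R]_n) :
  vmeasurable A -> vmeasurable B -> vmeasurable (A `&` B).
Proof. exact: measurableI. Qed.

Lemma vmeasurableU n (A B : set 'rV[R]_n) :
  vmeasurable A -> vmeasurable B -> vmeasurable (A `|` B).
Proof. exact: measurableU. Qed.

Lemma vmeasurableD n (A B : set 'rV[R]_n) :
  vmeasurable A -> vmeasurable B -> vmeasurable (A `\` B).
Proof. exact: measurableD. Qed.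

Lemma Vol_ge0 n (A : set 'rV[R]_n) : (0 <= Vol A)%E.
Proof. exact: measure_ge0. Qed.

Lemma Vol0 n : Vol (set0 : set 'rV[R]_n) = 0%E.
Proof. exact: measure0. Qed.

Lemma le_Vol n (A B : set 'rV[R]_n) : vmeasurable A -> vmeasurable B ->
  A `<=` B -> (Vol A <= Vol B)%E.
Proof. by move=> mA mB AB; apply: le_measure; rewrite ?inE// => t /AB. Qed.

Lemma le_VolU n (A B : set 'rV[R]_n) : vmeasurable A -> vmeasurable B ->
  (Vol (A `|` B) <= Vol A + Vol B)%E.
Proof. exact: measureU2. Qed.

Lemma VolU n (A B : set 'rV[R]_n) : vmeasurable A -> vmeasurable B ->
  A `&` B = set0 -> Vol (A `|` B) = (Vol A + Vol B)%E.
Proof.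
move=> mA mB AB; rewrite /Vol -measureU//; apply/seteqP; split=> // t [At Bt].
have : (A `&` B) (\row_i tnth t i) by [].
by rewrite AB.
Qed.

Lemma vmeasurable_bigsetU n (I : Type) (r : seq I) (P : pred I)
    (F : I -> set 'rV[R]_n) : (forall i, P i -> vmeasurable (F i)) ->
  vmeasurable (\big[setU/set0]_(i <- r | P i) F i).
Proof.
move=> mF; elim/big_ind : _ => //; first exact: measurable0.
exact: vmeasurableU.
Qed.

Lemma Vol_bigsetU n (I : choiceType) (r : seq I) (P : pred I)
    (F : I -> set 'rV[R]_n) : uniq r -> (forall i, vmeasurable (F i)) ->
  (forall i j, i != j -> F i `&` F j = set0) ->
  Vol (\big[setU/set0]_(i <- r | P i) F i) = (\sum_(i <- r | P i) Vol (F i))%E.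
Proof.
move=> ur mF tF; elim: r ur => [|i r IH] /=; first by rewrite !big_nil Vol0.
move=> /andP[ir ur]; rewrite !big_cons; case: ifP => _; last exact: IH.
rewrite VolU ?IH//; first exact: vmeasurable_bigsetU.
rewrite -bigcup_seq_cond; apply/seteqP; split=> // x [Fix [j /= /andP[jr _] Fjx]].
have ij : i != j by apply: contraNneq ir => ->.
by have : (F i `&` F j) x by []; rewrite tF.
Qed.

Definition prod_set n (B : 'I_n -> set R) : set 'rV[R]_n :=
  [set x | forall i, B i (x 0 i)].

Lemma vmeasurable_prod_set n (B : 'I_n -> set R) :
  (forall i, measurable (B i : set (measurableTypeR R))) ->
  vmeasurable (prod_set B).
Proof.
move=> mB; rewrite /vmeasurable.
have -> : [set t : n.-tuple (measurableTypeR R) | prod_set B (\row_i tnth t i)] =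
    \bigcap_(i in [set: 'I_n]) ((@tnth n (measurableTypeR R))^~ i @^-1` B i).
  apply/seteqP; split=> t Bt i; first by move=> _; have := Bt i; rewrite mxE.
  by rewrite mxE; exact: Bt.
apply: fin_bigcap_measurable => // i _; rewrite -[_ @^-1` _]setTI.
by apply: measurable_tnth => //; exact: mB.
Qed.

Lemma Vol_prod_set n (B : 'I_n -> set R) :
  (forall i, measurable (B i : set (measurableTypeR R))) ->
  Vol (prod_set B) = (\prod_(i < n) lebesgue_measure (B i))%E.
Proof.
elim: n B => [|n IH] B mB.
  rewrite big_ord0 /Vol /= diracE mem_set//= => -[]//.
rewrite big_ord_recl -IH//.
rewrite -product_measure1E//; last exact: vmeasurable_prod_set.
congr ((_ \x _)%E _); apply/seteqP; split=> -[x t].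
  move=> Bt; split; first by have := Bt ord0; rewrite mxE.
  by move=> i; have := Bt (lift ord0 i); rewrite !mxE tnthS.
move=> [Bx Bt] i; rewrite mxE; case: (unliftP ord0 i) => [j ->|->//].
by rewrite tnthS; have := Bt j; rewrite mxE.
Qed.

Definition obox n (l u : 'I_n -> R) : set 'rV[R]_n :=
  [set x | forall i, l i < x 0 i < u i].

Definition cbox n (l u : 'I_n -> R) : set 'rV[R]_n :=
  [set x | forall i, l i <= x 0 i <= u i].

Lemma oboxE n (l u : 'I_n -> R) : obox l u = prod_set (fun i => [set` `]l i, u i[]).
Proof. by apply/seteqP; split=> x xlu i; have := xlu i; rewrite /= in_itv. Qed.

Lemma cboxE n (l u : 'I_n -> R) : cbox l u = prod_set (fun i => [set` `[l i, u i]]).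
Proof. by apply/seteqP; split=> x xlu i; have := xlu i; rewrite /= in_itv. Qed.

Lemma vmeasurable_obox n (l u : 'I_n -> R) : vmeasurable (obox l u).
Proof. by rewrite oboxE; apply: vmeasurable_prod_set => i; exact: measurable_itv. Qed.

Lemma vmeasurable_cbox n (l u : 'I_n -> R) : vmeasurable (cbox l u).
Proof. by rewrite cboxE; apply: vmeasurable_prod_set => i; exact: measurable_itv. Qed.

Lemma lebesgue_measure_itvoo (a b : R) : a <= b ->
  lebesgue_measure `]a, b[%classic = (b - a)%:E.
Proof.
move=> ab; rewrite lebesgue_measure_itv/= lte_fin EFinB.
by case: ltgtP ab => // -> _; rewrite subee.
Qed.

Lemma lebesgue_measure_itvcc (a b : R) : a <= b ->
  lebesgue_measure `[a, b]%classic = (b - a)%:E.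
Proof.
move=> ab; rewrite lebesgue_measure_itv/= lte_fin EFinB.
by case: ltgtP ab => // -> _; rewrite subee.
Qed.

Lemma Vol_obox n (l u : 'I_n -> R) : (forall i, l i <= u i) ->
  Vol (obox l u) = (\prod_i (u i - l i))%:E.
Proof.
move=> lu; rewrite oboxE Vol_prod_set; last by move=> i; exact: measurable_itv.
by rewrite -prodEFin; apply: eq_bigr => i _; rewrite lebesgue_measure_itvoo.
Qed.

Lemma Vol_cbox n (l u : 'I_n -> R) : (forall i, l i <= u i) ->
  Vol (cbox l u) = (\prod_i (u i - l i))%:E.
Proof.
move=> lu; rewrite cboxE Vol_prod_set; last by move=> i; exact: measurable_itv.
by rewrite -prodEFin; apply: eq_bigr => i _; rewrite lebesgue_measure_itvcc.
Qed.

Lemma ball_rVP n (x y : 'rV[R]_n) (e : R) : 0 < e ->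
  ball x e y <-> forall i, `|x 0 i - y 0 i| < e.
Proof.
move=> e0; split=> [[_ xy] i|xy]; first exact: xy.
by split=> // i j; rewrite (ord1 i); exact: xy.
Qed.

(** The sigma-algebra on tuples is a product one, so an open set is written as the countable union
    of the rational boxes that it contains; in [F], other codes give the empty set. *)
Lemma open_vmeasurable n (U : set 'rV[R]_n) : open U -> vmeasurable U.
Proof.
move=> oU; rewrite /vmeasurable.
pose T : countType := ({ffun 'I_n -> rat} * {ffun 'I_n -> rat})%type.
pose B (p : T) : set 'rV[R]_n :=
  obox (fun i => ratr (p.1 i)) (fun i => ratr (p.2 i)).
pose F k : set 'rV[R]_n := if unpickle k is Some p then
  if `[< B p `<=` U >] then B p else set0 else set0.
have -> : [set t : n.-tuple (measurableTypeR R) | U (\row_i tnth t i)] =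
    \bigcup_k [set t | F k (\row_i tnth t i)].
  apply/seteqP; split=> t /=; last first.
    move=> [k _]; rewrite /F; case: unpickle => // p.
    by case: asboolP => // + Bt; exact.
  move=> Ut; set x := \row_i tnth t i in Ut *.
  have /nbhs_ballP[e /= e0 eU] := open_nbhs_nbhs (conj oU Ut).
  have /fin_all_exists[l lP] i : exists q : rat, x 0 i - e < ratr q < x 0 i.
    have [|q] := @rat_in_itvoo _ (x 0 i - e) (x 0 i); first by rewrite ltrBlDr ltrDl.
    by rewrite in_itv => qP; exists q.
  have /fin_all_exists[u uP] i : exists q : rat, x 0 i < ratr q < x 0 i + e.
    have [|q] := @rat_in_itvoo _ (x 0 i) (x 0 i + e); first by rewrite ltrDl.
    by rewrite in_itv => qP; exists q.
  exists (pickle ((finfun l, finfun u) : T)) => //; rewrite /F pickleK.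
  have Bx : B (finfun l, finfun u) x.
    move=> i /=; rewrite !ffunE; case/andP: (lP i) => _ ->.
    by case/andP: (uP i) => ->.
  case: asboolP => // nBU; exfalso; apply: nBU => y By; apply: eU.
  apply/ball_rVP => // i; have := By i; rewrite /= !ffunE ltr_norml.
  have := lP i; have := uP i; lra.
apply: bigcupT_measurable => k; rewrite /F; case: unpickle; last exact: measurable0.
move=> p; case: asboolP => _; last exact: measurable0.
exact: vmeasurable_obox.
Qed.

Lemma closed_vmeasurable n (A : set 'rV[R]_n) : closed A -> vmeasurable A.
Proof.
move=> cA; rewrite -(setCK A); apply: vmeasurableC; apply: open_vmeasurable.
exact: closed_openC.
Qed.

(** The bound [K] cuts each hyperplane down to a closed box with one side of length 0 and finite
    other sides; [|K|] keeps these boxes well ordered whatever the sign of [K]. *)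
Lemma Vol_null n (A : set 'rV[R]_n) (s : seq ('I_n * R)) (K : R) :
  vmeasurable A -> (forall x, A x -> forall i, - K <= x 0 i <= K) ->
  A `<=` \bigcup_(h in [set` s]) coordinate_hyperplane h.1 h.2 -> Vol A = 0%E.
Proof.
move=> mA AK As.
pose F (h : 'I_n * R) : set 'rV[R]_n :=
  cbox (fun i => if i == h.1 then h.2 else - `|K|)
       (fun i => if i == h.1 then h.2 else `|K|).
have AF : A `<=` \big[setU/set0]_(h <- s) F h.
  move=> x Ax; rewrite -bigcup_seq; have [h hs xh] := As _ Ax.
  exists h => // i; case: eqP => [->|_]; first by rewrite xh lexx.
  have /andP[x1 x2] := AK _ Ax i; rewrite (le_trans x2) ?ler_norm// andbT.
  by rewrite (le_trans _ x1)// lerN2 ler_norm.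
have mF h : vmeasurable (F h) by exact: vmeasurable_cbox.
have F0 h : Vol (F h) = 0%E.
  rewrite Vol_cbox; last by move=> i; case: eqP => // _; rewrite ge0_cp.
  by rewrite (bigD1 h.1)//= eqxx subrr mul0r.
apply/eqP; rewrite eq_le Vol_ge0 andbT.
apply: le_trans (le_Vol mA _ AF) _; first exact: vmeasurable_bigsetU.
elim: s {As AF} => [|h s IH]; first by rewrite big_nil Vol0.
rewrite big_cons; apply: le_trans (le_VolU (mF h) _) _; first exact: vmeasurable_bigsetU.
by rewrite F0 add0e.
Qed.

Lemma eq_Vol_null n (A B : set 'rV[R]_n) : vmeasurable A -> vmeasurable B ->
  Vol (A `\` B) = 0%E -> Vol (B `\` A) = 0%E -> Vol A = Vol B.
Proof.
move=> mA mB AB BA.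
have E (C D : set 'rV[R]_n) : vmeasurable C -> vmeasurable D ->
    Vol C = (Vol (C `\` D) + Vol (C `&` D))%E.
  move=> mC mD; rewrite -VolU; last 3 first.
  - exact: vmeasurableD.
  - exact: vmeasurableI.
  - by rewrite setDE setIACA setICl setI0.
  by rewrite setUC setUIDK.
by rewrite (E A B)// AB (E B A)// BA setIC.
Qed.

End Volume.

(** * Hausdorff measure of axis-parallel plates *)

Section Hausdorff.
Context {R : realType}.
Variables (n k : nat).
Implicit Types (A B : set 'rV[R]_n) (x y : 'rV[R]_n) (F : nat -> set 'rV[R]_n).

Lemma edist_ge0 x y : 0 <= edist x y.
Proof. exact: sqrtr_ge0. Qed.

Lemma diam_ge0 A : (0 <= diam A)%E.
Proof. by apply: ereal_sup_ubound; left. Qed.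

Lemma edist_le_diam A x y : A x -> A y -> ((edist x y)%:E <= diam A)%E.
Proof. by move=> Ax Ay; apply: ereal_sup_ubound; right; exists (x, y). Qed.

Lemma diam_le A d : (0 <= d)%E ->
  (forall x y, A x -> A y -> ((edist x y)%:E <= d)%E) -> (diam A <= d)%E.
Proof.
move=> d0 Ad; apply: ge_ereal_sup => _ [->//|[[x y] [Ax Ay] <-]].
exact: Ad.
Qed.

Lemma diam0 : diam (set0 : set 'rV[R]_n) = 0%E.
Proof. by apply/eqP; rewrite eq_le diam_ge0 andbT; exact: diam_le. Qed.

Lemma hausdorff_weight_ge0 A : (0 <= hausdorff_weight k A)%E.
Proof.
rewrite /hausdorff_weight; case: ifP => // _; rewrite mule_ge0 ?Vol_ge0//.
by rewrite expe_ge0// mule_ge0 ?diam_ge0// lee_fin.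
Qed.

Lemma hausdorff_weight0 : hausdorff_weight k (set0 : set 'rV[R]_n) = 0%E.
Proof. by rewrite /hausdorff_weight eqxx. Qed.

Lemma hausdorff_content_le (delta : R) A F (m : \bar R) :
  A `<=` \bigcup_j F j -> (forall j, (diam (F j) <= delta%:E)%E) ->
  (\sum_(0 <= j <oo) hausdorff_weight k (F j) <= m)%E ->
  (hausdorff_content k delta A <= m)%E.
Proof.
by move=> AF Fd; apply: le_trans; apply: ereal_inf_lbound; exists F.
Qed.

Lemma hausdorff_contentP (delta : R) A (m : \bar R) :
  (forall F, A `<=` \bigcup_j F j -> (forall j, (diam (F j) <= delta%:E)%E) ->
    (m <= \sum_(0 <= j <oo) hausdorff_weight k (F j))%E) ->
  (m <= hausdorff_content k delta A)%E.
Proof. by move=> H; apply: le_ereal_inf_tmp => _ [F [AF Fd] <-]; exact: H. Qed.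

Lemma hausdorff_content_ge0 (delta : R) A : (0 <= hausdorff_content k delta A)%E.
Proof.
apply: hausdorff_contentP => F _ _; apply: nneseries_ge0 => j _ _.
exact: hausdorff_weight_ge0.
Qed.

Lemma hausdorff_content_subset (delta : R) A B : A `<=` B ->
  (hausdorff_content k delta A <= hausdorff_content k delta B)%E.
Proof.
move=> AB; apply: hausdorff_contentP => F BF Fd.
by apply: hausdorff_content_le (lexx _) => //; exact: subset_trans BF.
Qed.

Lemma hausdorff_content_anti (delta delta' : R) A : delta <= delta' ->
  (hausdorff_content k delta' A <= hausdorff_content k delta A)%E.
Proof.
move=> dd; apply: hausdorff_contentP => F AF Fd.
apply: hausdorff_content_le (lexx _) => // j.
by rewrite (le_trans (Fd j))// lee_fin.
Qed.

Lemma hausdorff_content_le_measure (delta : R) A : 0 < delta ->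
  (hausdorff_content k delta A <= hausdorff_measure k A)%E.
Proof. by move=> d0; apply: ereal_sup_ubound; exists delta. Qed.

Lemma hausdorff_measure_le A (m : \bar R) :
  (forall delta : R, 0 < delta -> (hausdorff_content k delta A <= m)%E) ->
  (hausdorff_measure k A <= m)%E.
Proof. by move=> H; apply: ge_ereal_sup => _ [delta /= d0 <-]; exact: H. Qed.

Lemma hausdorff_measure_ge0 A : (0 <= hausdorff_measure k A)%E.
Proof.
apply: le_trans (hausdorff_content_le_measure A (@ltr01 R)).
exact: hausdorff_content_ge0.
Qed.

Lemma le_hausdorff_measure A B : A `<=` B ->
  (hausdorff_measure k A <= hausdorff_measure k B)%E.
Proof.
move=> AB; apply: hausdorff_measure_le => delta d0.
exact: le_trans (hausdorff_content_subset _ AB)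
                (hausdorff_content_le_measure _ d0).
Qed.

Lemma nneseries_le_bound (u : nat -> \bar R) (m : \bar R) :
  (forall j, (0 <= u j)%E) -> (forall N, (\sum_(0 <= j < N) u j <= m)%E) ->
  (\sum_(0 <= j <oo) u j <= m)%E.
Proof.
move=> u0 um; apply: lime_le; first by apply: is_cvg_nneseries => j _ _; exact: u0.
exact: nearW.
Qed.

Lemma hausdorff_content_le_weight (delta : R) A : 0 <= delta ->
  (diam A <= delta%:E)%E ->
  (hausdorff_content k delta A <= hausdorff_weight k A)%E.
Proof.
move=> d0 Ad; pose F (j : nat) : set 'rV[R]_n := if j is 0%N then A else set0.
apply: (@hausdorff_content_le _ _ F).
- by move=> x Ax; exists 0%N.
- by move=> [|j] //=; rewrite diam0 lee_fin.
- apply: nneseries_le_bound => [j|N]; first exact: hausdorff_weight_ge0.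
  case: N => [|N]; first by rewrite big_nil hausdorff_weight_ge0.
  rewrite big_nat_recl// big1 ?adde0// => j _; exact: hausdorff_weight0.
Qed.

(** Two nearly optimal covers are interleaved at even and odd indices; a partial sum of length [N]
    is bounded by that of length [N.*2], which splits evenly. *)
Lemma hausdorff_contentU (delta : R) A B :
  (hausdorff_content k delta (A `|` B) <=
   hausdorff_content k delta A + hausdorff_content k delta B)%E.
Proof.
have cA0 := hausdorff_content_ge0 delta A.
have cB0 := hausdorff_content_ge0 delta B.
have [->|Afin] := eqVneq (hausdorff_content k delta A) +oo%E.
  by rewrite addye ?leey// -ltNye (lt_le_trans _ cB0).
have [->|Bfin] := eqVneq (hausdorff_content k delta B) +oo%E.
  by rewrite addey ?leey// -ltNye (lt_le_trans _ cA0).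
have fA : hausdorff_content k delta A \is a fin_num.
  by rewrite ge0_fin_numE// ltey.
have fB : hausdorff_content k delta B \is a fin_num.
  by rewrite ge0_fin_numE// ltey.
apply/lee_addgt0Pr => e e0; have e2 : 0 < e / 2 by rewrite divr_gt0.
have [_ [F [AF Fd] <-] Fe] := lb_ereal_inf_adherent e2 fA.
have [_ [G [BG Gd] <-] Ge] := lb_ereal_inf_adherent e2 fB.
pose E (j : nat) : set 'rV[R]_n := if odd j then G j./2 else F j./2.
apply: (@hausdorff_content_le _ _ E).
- move=> x [/AF[j _ Fj]|/BG[j _ Gj]].
    by exists j.*2 => //; rewrite /E odd_double doubleK.
  by exists j.*2.+1 => //; rewrite /E /= odd_double /= uphalf_double.
- by move=> j; rewrite /E; case: ifP.
- have -> : e = e / 2 + e / 2 by field.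
  rewrite EFinD addeACA.
  apply: le_trans (leeD (ltW Fe) (ltW Ge)).
  apply: nneseries_le_bound => [j|N]; first exact: hausdorff_weight_ge0.
  have H N' : (\sum_(0 <= j < N'.*2) hausdorff_weight k (E j) =
    \sum_(0 <= j < N') hausdorff_weight k (F j) +
    \sum_(0 <= j < N') hausdorff_weight k (G j))%E.
    elim: N' => [|N' IH]; first by rewrite !big_nil adde0.
    rewrite doubleS !big_nat_recr//= IH -addeA addeACA; congr (_ + (_ + _))%E.
      by rewrite /E odd_double doubleK.
    by rewrite /E /= odd_double /= uphalf_double.
  apply: le_trans (_ : (\sum_(0 <= j < N.*2) hausdorff_weight k (E j) <= _)%E).
    rewrite [leRHS](big_cat_nat (n := N))//=; last by rewrite -addnn leq_addr.
    by rewrite leeDl// sume_ge0// => j _; exact: hausdorff_weight_ge0.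
  by rewrite H leeD//; apply: nneseries_lim_ge => j _ _; exact: hausdorff_weight_ge0.
Qed.

Lemma hausdorff_measureU A B :
  (hausdorff_measure k (A `|` B) <= hausdorff_measure k A + hausdorff_measure k B)%E.
Proof.
apply: hausdorff_measure_le => delta d0.
apply: le_trans (hausdorff_contentU delta A B) _.
by rewrite leeD// hausdorff_content_le_measure.
Qed.

Lemma hausdorff_content0 (delta : R) : 0 <= delta ->
  hausdorff_content k delta (set0 : set 'rV[R]_n) = 0%E.
Proof.
move=> d0; apply/eqP; rewrite eq_le hausdorff_content_ge0 andbT.
rewrite -[leRHS]hausdorff_weight0; apply: hausdorff_content_le_weight => //.
by rewrite diam0 lee_fin.
Qed.

Lemma hausdorff_measure0 : hausdorff_measure k (set0 : set 'rV[R]_n) = 0%E.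
Proof.
apply/eqP; rewrite eq_le hausdorff_measure_ge0 andbT.
by apply: hausdorff_measure_le => delta d0; rewrite (hausdorff_content0 (ltW d0)).
Qed.

Lemma hausdorff_measure_bigsetU (I : Type) (r : seq I) (P : pred I)
    (F : I -> set 'rV[R]_n) :
  (hausdorff_measure k (\big[setU/set0]_(i <- r | P i) F i) <=
   \sum_(i <- r | P i) hausdorff_measure k (F i))%E.
Proof.
elim/big_rec2 : _ => [|i y A _ IH]; first by rewrite hausdorff_measure0.
by apply: le_trans (hausdorff_measureU _ _) _; rewrite leeD2l.
Qed.

Lemma hausdorff_content_bigsetU (delta : R) (I : Type) (r : seq I) (P : pred I)
    (F : I -> set 'rV[R]_n) : 0 <= delta ->
  (hausdorff_content k delta (\big[setU/set0]_(i <- r | P i) F i) <=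
   \sum_(i <- r | P i) hausdorff_content k delta (F i))%E.
Proof.
move=> d0; elim/big_rec2 : _ => [|i y A _ IH]; first by rewrite hausdorff_content0.
by apply: le_trans (hausdorff_contentU _ _ _) _; rewrite leeD2l.
Qed.

Definition separated (e : R) A B := forall x y, A x -> B y -> e <= edist x y.

(** A set of diameter less than [e] cannot meet both parts: the members of a cover that meet [A]
    cover [A], and the others cover [B]. *)
Lemma hausdorff_content_separated (e delta : R) A B : 0 < e -> delta < e ->
  separated e A B ->
  (hausdorff_content k delta A + hausdorff_content k delta B <=
   hausdorff_content k delta (A `|` B))%E.
Proof.
move=> e0 de sAB; apply: hausdorff_contentP => F ABF Fd.
pose FA (j : nat) : set 'rV[R]_n := if `[< F j `&` A !=set0 >] then F j else set0.
pose FB (j : nat) : set 'rV[R]_n := if `[< F j `&` A !=set0 >] then set0 else F j.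
have -> : (\sum_(0 <= j <oo) hausdorff_weight k (F j) =
  \sum_(0 <= j <oo) hausdorff_weight k (FA j) +
  \sum_(0 <= j <oo) hausdorff_weight k (FB j))%E.
  rewrite -nneseriesD; try by move=> *; exact: hausdorff_weight_ge0.
  apply: eq_eseriesr => j _; rewrite /FA /FB.
  by case: ifP; rewrite hausdorff_weight0 ?adde0 ?add0e.
have d0 : 0 <= delta by rewrite -lee_fin (le_trans (diam_ge0 (F 0%N))).
apply: leeD.
- apply: (@hausdorff_content_le _ _ FA) (lexx _).
    move=> x Ax; have [j _ Fj] := ABF x (or_introl Ax); exists j => //.
    by rewrite /FA; case: asboolP => // -[]; exists x.
  by move=> j; rewrite /FA; case: ifP => // _; rewrite diam0 lee_fin.
- apply: (@hausdorff_content_le _ _ FB) (lexx _).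
    move=> y By; have [j _ Fj] := ABF y (or_intror By); exists j => //.
    rewrite /FB; case: asboolP => // -[x [Fx Ax]].
    have := le_trans (edist_le_diam Fx Fj) (Fd j); rewrite lee_fin.
    by move=> /le_lt_trans/(_ de); rewrite ltNge sAB.
  by move=> j; rewrite /FB; case: ifP => // _; rewrite diam0 lee_fin.
Qed.

(** The metric outer measure property, the only form of additivity in the proof. The two suprema are
    taken separately, then compared at a common mesh below [d1], [d2] and [e]. *)
Lemma hausdorff_measure_separated (e : R) A B : 0 < e -> separated e A B ->
  (hausdorff_measure k A + hausdorff_measure k B <= hausdorff_measure k (A `|` B))%E.
Proof.
move=> e0 sAB; set X := hausdorff_measure k (A `|` B).
have [->|Xfin] := eqVneq X +oo%E; first exact: leey.
have X0 : (0 <= X)%E by exact: hausdorff_measure_ge0.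
have finX C : C `<=` A `|` B -> hausdorff_measure k C \is a fin_num.
  move=> CAB; rewrite ge0_fin_numE ?hausdorff_measure_ge0//.
  by apply: le_lt_trans (le_hausdorff_measure CAB) _; rewrite ltey.
have finA := finX A (@subsetUl _ _ _).
rewrite -leeBrDl//; apply: hausdorff_measure_le => d2 d20.
have fc2 : hausdorff_content k d2 B \is a fin_num.
  rewrite ge0_fin_numE ?hausdorff_content_ge0//.
  apply: le_lt_trans (hausdorff_content_le_measure _ d20) _.
  by rewrite -ge0_fin_numE ?hausdorff_measure_ge0//; apply/finX/subsetUr.
rewrite leeBrDl// -leeBrDr//; apply: hausdorff_measure_le => d1 d10.
rewrite leeBrDr//.
pose d := Num.min (Num.min d1 d2) (e / 2).
have d0 : 0 < d by rewrite !lt_min d10 d20 divr_gt0.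
apply: le_trans (hausdorff_content_le_measure _ d0).
apply: le_trans (@hausdorff_content_separated e d _ _ e0 _ sAB); last first.
  by rewrite !gt_min; apply/orP; right; rewrite ltr_pdivrMr// ltr_pMr// ltr1n.
by apply: leeD; apply: hausdorff_content_anti; rewrite !ge_min lexx ?orbT.
Qed.

Lemma hausdorff_measure_bigsetU_separated (e : R) (I : eqType) (r : seq I)
    (P : pred I) (F : I -> set 'rV[R]_n) : 0 < e -> uniq r ->
  (forall i j, P i -> P j -> i != j -> separated e (F i) (F j)) ->
  (\sum_(i <- r | P i) hausdorff_measure k (F i) <=
   hausdorff_measure k (\big[setU/set0]_(i <- r | P i) F i))%E.
Proof.
move=> e0 ur sF; elim: r ur => [|i r IH] /=; first by rewrite !big_nil hausdorff_measure_ge0.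
move=> /andP[ir ur]; rewrite !big_cons; case: ifP => Pi; last exact: IH.
apply: le_trans (leeD2l _ (IH ur)) _.
apply: hausdorff_measure_separated e0 _ => x y Fx.
elim: r ir {IH ur} => [|j r IH]; first by rewrite big_nil.
rewrite inE negb_or => /andP[ij /IH {}IH]; rewrite big_cons.
by case: ifP => Pj //; move=> [Fjy|//]; exact: (sF _ _ Pi Pj ij _ _ Fx Fjy).
Qed.

End Hausdorff.

(** * Similarities, and balls compared with cubes *)

Section Similarity.
Context {R : realType}.
Variables (n k : nat).

Lemma hausdorff_weight_similarity (r : R) (f : 'rV[R]_n -> 'rV[R]_n) A : 0 < r ->
  (forall x y, edist (f x) (f y) = r * edist x y) ->
  (hausdorff_weight k (f @` A) <= (r ^+ k)%:E * hausdorff_weight k A)%E.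
Proof.
move=> r0 fr; rewrite /hausdorff_weight.
have [->|A0] := eqVneq A set0; first by rewrite image_set0 eqxx mule0.
case: ifPn => _.
  have := hausdorff_weight_ge0 k A; rewrite /hausdorff_weight (negbTE A0).
  by apply: mule_ge0; rewrite lee_fin exprn_ge0// ltW.
rewrite muleCA lee_wpmul2l ?Vol_ge0//.
have d : (diam (f @` A) * 2^-1%:E <= r%:E * (diam A * 2^-1%:E))%E.
  rewrite muleA lee_wpmul2r ?lee_fin//; apply: diam_le.
    by rewrite mule_ge0 ?diam_ge0// lee_fin ltW.
  move=> _ _ [x Ax <-] [y Ay <-]; rewrite fr EFinM.
  by apply: lee_wpmul2l; [rewrite lee_fin ltW|exact: edist_le_diam].
have d0 : (0 <= diam (f @` A) * 2^-1%:E)%E by rewrite mule_ge0 ?diam_ge0// lee_fin.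
elim: k => [|m IH]; first by rewrite mule1.
rewrite !expeS exprS EFinM muleACA lee_pmul// expe_ge0//.
Qed.

Lemma diam_similarity (r : R) (f : 'rV[R]_n -> 'rV[R]_n) A (delta : R) : 0 < r ->
  (forall x y, edist (f x) (f y) = r * edist x y) ->
  (diam A <= (delta / r)%:E)%E -> (diam (f @` A) <= delta%:E)%E.
Proof.
move=> r0 fr Ad.
have : (0 <= (delta / r)%:E)%E by rewrite (le_trans (diam_ge0 A)).
rewrite lee_fin pmulr_lge0 ?invr_gt0// => d0; apply: diam_le; rewrite ?lee_fin//.
move=> _ _ [x Ax <-] [y Ay <-]; have := le_trans (edist_le_diam Ax Ay) Ad.
by rewrite fr !lee_fin ler_pdivlMr// mulrC.
Qed.

(** Covers of mesh [delta / r] are mapped to covers of mesh [delta]. The opposite inequality is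
    obtained, where wanted, from the inverse similarity. *)
Lemma hausdorff_measure_similarity (r : R) (f : 'rV[R]_n -> 'rV[R]_n) A : 0 < r ->
  (forall x y, edist (f x) (f y) = r * edist x y) ->
  (hausdorff_measure k (f @` A) <= (r ^+ k)%:E * hausdorff_measure k A)%E.
Proof.
move=> r0 fr; apply: hausdorff_measure_le => delta d0.
have rk : 0 < r ^+ k by rewrite exprn_gt0.
apply: le_trans (_ : (_ <= (r ^+ k)%:E * hausdorff_content k (delta / r) A)%E) _; last first.
  apply: lee_wpmul2l; first by rewrite lee_fin ltW.
  by apply: hausdorff_content_le_measure; rewrite divr_gt0.
rewrite -lee_pdivrMl//; apply: hausdorff_contentP => F AF Fd.
rewrite lee_pdivrMl//.
apply: (@hausdorff_content_le _ _ _ _ _ (fun j => f @` F j)).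
- by move=> _ [x /AF[j _ Fj] <-]; exists j => //; exists x.
- by move=> j; exact: diam_similarity fr (Fd j).
- rewrite -nneseriesZl; last by move=> j _; exact: hausdorff_weight_ge0.
  apply: lee_nneseries => [j _ _|j _]; first exact: hausdorff_weight_ge0.
  exact: hausdorff_weight_similarity.
Qed.

End Similarity.

Section Balls.
Context {R : realType}.
Implicit Type n : nat.

Lemma norm_le_edist n (x y : 'rV[R]_n) i : `|x 0 i - y 0 i| <= edist x y.
Proof.
rewrite -sqrtr_sqr ler_wsqrtr// (bigD1 i)//= lerDl.
by apply: sumr_ge0 => j _; exact: sqr_ge0.
Qed.

(** For [n <= 4] the factor [sqrt n] is at most 2; this covers the dimensions 2 of the weights and 3
    of the cube. *)
Lemma edist_le_sup n (x y : 'rV[R]_n) (e : R) : (n <= 4)%N -> 0 <= e ->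
  (forall i, `|x 0 i - y 0 i| <= e) -> edist x y <= 2 * e.
Proof.
move=> n4 e0 xy; have -> : 2 * e = Num.sqrt ((2 * e) ^+ 2).
  by rewrite sqrtr_sqr ger0_norm// mulr_ge0.
rewrite ler_wsqrtr//; apply: (@le_trans _ _ (\sum_(i < n) e ^+ 2)).
  apply: ler_sum => i _; rewrite -[leLHS]real_normK ?num_real//.
  by rewrite ler_pXn2r ?nnegrE.
rewrite sumr_const card_ord exprMn -[leLHS]mulr_natl ler_wpM2r ?sqr_ge0// -natrX.
by rewrite ler_nat.
Qed.

Lemma vmeasurable_eball n (x : 'rV[R]_n) (r : R) : vmeasurable (eball x r).
Proof.
have [r0|r0] := lerP r 0.
  rewrite (_ : eball x r = set0); first exact: measurable0.
  apply/seteqP; split=> // y /=; rewrite /eball/= => xy.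
  by have := le_lt_trans (edist_ge0 x y) (lt_le_trans xy r0); rewrite ltxx.
pose f (t : n.-tuple (measurableTypeR R)) : measurableTypeR R :=
  \sum_(i < n) (x 0 i - tnth t i) ^+ 2.
have mf : measurable_fun setT f.
  apply: (@measurable_sum _ _ _ _ _ _ _) => i.
  apply: measurable_funX.
  apply: measurable_funB; [exact: measurable_cst|exact: measurable_tnth].
rewrite /vmeasurable (_ : [set t | _] = f @^-1` `]-oo, r ^+ 2[).
  by rewrite -[_ @^-1` _]setTI; apply: mf => //; exact: measurable_itv.
apply/seteqP; split=> t; rewrite /= in_itv /= /eball /= /edist.
  rewrite -{1}(ger0_norm (ltW r0)) -sqrtr_sqr ltr_sqrt ?exprn_gt0//.
  by under eq_bigr do rewrite mxE.
move=> ft; rewrite -[ltRHS](ger0_norm (ltW r0)) -sqrtr_sqr ltr_sqrt ?exprn_gt0//.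
by under eq_bigr do rewrite mxE.
Qed.

Lemma Vol_eball_le n (x : 'rV[R]_n) (r : R) : 0 <= r ->
  (Vol (eball x r) <= ((2 * r) ^+ n)%:E)%E.
Proof.
move=> r0; have lu i : x 0 i - r <= x 0 i + r by lra.
have -> : (2 * r) ^+ n = \prod_(i < n) (x 0 i + r - (x 0 i - r)).
  rewrite (eq_bigr (fun=> 2 * r)) ?prodr_const ?card_ord// => i _; lra.
have := Vol_cbox lu; rewrite /= => <-; apply: le_Vol.
- exact: vmeasurable_eball.
- exact: vmeasurable_cbox.
move=> y /= xy i; have := le_lt_trans (norm_le_edist x y i) xy.
rewrite ltr_norml; lra.
Qed.

Lemma cbox_sub_eball n (x : 'rV[R]_n) (r e : R) : (n <= 4)%N -> 0 <= e -> 
  2 * e < r -> cbox (fun i => x 0 i - e) (fun i => x 0 i + e) `<=` eball x r.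
Proof.
move=> n4 e0 er y xy; rewrite /eball/=; apply: le_lt_trans er.
by apply: edist_le_sup => // i; have := xy i; rewrite ler_norml; lra.
Qed.

Lemma Vol_eball_ge n (x : 'rV[R]_n) (r : R) : (n <= 4)%N -> 0 < r ->
  (((r / 2) ^+ n)%:E <= Vol (eball x r))%E.
Proof.
move=> n4 r0; have lu i : x 0 i - r / 4 <= x 0 i + r / 4 by lra.
have -> : (r / 2) ^+ n = \prod_(i < n) (x 0 i + r / 4 - (x 0 i - r / 4)).
  rewrite (eq_bigr (fun=> r / 2)) ?prodr_const ?card_ord// => i _; lra.
have := Vol_cbox lu; rewrite /= => <-; apply: le_Vol.
- exact: vmeasurable_cbox.
- exact: vmeasurable_eball.
by apply: cbox_sub_eball => //; lra.
Qed.

Lemma Vol_eball_fin n (x : 'rV[R]_n) (r : R) : 0 <= r ->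
  Vol (eball x r) \is a fin_num.
Proof.
move=> r0; rewrite ge0_fin_numE ?Vol_ge0//.
by apply: le_lt_trans (Vol_eball_le x r0) _; rewrite ltey.
Qed.

(** The number pi, as the normalising constant of the two-dimensional weights. *)
Definition disc : R := fine (Vol (eball (0 : 'rV[R]_2) 1)).

Lemma discE : Vol (eball (0 : 'rV[R]_2) 1) = disc%:E.
Proof. by rewrite /disc fineK// Vol_eball_fin. Qed.

Lemma disc_gt0 : 0 < disc.
Proof.
rewrite -lte_fin -discE; apply: lt_le_trans (Vol_eball_ge _ _ _) => //.
by rewrite lte_fin exprn_gt0// divr_gt0.
Qed.

Lemma hausdorff_weight_le n (A : set 'rV[R]_n) (d : R) :
  (diam A <= d%:E)%E -> (hausdorff_weight 2 A <= (disc * (d / 2) ^+ 2)%:E)%E.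
Proof.
move=> Ad; have d0 : 0 <= d by rewrite -lee_fin (le_trans (diam_ge0 A)).
rewrite /hausdorff_weight; case: ifP => _.
  by rewrite lee_fin mulr_ge0 ?sqr_ge0// ltW// disc_gt0.
rewrite discE EFinM; apply: lee_wpmul2l; first by rewrite lee_fin ltW// disc_gt0.
rewrite EFin_expe EFinM; have h0 : (0 <= diam A * 2^-1%:E)%E.
  by rewrite mule_ge0 ?diam_ge0// lee_fin.
have h : (diam A * 2^-1%:E <= d%:E * 2^-1%:E)%E by rewrite lee_wpmul2r ?lee_fin.
exact: (lee_pmul h0 h0 h h).
Qed.

Lemma hausdorff_weightE n (A : set 'rV[R]_n) (d : R) :
  diam A = d%:E -> hausdorff_weight 2 A = (disc * (d / 2) ^+ 2)%:E.
Proof.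
move=> Ad; rewrite /hausdorff_weight; case: eqP => A0.
  move: Ad; rewrite A0 diam0 => -[<-]; by rewrite mul0r expr0n mulr0.
by rewrite discE Ad EFinM EFin_expe EFinM.
Qed.

End Balls.

Section Boxes.
Context {R : realType}.
Variable k : nat.

Lemma edist_similarity n (r : R) (c : 'I_n -> R) (s : 'S_n) (x y : 'rV[R]_n) :
  0 <= r -> edist (\row_i (c i + r * x 0 (s i))) (\row_i (c i + r * y 0 (s i))) =
  r * edist x y.
Proof.
move=> r0; rewrite /edist -{3}(ger0_norm r0) -sqrtr_sqr -sqrtrM ?sqr_ge0//.
congr Num.sqrt; rewrite mulr_sumr [RHS](reindex_inj (@perm_inj _ s)) /=.
by apply: eq_bigr => i _; rewrite !mxE; ring.
Qed.

Lemma hausdorff_measure_cbox_similarity n (r : R) (c : 'I_n -> R) (s : 'S_n)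
    (l u l' u' : 'I_n -> R) : 0 < r ->
  (forall i, l' i = c i + r * l (s i)) -> (forall i, u' i = c i + r * u (s i)) ->
  (hausdorff_measure k (cbox l' u') <= (r ^+ k)%:E * hausdorff_measure k (cbox l u))%E.
Proof.
move=> r0 ll uu; pose f (x : 'rV[R]_n) : 'rV[R]_n := \row_i (c i + r * x 0 (s i)).
apply: le_trans (hausdorff_measure_similarity k (f := f) _ r0 _); last first.
  by move=> x y; apply: edist_similarity; exact: ltW.
apply: le_hausdorff_measure => y ly.
exists (\row_i (r^-1 * (y 0 (s^-1 i)%g - c (s^-1 i)%g))).
  move=> i; rewrite mxE; have := ly (s^-1 i)%g; rewrite ll uu permKV.
  by rewrite [r^-1 * _]mulrC ler_pdivlMr// ler_pdivrMr// => /andP[? ?]; lra.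
apply/rowP => i; rewrite !mxE permK mulrA divff ?gt_eqF// mul1r; ring.
Qed.

(** The scale 1 case, used with [s] and with its inverse: only the side lengths matter, up to
    order. *)
Lemma hausdorff_measure_cbox_isometry n (s : 'S_n) (l u l' u' : 'I_n -> R) :
  (forall i, u' i - l' i = u (s i) - l (s i)) ->
  hausdorff_measure k (cbox l' u') = hausdorff_measure k (cbox l u).
Proof.
move=> lu; apply/eqP; rewrite eq_le; apply/andP; split.
  have := @hausdorff_measure_cbox_similarity n 1 (fun i => l' i - l (s i)) s
    l u l' u' ltr01; rewrite expr1n mul1e; apply => i; have := lu i; lra.
have := @hausdorff_measure_cbox_similarity n 1 (fun i => l i - l' (s^-1 i)%g)
  s^-1%g l' u' l u ltr01; rewrite expr1n mul1e; apply => i; first by ring.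
by have := lu (s^-1 i)%g; rewrite permKV; lra.
Qed.

End Boxes.

(** * Area of rectangular plates *)

Section Plates.
Context {R : realType}.
Local Notation H := (@hausdorff_measure R 3 2).

Definition vec3 (a b c : R) : 'I_3 -> R := fun i => nth 0 [:: a; b; c] i.

Lemma forall_ord3 (P : 'I_3 -> Prop) :
  P ord0 -> P (inord 1) -> P (inord 2) -> forall i, P i.
Proof.
move=> P0 P1 P2 i; have [/eqP|/eqP|/eqP] : [\/ i == 0 :> nat, i == 1%N :> nat | i == 2 :> nat].
  by case: i => -[|[|[|]]] //= _; [constructor 1|constructor 2|constructor 3].
- by move=> i0; rewrite (_ : i = ord0)//; exact: val_inj.
- by move=> i0; rewrite (_ : i = inord 1)//; apply: val_inj; rewrite /= inordK.
- by move=> i0; rewrite (_ : i = inord 2)//; apply: val_inj; rewrite /= inordK.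
Qed.

Lemma ord3_neq : ((inord 1 == ord0 :> 'I_3) = false) *
  ((inord 2 == ord0 :> 'I_3) = false) * ((inord 1 == inord 2 :> 'I_3) = false).
Proof. by do !split; rewrite -val_eqE /= ?inordK. Qed.

Definition plate (a b : R) : set 'rV[R]_3 := cbox (vec3 0 0 0) (vec3 0 a b).

Definition plate_cell (N i j : nat) : set 'rV[R]_3 :=
  cbox (vec3 0 (i%:R / N%:R) (j%:R / N%:R)) (vec3 0 (i.+1%:R / N%:R) (j.+1%:R / N%:R)).

Lemma plate_cover (a b : R) (N : nat) : (0 < N)%N ->
  plate a b `<=` \big[setU/set0]_(i < (Num.truncn (a * N%:R)).+1)
    \big[setU/set0]_(j < (Num.truncn (b * N%:R)).+1) plate_cell N i j.
Proof.
move=> N0 x xab; have N0' : 0 < N%:R :> R by rewrite ltr0n.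
have := xab ord0; have := xab (inord 1); have := xab (inord 2).
rewrite /vec3 /= !inordK//= => /andP[x2 x2b] /andP[x1 x1a] x0.
have x1N : 0 <= x 0 (inord 1) * N%:R by rewrite mulr_ge0.
have x2N : 0 <= x 0 (inord 2) * N%:R by rewrite mulr_ge0.
have i1 : (Num.truncn (x 0 (inord 1) * N%:R)%R < (Num.truncn (a * N%:R)%R).+1)%N.
  by rewrite ltnS le_truncn// ler_wpM2r.
have i2 : (Num.truncn (x 0 (inord 2) * N%:R)%R < (Num.truncn (b * N%:R)%R).+1)%N.
  by rewrite ltnS le_truncn// ler_wpM2r.
rewrite -bigcup_seq; exists (Ordinal i1); first by rewrite /= mem_index_enum.
rewrite -bigcup_seq; exists (Ordinal i2); first by rewrite /= mem_index_enum.
have /andP[t1 t1'] := truncn_itv x1N; have /andP[t2 t2'] := truncn_itv x2N.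
apply: forall_ord3; rewrite /vec3 /= ?inordK//=.
  by rewrite ler_pdivrMr// ler_pdivlMr// t1 ltW.
by rewrite ler_pdivrMr// ler_pdivlMr// t2 ltW.
Qed.

Lemma hausdorff_measure_bigsetU2 (p q : nat) (F : nat -> nat -> set 'rV[R]_3) (m : R) :
  (forall i j, H (F i j) <= m%:E)%E ->
  (H (\big[setU/set0]_(i < p) \big[setU/set0]_(j < q) F i j) <=
   (p%:R * q%:R * m)%:E)%E.
Proof.
move=> Fm; apply: le_trans (hausdorff_measure_bigsetU _ _ _ _) _.
apply: (@le_trans _ _ (\sum_(i < p) (q%:R * m)%:E)).
  apply: lee_sum => i _; apply: le_trans (hausdorff_measure_bigsetU _ _ _ _) _.
  apply: (@le_trans _ _ (\sum_(j < q) m%:E)); first by apply: lee_sum => j _.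
  by rewrite sumEFin sumr_const card_ord mulr_natl.
by rewrite sumEFin sumr_const card_ord lee_fin -mulrA [leRHS]mulr_natl.
Qed.

Lemma diam_plate_cell (N i j : nat) : (0 < N)%N ->
  (diam (plate_cell N i j) <= (2 / N%:R)%:E)%E.
Proof.
move=> N0; have N0' : 0 < N%:R :> R by rewrite ltr0n.
apply: diam_le; first by rewrite lee_fin divr_ge0.
move=> x y cx cy; rewrite lee_fin edist_le_sup// ?invr_ge0//.
have e (t : nat) : t.+1%:R / N%:R = t%:R / N%:R + N%:R^-1 :> R.
  by rewrite -natr1 mulrDl mul1r.
have n0 : 0 <= N%:R^-1 :> R by rewrite invr_ge0.
move=> l; rewrite ler_norml; have := cx l; have := cy l.
move: l; apply: forall_ord3; rewrite /vec3 /= ?inordK//= ?e.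
- lra.
- move: (i%:R / N%:R) => z; lra.
- move: (j%:R / N%:R) => z; lra.
Qed.

Lemma hausdorff_content_bigsetU2 (delta : R) (p q : nat)
    (F : nat -> nat -> set 'rV[R]_3) (m : R) : 0 <= delta ->
  (forall i j, hausdorff_content 2 delta (F i j) <= m%:E)%E ->
  (hausdorff_content 2 delta
     (\big[setU/set0]_(i < p) \big[setU/set0]_(j < q) F i j) <=
   (p%:R * q%:R * m)%:E)%E.
Proof.
move=> d0 Fm; apply: le_trans (hausdorff_content_bigsetU _ _ _ _ d0) _.
apply: (@le_trans _ _ (\sum_(i < p) (q%:R * m)%:E)).
  apply: lee_sum => i _; apply: le_trans (hausdorff_content_bigsetU _ _ _ _ d0) _.
  apply: (@le_trans _ _ (\sum_(j < q) m%:E)); first by apply: lee_sum => j _.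
  by rewrite sumEFin sumr_const card_ord mulr_natl.
by rewrite sumEFin sumr_const card_ord lee_fin -mulrA [leRHS]mulr_natl.
Qed.

(** There are [(N + 1)^2] covering cells of diameter at most [2 / N], each of weight at most
    [disc / N^2], and [(1 + 1/N)^2 <= 4]. [N] is chosen so that [2 / N <= delta]. *)
Lemma hausdorff_unit_plate_fin : H (plate 1 1) \is a fin_num.
Proof.
rewrite ge0_fin_numE ?hausdorff_measure_ge0//.
apply: (@le_lt_trans _ _ (4 * disc)%:E); last by rewrite ltey.
apply: hausdorff_measure_le => delta d0.
pose N := (Num.truncn (2 / delta)).+1.
have N0' : 0 < N%:R :> R by rewrite ltr0n.
have Nd : 2 / N%:R <= delta.
  by rewrite ler_pdivrMr// mulrC -ler_pdivrMr// ltW// truncnS_gt.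
apply: le_trans (hausdorff_content_subset _ _ (@plate_cover 1 1 N isT)) _.
rewrite mul1r natrK.
apply: le_trans (@hausdorff_content_bigsetU2 _ _ _ _ (disc * (2 / N%:R / 2) ^+ 2) (ltW d0) _) _.
  move=> i j; have dN := @diam_plate_cell N i j isT.
  apply: le_trans (hausdorff_weight_le dN).
  apply: hausdorff_content_le_weight; first exact: ltW.
  by apply: le_trans dN _; rewrite lee_fin.
rewrite lee_fin -natr1.
have -> : (N%:R + 1) * (N%:R + 1) * (disc * (2 / N%:R / 2) ^+ 2) =
  disc * ((N%:R + 1) / N%:R) ^+ 2 :> R by field; rewrite gt_eqF.
have e4 : 4 = 2 ^+ 2 :> R by rewrite -natrX.
rewrite mulrC ler_wpM2r ?(ltW disc_gt0)// e4.
have N1 : 1 <= N%:R :> R by rewrite ler1n.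
by rewrite ler_pXn2r ?nnegrE ?divr_ge0 ?addr_ge0 ?ler0n// ler_pdivrMr//; lra.
Qed.

(* Its value is never computed: the proof only needs 0 < plate_unit < oo, since
   all the perimeters to be compared are multiples of it. *)
Definition plate_unit : R := fine (H (plate 1 1)).

Lemma plate_unitE : H (plate 1 1) = plate_unit%:E.
Proof. by rewrite /plate_unit fineK// hausdorff_unit_plate_fin. Qed.

Lemma plate_unit_ge0 : 0 <= plate_unit.
Proof. by rewrite fine_ge0// hausdorff_measure_ge0. Qed.

Lemma plate_unit_gt0 : 0 < plate_unit.
Proof.
rewrite -lte_fin -plate_unitE.
(* A set of diameter [d] has weight [disc * (d / 2)^2] and will be enclosed in a box of volume
   [(2 d)^2]; the ratio is [disc / 16]. *)
have c0 : 0 < disc / 16 :> R by rewrite divr_gt0// disc_gt0.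
apply: (@lt_le_trans _ _ (disc / 16)%:E); first by rewrite lte_fin.
apply: le_trans (hausdorff_content_le_measure 2 (plate 1 1) (@ltr01 R)).
apply: hausdorff_contentP => F PF Fd.
(* Each set of the cover is enclosed in a box over [0, 1], so that the boxes
   cover the unit cube and their volumes add up to at least 1. *)
pose p j : 'rV[R]_3 := get (F j).
pose d j : R := fine (diam (F j)).
have dE j : diam (F j) = (d j)%:E.
  by rewrite /d fineK// ge0_fin_numE ?diam_ge0// (le_lt_trans (Fd j))// ltey.
have d0 j : 0 <= d j by rewrite -lee_fin -dE diam_ge0.
pose l j := vec3 0 (p j 0 (inord 1) - d j) (p j 0 (inord 2) - d j).
pose u j := vec3 1 (p j 0 (inord 1) + d j) (p j 0 (inord 2) + d j).
have VB j : Vol (cbox (l j) (u j)) = ((2 * d j) ^+ 2)%:E.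
  rewrite Vol_cbox; last first.
    apply: forall_ord3; rewrite /l /u /vec3 /= ?inordK//=; have := d0 j; lra.
  by rewrite !big_ord_recl big_ord0 /l /u /vec3 /=; congr (_%:E); ring.
have cov : cbox (vec3 0 0 0) (vec3 1 1 1) `<=` \bigcup_j cbox (l j) (u j).
  move=> x cx; pose y : 'rV[R]_3 := \row_i if i == ord0 then 0 else x 0 i.
  have Py : plate 1 1 y.
    apply: forall_ord3; rewrite !mxE -?val_eqE /= ?inordK//= /vec3 /= ?lexx// ?inordK//=.
      by have := cx (inord 1); rewrite /vec3 /= inordK.
    by have := cx (inord 2); rewrite /vec3 /= inordK.
  have [j _ Fy] := PF _ Py; exists j => //.
  (* For an empty [F j] the point [p j] is an arbitrary default; here [y] is a witness. *)
  have Fp : F j (p j) by apply: getPex; exists y.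
  have e i : `|p j 0 i - y 0 i| <= d j.
    apply: le_trans (norm_le_edist _ _ i) _.
    by rewrite -lee_fin -dE; exact: edist_le_diam.
  apply: forall_ord3; rewrite /l /u /vec3 /= ?inordK//=.
  - exact: (cx ord0).
  - by have := e (inord 1); rewrite mxE -val_eqE /= inordK//= ler_norml; lra.
  - by have := e (inord 2); rewrite mxE -val_eqE /= inordK//= ler_norml; lra.
have V1 : Vol (cbox (vec3 0 0 0) (vec3 1 1 1)) = 1%E.
  rewrite Vol_cbox; last by apply: forall_ord3; rewrite /vec3 /= ?inordK.
  by rewrite !big_ord_recl big_ord0 /vec3 /= subr0 !mulr1.
have : (1 <= \sum_(0 <= j <oo) Vol (cbox (l j) (u j)))%E.
  rewrite -V1; apply: measure_sigma_subadditive.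
  - by move=> j; exact: vmeasurable_cbox.
  - exact: vmeasurable_cbox.
  - by move=> t /cov[j _ Bj]; exists j.
have -> : (\sum_(0 <= j <oo) Vol (cbox (l j) (u j)) =
   (16 / disc)%:E * \sum_(0 <= j <oo) hausdorff_weight 2 (F j))%E.
  rewrite -nneseriesZl; last by move=> j _; exact: hausdorff_weight_ge0.
  apply: eq_eseriesr => j _; rewrite VB (hausdorff_weightE (dE j)) -EFinM.
  congr (_%:E); field; by rewrite gt_eqF ?disc_gt0.
by rewrite -lee_pdivrMl ?divr_gt0 ?disc_gt0// mule1 invf_div.
Qed.

End Plates.

Section PlateArea.
Context {R : realType}.
Local Notation H := (@hausdorff_measure R 3 2).

Lemma big_ord3 (T : Type) (idx : T) (op : Monoid.law idx) (P : pred 'I_3)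
    (F : 'I_3 -> T) : \big[op/idx]_(i < 3 | P i) F i =
  op (if P ord0 then F ord0 else idx)
    (op (if P (inord 1) then F (inord 1) else idx)
        (if P (inord 2) then F (inord 2) else idx)).
Proof.
rewrite big_mkcond !big_ord_recl big_ord0 Monoid.mulm1.
have -> : lift ord0 ord0 = inord 1 :> 'I_3 by apply: val_inj; rewrite /= inordK.
have -> // : lift ord0 (lift ord0 ord0) = inord 2 :> 'I_3.
by apply: val_inj; rewrite /= inordK.
Qed.

Lemma plate_cell_le (N i j : nat) : (0 < N)%N ->
  (H (plate_cell N i j) <= (plate_unit / N%:R ^+ 2)%:E)%E.
Proof.
move=> N0; have N0' : 0 < N%:R :> R by rewrite ltr0n.
have r0 : 0 < N%:R^-1 :> R by rewrite invr_gt0.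
have := @hausdorff_measure_cbox_similarity R 2 3 N%:R^-1
  (vec3 0 (i%:R / N%:R) (j%:R / N%:R)) 1%g (vec3 0 0 0) (vec3 0 1 1)
  (vec3 0 (i%:R / N%:R) (j%:R / N%:R)) (vec3 0 (i.+1%:R / N%:R) (j.+1%:R / N%:R)) r0.
rewrite -/(plate 1 1) plate_unitE -EFinM exprVn [_^-1 * plate_unit]mulrC; apply.
  by move=> t; rewrite perm1 [X in _ + _ * X](_ : _ = 0) ?mulr0 ?addr0//;
     move: t; apply: forall_ord3; rewrite /vec3 /= ?inordK.
move=> t; rewrite perm1; move: t; apply: forall_ord3; rewrite /vec3 /= ?inordK//=.
- by rewrite mulr0 addr0.
- by rewrite -natr1 mulrDl mulr1 mul1r.
- by rewrite -natr1 mulrDl mulr1 mul1r.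
Qed.

(** Counting cells of side [1 / N] gives at most [c (a + 1/N) (b + 1/N)]; the excess over [c a b] is
    at most [c (a + b + 1) / N], and [N] makes it at most [e]. *)
Lemma plate_le (a b : R) : 0 <= a -> 0 <= b ->
  (H (plate a b) <= (plate_unit * (a * b))%:E)%E.
Proof.
move=> a0 b0; apply/lee_addgt0Pr => e e0.
have c0 := @plate_unit_gt0 R; set c := (plate_unit : R) in c0 *.
pose N := (Num.truncn (c * (a + b + 1) / e)).+1.
have N0' : 0 < N%:R :> R by rewrite ltr0n.
have Ne : c * (a + b + 1) / N%:R <= e.
  by rewrite ler_pdivrMr// [e * _]mulrC -ler_pdivrMr// ltW// truncnS_gt.
apply: le_trans (le_hausdorff_measure _ (@plate_cover R a b N isT)) _.
apply: le_trans (hausdorff_measure_bigsetU2 _ _ (fun i j => plate_cell_le i j (ltn0Sn _))) _.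
rewrite -EFinD lee_fin -/N -/c.
have h (t : R) : 0 <= t -> (Num.truncn (t * N%:R)).+1%:R / N%:R <= t + N%:R^-1 :> R.
  move=> t0; rewrite -natr1 mulrDl mul1r lerD2r ler_pdivrMr//.
  by have /andP[] := truncn_itv (mulr_ge0 t0 (ltW N0')).
have h0 (t : R) : 0 <= (Num.truncn (t * N%:R)).+1%:R / N%:R :> R by rewrite divr_ge0.
have H1 := ler_pM (h0 a) (h0 b) (h a a0) (h b b0).
have NV : 0 <= N%:R^-1 :> R by rewrite invr_ge0.
have NV1 : N%:R^-1 <= 1 :> R by rewrite invf_le1// ler1n.
have H2 : (a + N%:R^-1) * (b + N%:R^-1) <= a * b + (a + b + 1) / N%:R.
  have : N%:R^-1 * N%:R^-1 <= N%:R^-1 :> R by rewrite ler_piMr.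
  move: (N%:R^-1 : R) => z; lra.
have H3 := ler_wpM2l (ltW c0) (le_trans H1 H2).
apply: le_trans (_ : c * (a * b + (a + b + 1) / N%:R) <= _); last first.
  by rewrite mulrDr lerD2l mulrA.
apply: le_trans H3; rewrite le_eqVlt; apply/predU1P; left.
by field; rewrite gt_eqF.
Qed.

Lemma plate_isometry (l u : 'I_3 -> R) (a b : R) : u ord0 - l ord0 = 0 ->
  u (inord 1) - l (inord 1) = a -> u (inord 2) - l (inord 2) = b ->
  H (cbox l u) = H (plate a b).
Proof.
move=> e0 e1 e2; apply: (@hausdorff_measure_cbox_isometry R 2 3 1%g).
by move=> i; rewrite perm1; move: i; apply: forall_ord3; rewrite /vec3 /= ?inordK//= subr0.
Qed.

(* The upper bound applied to the complement of the plate in a large square. *)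
Lemma plate_ge (a b : R) : 0 <= a -> 0 <= b ->
  ((plate_unit * (a * b))%:E <= H (plate a b))%E.
Proof.
move=> a0 b0; have [->|an0] := eqVneq a 0.
  by rewrite mul0r mulr0 hausdorff_measure_ge0.
have a1 : 0 < a by rewrite lt_def an0.
have fH : H (plate a b) \is a fin_num.
  rewrite ge0_fin_numE ?hausdorff_measure_ge0//.
  by apply: le_lt_trans (plate_le a0 b0) _; rewrite ltey.
have K0 : 0 < a + b by rewrite ltr_wpDr.
set K := a + b in K0.
(* For a square the lower bound needs only scaling to the unit plate. [K = a + b] is positive and
   exceeds neither side's range: [a <= K] and [b <= K]. *)
have HK : ((K ^+ 2 * plate_unit)%:E <= H (plate K K))%E.
  have r0 : 0 < K^-1 by rewrite invr_gt0.
  have := @hausdorff_measure_cbox_similarity R 2 3 K^-1 (vec3 0 0 0) 1%g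
   (vec3 0 0 0) (vec3 0 K K) (vec3 0 0 0) (vec3 0 1 1) r0.
  rewrite -!/(plate _ _) plate_unitE exprVn -lee_pdivrMl ?invr_gt0 ?exprn_gt0// invrK.
  rewrite -EFinM; apply.
    move=> t; rewrite perm1; move: t.
    by apply: forall_ord3; rewrite /vec3 /= ?inordK//= mulr0 addr0.
  move=> t; rewrite perm1; move: t; apply: forall_ord3;
    by rewrite /vec3 /= ?inordK//= ?mulr0 ?addr0 ?add0r// mulVf// gt_eqF.
pose P1 : set 'rV[R]_3 := cbox (vec3 0 a 0) (vec3 0 K K).
pose P2 : set 'rV[R]_3 := cbox (vec3 0 0 b) (vec3 0 a K).
have sub : plate K K `<=` plate a b `|` P1 `|` P2.
  move=> x xK; have := xK ord0; have := xK (inord 1); have := xK (inord 2).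
  rewrite /vec3 /= !inordK//= => x2 x1 x0.
  have [xa|xa] := lerP (x 0 (inord 1)) a; last first.
    left; right; apply: forall_ord3; rewrite /vec3 /= ?inordK//=; lra.
  have [xb|xb] := lerP (x 0 (inord 2)) b.
    left; left; apply: forall_ord3; rewrite /vec3 /= ?inordK//=; lra.
  right; apply: forall_ord3; rewrite /vec3 /= ?inordK//=; lra.
have H1 : (H P1 <= (plate_unit * ((K - a) * K))%:E)%E.
  rewrite (@plate_isometry _ _ (K - a) K) /vec3 /= ?inordK//= ?subrr ?subr0//.
  by apply: plate_le; rewrite /K; lra.
have H2 : (H P2 <= (plate_unit * (a * (K - b)))%:E)%E.
  rewrite (@plate_isometry _ _ a (K - b)) /vec3 /= ?inordK//= ?subrr ?subr0//.
  by apply: plate_le; rewrite /K; lra.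
have := le_trans HK (le_hausdorff_measure 2 sub).
move=> /le_trans/(_ (hausdorff_measureU _ _ _)).
move=> /le_trans/(_ (leeD (hausdorff_measureU _ _ _) H2)).
move=> /le_trans/(_ (leeD (leeD (lexx _) H1) (lexx _))).
rewrite -(fineK fH) -!EFinD !lee_fin /K; lra.
Qed.

Lemma plate_area (a b : R) : 0 <= a -> 0 <= b ->
  H (plate a b) = (plate_unit * (a * b))%:E.
Proof. by move=> a0 b0; apply/eqP; rewrite eq_le plate_le// plate_ge. Qed.

(** Exchanging [d] with the first coordinate turns the face into a plate. *)
Lemma face_area (d : 'I_3) (l u : 'I_3 -> R) : l d = u d ->
  (forall i, l i <= u i) ->
  H (cbox l u) = (plate_unit * \prod_(i < 3 | i != d) (u i - l i))%:E.
Proof.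
move=> ld lu; have lu' i : 0 <= u i - l i by rewrite subr_ge0.
have [[E1 E2] E3] := ord3_neq.
rewrite big_ord3; move: d ld; apply: forall_ord3 => ld;
  rewrite ?eqxx ?(eq_sym ord0) ?(eq_sym (inord 2) (inord 1)) ?E1 ?E2 ?E3 /=
    ?mulr1 ?mul1r.
- by rewrite -plate_area//; apply: plate_isometry; rewrite ?ld ?subrr.
- rewrite -plate_area//.
  apply: (@hausdorff_measure_cbox_isometry R 2 3 (tperm ord0 (inord 1))).
  apply: forall_ord3.
  - by rewrite tpermL /vec3 /= inordK//= subr0.
  - by rewrite tpermR /vec3 /= ld !subrr.
  - rewrite tpermD ?E3// 1?eq_sym ?E2//.
    by rewrite /vec3 /= inordK//= subr0.
- rewrite [_ * (u (inord 1) - _)]mulrC -plate_area//.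
  apply: (@hausdorff_measure_cbox_isometry R 2 3 (tperm ord0 (inord 2))).
  apply: forall_ord3.
  - by rewrite tpermL /vec3 /= inordK//= subr0.
  - rewrite tpermD 1?eq_sym ?E1 ?E3//.
    by rewrite /vec3 /= inordK//= subr0.
  - by rewrite tpermR /vec3 /= ld !subrr.
Qed.

End PlateArea.

(** * Essential boundaries, grids and faces *)

Section Topology.
Context {R : realType}.
Implicit Type n : nat.

Lemma open_obox n (l u : 'I_n -> R) : open (obox l u).
Proof.
rewrite openE => x xlu; rewrite /interior /=.
suff H (i : 'I_n) : nbhs x [set y : 'rV[R]_n | l i < y 0 i < u i].
  exact: (@filter_forall _ _ (fun i (y : 'rV[R]_n) => l i < y 0 i < u i) _ _ H).
have /andP[lx xu] := xlu i.
have cx : {for x, continuous (fun M : 'rV[R]_n => M 0 i)} by exact: coord_continuous.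
have h1 : nbhs x [set y : 'rV[R]_n | l i < y 0 i] :=
  @cvgr_gt _ _ _ (nbhs_filter x) _ _ cx _ lx.
have h2 : nbhs x [set y : 'rV[R]_n | y 0 i < u i] :=
  @cvgr_lt _ _ _ (nbhs_filter x) _ _ cx _ xu.
by apply: filterS2 h1 h2 => y /= -> ->.
Qed.

Lemma obox_interior n (l u : 'I_n -> R) (A : set 'rV[R]_n) :
  obox l u `<=` A -> obox l u `<=` A°.
Proof. by rewrite open_subsetE//; exact: open_obox. Qed.

Lemma obox_cbox n (l u : 'I_n -> R) : obox l u `<=` cbox l u.
Proof. by move=> x xo i; have /andP[a b] := xo i; rewrite !ltW. Qed.

Lemma compact_cbox n (l u : 'I_n -> R) : compact (cbox l u).
Proof.
rewrite (_ : cbox l u = [set v : 'rV[R]_n | forall i, `[l i, u i]%classic (v ord0 i)]).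
  by apply: (@rV_compact R n (fun i => `[l i, u i]%classic)) => i; exact: segment_compact.
by apply/seteqP; split=> x xlu i; have := xlu i; rewrite /= in_itv.
Qed.

Lemma compact_closed_rV n (A : set 'rV[R]_n) : compact A -> closed A.
Proof. by apply: compact_closed; exact: norm_hausdorff. Qed.

Lemma closed_cbox n (l u : 'I_n -> R) : closed (cbox l u).
Proof. by apply: compact_closed_rV; exact: compact_cbox. Qed.

Lemma boundary_cbox n (l u : 'I_n -> R) x : boundary (cbox l u) x ->
  cbox l u x /\ exists i, x 0 i = l i \/ x 0 i = u i.
Proof.
move=> [xc xi]; have {}xc : cbox l u x.
  by rewrite ((closure_id _).1 (@closed_cbox _ l u)).
split=> //; apply: contrapT => H; apply: xi.
apply: (obox_interior (@obox_cbox _ l u)) => i; have /andP[a b] := xc i; apply/andP; split.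
  by rewrite lt_neqAle a andbT; apply/eqP => e; apply: H; exists i; left.
by rewrite lt_neqAle b andbT; apply/eqP => e; apply: H; exists i; right.
Qed.

Lemma eball_sub_nbhs n (x : 'rV[R]_n) (A : set 'rV[R]_n) : nbhs x A ->
  exists2 e : R, 0 < e & forall r, r <= e -> eball x r `<=` A.
Proof.
move=> /nbhs_ballP[e /= e0 eA]; exists e => // r re y xy; apply: eA.
apply/ball_rVP => // i; apply: le_lt_trans (norm_le_edist x y i) _.
exact: lt_le_trans re.
Qed.

Lemma interior_cube n (x : 'rV[R]_n) : (@cube R n)° x -> forall i, 0 < x 0 i < 1.
Proof.
move=> /nbhs_ballP[e /= e0 eA] i.
have b1 : ball x e (\row_j (x 0 j - e / 2)).
  apply/ball_rVP => // j; rewrite mxE opprB addrC subrK gtr0_norm ?divr_gt0//.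
  lra.
have b2 : ball x e (\row_j (x 0 j + e / 2)).
  apply/ball_rVP => // j; rewrite mxE opprD addrA subrr add0r normrN gtr0_norm ?divr_gt0//.
  lra.
have := eA _ b1 i; have := eA _ b2 i; rewrite !mxE; lra.
Qed.

Lemma interior_cubeP n (x : 'rV[R]_n) : (forall i, 0 < x 0 i < 1) ->
  ~ boundary (@cube R n) x.
Proof.
move=> x01 [_]; apply.
exact: (obox_interior (@obox_cbox _ (fun=> 0) (fun=> 1))).
Qed.

Lemma fine_Vol_eball_gt0 n (x : 'rV[R]_n) (r : R) : (n <= 4)%N -> 0 < r ->
  0 < fine (Vol (eball x r)).
Proof.
move=> n4 r0; rewrite -lte_fin fineK ?Vol_eball_fin ?ltW//.
by apply: lt_le_trans (Vol_eball_ge x n4 r0); rewrite lte_fin exprn_gt0// divr_gt0.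
Qed.

Lemma has_density_interior n (A : set 'rV[R]_n) x : (n <= 4)%N ->
  nbhs x A -> has_density A x 1.
Proof.
move=> n4 /eball_sub_nbhs[e e0 eA]; apply: cvg_near_cst.
near=> r; have r0 : 0 < r by near: r; exact: nbhs_right_gt.
rewrite (_ : A `&` eball x r = eball x r) ?divff ?gt_eqF ?fine_Vol_eball_gt0//.
apply/setIidPr; apply: eA; near: r; exact: nbhs_right_le.
Unshelve. all: by end_near. Qed.

Lemma has_density_exterior n (A : set 'rV[R]_n) x :
  nbhs x (~` A) -> has_density A x 0.
Proof.
move=> /eball_sub_nbhs[e e0 eA]; apply: cvg_near_cst.
near=> r.
rewrite (_ : A `&` eball x r = set0) ?Vol0 ?mul0r//.
apply/seteqP; split=> // y [Ay yr]; apply: (eA r) Ay => //.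
by near: r; exact: nbhs_right_le.
Unshelve. all: by end_near. Qed.

(** Interior points have density 1, exterior points density 0. *)
Lemma essential_boundary_sub n (A : set 'rV[R]_n) : (n <= 4)%N ->
  essential_boundary A `<=` boundary A.
Proof.
move=> n4 x [d0 d1]; split.
  move=> B xB; apply: contrapT => AB; apply: d0; apply: has_density_exterior.
  by apply: filterS xB => y By Ay; apply: AB; exists y.
by move=> Ax; apply: d1; exact: has_density_interior.
Qed.

(** The ball has volume at most [(2 r)^n], so the density quotient stays between [kappa / 2^n] and
    [1 - kappa / 2^n] and can tend neither to 0 nor to 1. *)
Lemma essential_boundaryI n (A : set 'rV[R]_n) x (rho kappa : R) : (n <= 4)%N ->
  vmeasurable A -> 0 < rho -> 0 < kappa ->
  (forall r, 0 < r -> r < rho -> exists C D,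
    [/\ vmeasurable C, vmeasurable D, C `<=` A `&` eball x r,
        D `<=` eball x r `\` A & ((kappa * r ^+ n)%:E <= Vol C)%E
        /\ ((kappa * r ^+ n)%:E <= Vol D)%E]) ->
  essential_boundary A x.
Proof.
move=> n4 mA rho0 k0 H.
pose f r := fine (Vol (A `&` eball x r)) / fine (Vol (eball x r)).
have k2 : 0 < kappa / 2 ^+ n by rewrite divr_gt0// exprn_gt0.
have key r : 0 < r -> r < rho -> kappa / 2 ^+ n <= f r <= 1 - kappa / 2 ^+ n.
  move=> r0 rr; have [C [D [mC mD CA DA [VC VD]]]] := H r r0 rr.
  have v0 := fine_Vol_eball_gt0 x n4 r0.
  have mb := vmeasurable_eball x r.
  have mAb := vmeasurableI mA mb; have mbA := vmeasurableD mb mA.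
  have fb : Vol (eball x r) \is a fin_num by rewrite Vol_eball_fin// ltW.
  have sub E : vmeasurable E -> E `<=` eball x r -> Vol E \is a fin_num.
    move=> mE Eb; rewrite ge0_fin_numE ?Vol_ge0//.
    by apply: le_lt_trans (le_Vol mE mb Eb) _; rewrite -ge0_fin_numE ?Vol_ge0.
  have fAb := sub _ mAb (@subIsetr _ _ _).
  have fbA := sub _ mbA (@subDsetl _ _ _).
  have e : fine (Vol (eball x r)) =
      fine (Vol (A `&` eball x r)) + fine (Vol (eball x r `\` A)).
    rewrite -fineD// -VolU//; last first.
      by apply/seteqP; split=> // y [[Ay _] [_ nAy]].
    by rewrite setIC setUIDK.
  have c1 : kappa * r ^+ n <= fine (Vol (A `&` eball x r)).
    rewrite -lee_fin fineK//; apply: le_trans VC _; exact: le_Vol.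
  have c2 : kappa * r ^+ n <= fine (Vol (eball x r `\` A)).
    rewrite -lee_fin fineK//; apply: le_trans VD _; exact: le_Vol.
  have c3 : fine (Vol (eball x r)) <= (2 * r) ^+ n.
    by rewrite -lee_fin fineK// Vol_eball_le// ltW.
  have c4 : kappa / 2 ^+ n * fine (Vol (eball x r)) <= kappa * r ^+ n.
    apply: le_trans (ler_wpM2l (ltW k2) c3) _.
    by rewrite exprMn mulrA divfK// gt_eqF// exprn_gt0.
  rewrite /f ler_pdivlMr// ler_pdivrMr// (le_trans c4 c1) mulrBl mul1r.
  move: e c1 c2 c4; move: (fine (Vol (A `&` _))) (fine (Vol (_ `\` _))) (fine _) => a b c.
  by move=> *; lra.
have near_key : \forall r \near 0^'+, kappa / 2 ^+ n <= f r <= 1 - kappa / 2 ^+ n.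
  near=> r; apply: key; near: r; [exact: nbhs_right_gt|exact: nbhs_right_lt].
have lo : \forall r \near 0^'+, kappa / 2 ^+ n <= f r.
  by apply: filterS near_key => r /andP[].
have hi : \forall r \near 0^'+, f r <= 1 - kappa / 2 ^+ n.
  by apply: filterS near_key => r /andP[].
split=> d.
- suff : kappa / 2 ^+ n <= 0 by rewrite leNgt k2.
  rewrite -(cvg_lim (@Rhausdorff R) d); exact: limr_ge (cvgP _ d) lo.
- suff : 1 <= 1 - kappa / 2 ^+ n by rewrite leNgt gtrBl k2.
  rewrite -{1}(cvg_lim (@Rhausdorff R) d); exact: limr_le (cvgP _ d) hi.
Unshelve. all: by end_near. Qed.

Lemma cubical_cbox n (l u : 'I_n -> R) : (forall i, 0 <= l i) ->
  (forall i, u i <= 1) -> cubical (cbox l u).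
Proof.
move=> l0 u1; split; first exact: compact_cbox.
  by move=> x xlu i; have /andP[a b] := xlu i; rewrite (le_trans (l0 i)) ?(le_trans b).
exists ([seq (i, l i) | i <- enum 'I_n] ++ [seq (i, u i) | i <- enum 'I_n]).
move=> x /boundary_cbox[_ [i [xi|xi]]].
  by exists (i, l i) => //=; rewrite mem_cat map_f ?mem_enum.
by exists (i, u i) => //=; rewrite mem_cat orbC map_f ?mem_enum.
Qed.

Definition corner_side n (m : nat) (a : R) (i : 'I_n) : R := if (i < m)%N then a else 1.

Lemma corner_boxE n (m : nat) (a : R) :
  @corner_box R n m a = cbox (fun=> 0) (corner_side m a).
Proof. by []. Qed.

Lemma cubical_corner_box n (m : nat) (a : R) : a <= 1 -> cubical (@corner_box R n m a).
Proof.
by move=> a1; apply: cubical_cbox => i; rewrite /corner_side//; case: ifP.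
Qed.

Lemma Vol_corner_box (m : nat) (a : R) : (m <= 3)%N -> 0 <= a ->
  Vol (@corner_box R 3 m a) = (a ^+ m)%:E.
Proof.
move=> m3 a0; rewrite corner_boxE Vol_cbox; last first.
  by move=> i; rewrite /corner_side; case: ifP.
congr (_%:E); rewrite big_ord3 /corner_side !inordK//=.
by case: m m3 => [|[|[|[|]]]] //= _; ring.
Qed.

(** A boundary point of the box that is interior to the cube has some coordinate [i < m] equal to
    [a]. Each of these [m] faces has area [a^(m-1)] in units of [plate_unit], and subadditivity
    suffices. *)
Lemma RelPer_corner_box (m : nat) (a : R) : (1 <= m <= 3)%N -> 0 <= a -> a <= 1 ->
  (RelPer (@corner_box R 3 m a) <= (plate_unit * (m%:R * a ^+ m.-1))%:E)%E.
Proof.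
move=> m13 a0 a1; pose u := @corner_side 3 m a.
have u0 i : 0 <= u i by rewrite /u /corner_side; case: ifP.
pose F (i : 'I_3) : set 'rV[R]_3 :=
  cbox (fun j => if j == i then a else 0) (fun j => if j == i then a else u j).
have sub : essential_boundary (@corner_box R 3 m a) `\` boundary (@cube R 3) `<=`
    \big[setU/set0]_(i < 3 | (i < m)%N) F i.
  move=> x [/(essential_boundary_sub (isT : (3 <= 4)%N)) xb xc].
  have [xbox [i xi]] := boundary_cbox xb.
  have xcube : @cube R 3 x.
    move=> j; have /andP[x0 xu] := xbox j; rewrite x0 (le_trans xu)//.
    by rewrite /corner_side; case: ifP.
  have x01 : forall j, 0 < x 0 j < 1.
    apply: interior_cube; apply: contrapT => nx; apply: xc; split=> //.
    exact: subset_closure.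
  have xia : (i < m)%N /\ x 0 i = a.
    have /andP[x0 x1] := x01 i.
    case: xi => xi; first by move: x0; rewrite xi ltxx.
    move: x1; rewrite xi /corner_side; case: ifP => //; by rewrite ltxx.
  rewrite -bigcup_seq_cond; exists i; first by rewrite /= mem_index_enum xia.1.
  move=> j /=; case: eqP => [->|_]; first by rewrite xia.2 lexx.
  exact: xbox.
apply: le_trans (le_hausdorff_measure _ sub) _.
apply: le_trans (hausdorff_measure_bigsetU _ _ _ _) _.
have FE i : hausdorff_measure 2 (F i) = (plate_unit * \prod_(j < 3 | j != i) u j)%:E.
  rewrite (@face_area _ i); last 2 first.
  - by rewrite eqxx.
  - by move=> j; case: eqP.
  congr (_ * _)%:E; apply: eq_bigr => j /negbTE ->; by rewrite subr0.
under eq_bigr do rewrite FE.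
rewrite sumEFin -mulr_sumr lee_fin; apply: ler_wpM2l; first exact: plate_unit_ge0.
have [[E1 E2] E3] := ord3_neq.
rewrite !big_ord3 !eqxx ?(eq_sym ord0) ?(eq_sym (inord 2) (inord 1)) E1 E2 E3 /=.
rewrite /u /corner_side !inordK//=.
by case: m m13 {u u0 F sub FE} => [|[|[|[|]]]] //= _; rewrite le_eqVlt; apply/predU1P; left; ring.
Qed.

End Topology.

(** * Grids adapted to a cubical set *)

Section Connected.
Context {R : realType}.

(** On a segment inside the box starting in [X], the trace of [X] is closed, and open because the
    boundary is avoided; by connectedness it is the whole segment. *)
Lemma obox_boundary n (l u : 'I_n -> R) (X : set 'rV[R]_n) : closed X ->
  obox l u `&` boundary X = set0 -> obox l u `<=` X \/ obox l u `&` X = set0.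
Proof.
move=> cX bX; apply: contrapT => /not_orP[nsub /eqP/set0P[x [xo Xx]]].
apply: nsub => y yo.
pose f (t : R) : 'rV[R]_n := x + t *: (y - x).
have cf : continuous f.
  move=> t; apply: cvgD; first exact: cvg_cst.
  exact: scalel_continuous.
have fo t : 0 <= t <= 1 -> obox l u (f t).
  move=> /andP[t0 t1] i; rewrite !mxE; have /andP[a b] := xo i; have /andP[c d] := yo i.
  have t1' : 0 <= 1 - t by rewrite subr_ge0.
  have -> : x 0 i + t * (y 0 i - x 0 i) = (1 - t) * x 0 i + t * y 0 i by ring.
  have [->|tp] := eqVneq t 0; first by rewrite subr0 mul1r mul0r addr0 a b.
  have tp' : 0 < t by rewrite lt_def tp.
  have h1 := ler_wpM2l t1' (ltW a); have h2 := ler_wpM2l t1' (ltW b).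
  have h3 : 0 < t * (y 0 i - l i) by rewrite mulr_gt0// subr_gt0.
  have h4 : 0 < t * (u i - y 0 i) by rewrite mulr_gt0// subr_gt0.
  lra.
have int t : 0 <= t <= 1 -> X (f t) -> X° (f t).
  move=> t01 Xf; apply: contrapT => nint.
  have : (obox l u `&` boundary X) (f t).
    by split; [exact: fo|split=> //; exact: subset_closure].
  by rewrite bX.
have E : `[0, 1]%classic `&` f @^-1` X = `[0, 1]%classic.
  apply: (@segment_connected R 0 1).
  - by exists 0; split; rewrite /= ?in_itv /= ?lexx ?ler01// /f scale0r addr0.
  - exists (f @^-1` X°).
      by apply: open_comp => [t _|]; [exact: cf|exact: open_interior].
    apply/seteqP; split=> t [t01 Xt]; split=> //.
      by apply: int => //; move: t01; rewrite /= in_itv.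
    exact: interior_subset Xt.
  - by exists (f @^-1` X) => //; apply: closed_comp => // t _; exact: cf.
have : (`[0, 1]%classic `&` f @^-1` X) 1 by rewrite E /= in_itv /= ler01 lexx.
by case=> _; rewrite /f /= scale1r addrC subrK.
Qed.

End Connected.

Section Grid.
Context {R : realType}.

Definition gcell n (g : nat -> R) (t : 'I_n -> nat) : set 'rV[R]_n :=
  obox (fun i => g (t i)) (fun i => g (t i).+1).

Definition grid (q : nat) (g : nat -> R) :=
  [/\ g 0%N = 0, g q.+1 = 1 & forall j, (j <= q)%N -> g j < g j.+1].

Lemma grid_lt q g : grid q g -> forall i j, (i < j)%N -> (j <= q.+1)%N -> g i < g j.
Proof.
move=> [_ _ gS] i j; elim: j => // j IH; rewrite ltnS leq_eqVlt => /predU1P[->|ij] jq.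
  exact: gS.
by apply: lt_trans (IH ij (ltnW jq)) _; exact: gS.
Qed.

Lemma grid_le q g : grid q g -> forall i j, (i <= j)%N -> (j <= q.+1)%N -> g i <= g j.
Proof.
move=> gg i j; rewrite leq_eqVlt => /predU1P[->//|ij] jq.
exact: ltW (grid_lt gg ij jq).
Qed.

Lemma exists_grid (s : seq R) : exists q g, grid q g /\
  forall c, c \in s -> 0 < c < 1 -> exists2 j, (j <= q.+1)%N & c = g j.
Proof.
pose L := sort <=%R (undup [seq c <- s | 0 < c < 1]).
have L01 c : (c \in L) = (c \in s) && (0 < c < 1).
  by rewrite mem_sort mem_undup mem_filter andbC.
have Ls : sorted <%R L by rewrite sort_lt_sorted undup_uniq.
pose gs := 0 :: rcons L 1.
have gss : sorted <%R gs.
  rewrite /= rcons_path; apply/andP; split.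
    rewrite lt_path_sortedE Ls andbT; apply/allP => c.
    by rewrite L01 => /and3P[].
  have := mem_last 0 L; rewrite inE => /orP[/eqP ->|]; first exact: ltr01.
  by rewrite L01 => /and3P[].
have szgs : size gs = (size L).+2 by rewrite /= size_rcons.
exists (size L), (nth 1 gs); split; first split=> //.
- by rewrite /= nth_rcons ltnn eqxx.
- move=> j jL; have /sortedP := gss; apply.
  by rewrite szgs !ltnS.
move=> c cs c01; have cL : c \in L by rewrite L01 cs.
have cg : c \in gs by rewrite inE mem_rcons inE cL !orbT.
exists (index c gs); last by rewrite nth_index.
by rewrite -ltnS -szgs index_mem.
Qed.

(** The positions of all hyperplanes are pooled whatever their direction, so that a single
    subdivision, hence a single family of weights, serves every axis. *)
Lemma cubical_grid n (X : set 'rV[R]_n) : cubical X -> exists q g, grid q g /\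
  forall t : 'I_n -> nat, (forall i, (t i <= q)%N) ->
    gcell g t `<=` X \/ gcell g t `&` X = set0.
Proof.
move=> [cX _ [s Xs]]; have [q [g [gg gs]]] := exists_grid [seq h.2 | h <- s].
exists q, g; split=> // t tq; apply: obox_boundary; first exact: compact_closed_rV.
apply/seteqP; split=> // x [xt /Xs[[i c] /= ics xic]].
have /andP[lx xu] := xt i; move: lx xu; rewrite xic => lx xu.
have [g0 g1 _] := gg.
have c0 : 0 < c by apply: le_lt_trans lx; rewrite -g0; apply: (grid_le gg) => //; exact: leqW.
have c1 : c < 1 by apply: lt_le_trans xu _; rewrite -g1; apply: (grid_le gg) => //; rewrite ltnS.
have [||j jq cj] := gs c; [by apply/mapP; exists (i, c)|by rewrite c0|].
have [jt|tj] := leqP j (t i).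
  by have := grid_le gg jt (leqW (tq i)); rewrite -cj leNgt lx.
by have := grid_le gg tj jq; rewrite -cj leNgt xu.
Qed.

Lemma grid_locate q g (y : R) : grid q g -> 0 <= y <= 1 ->
  (forall j, (j <= q.+1)%N -> y != g j) ->
  exists2 j, (j <= q)%N & g j < y < g j.+1.
Proof.
move=> [g0 g1 _] /andP[y0 y1] yg.
have H k : (k <= q.+1)%N -> y < g k -> exists2 j, (j < k)%N & g j < y < g j.+1.
  elim: k => [|k IH] kq yk; first by move: yk; rewrite g0 ltNge y0.
  have [ygk|gky|e] := ltgtP y (g k).
  - by have [j jk jy] := IH (ltnW kq) ygk; exists j => //; exact: leqW.
  - by exists k; rewrite // gky.
  - by have := yg k (ltnW kq); rewrite e eqxx.
have yl : y < g q.+1 by rewrite lt_neqAle yg// g1.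
by have [j jq jy] := H _ (leqnn _) yl; exists j.
Qed.

Lemma gcell_disjoint n q g (t t' : 'I_n -> nat) i : grid q g ->
  (t i <= q)%N -> (t' i <= q)%N -> t i != t' i -> gcell g t `&` gcell g t' = set0.
Proof.
move=> gg tq tq'; rewrite neq_ltn => tt; apply/seteqP; split=> // x [xt xt'].
have /andP[a b] := xt i; have /andP[c d] := xt' i.
case/orP: tt => tt.
  by have := grid_le gg tt (leqW tq'); rewrite leNgt (lt_trans c b).
by have := grid_le gg tt (leqW tq); rewrite leNgt (lt_trans a d).
Qed.

Definition tri (j k l : nat) : 'I_3 -> nat := fun i => nth 0%N [:: j; k; l] i.

Definition gwidth (g : nat -> R) (j : nat) : R := g j.+1 - g j.

Definition gpattern (g : nat -> R) (X : set 'rV[R]_3) (j k l : nat) : bool :=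
  `[< gcell g (tri j k l) `<=` X >].

Lemma gwidth_gt0 q g : grid q g -> forall j, (j <= q)%N -> 0 < gwidth g j.
Proof. by move=> [_ _ gS] j jq; rewrite subr_gt0 gS. Qed.

Lemma gwidth_sum_nat g a b : (a <= b)%N ->
  \sum_(a <= j < b) gwidth g j = g b - g a.
Proof. by move=> ab; rewrite telescope_sumr. Qed.

Lemma gwidth_sum q g : grid q g -> \sum_(j < q.+1) gwidth g j = 1.
Proof.
by move=> [g0 g1 _]; rewrite -(big_mkord xpredT) gwidth_sum_nat// g0 g1 subr0.
Qed.

(** The [q.+2] positions include 0 and 1, so the rest of the cube consists of open cells. *)
Definition grid_planes n (q : nat) (g : nat -> R) : seq ('I_n * R) :=
  [seq (i, g j) | i <- enum 'I_n, j <- iota 0 q.+2].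

Lemma off_grid_planes n q g (x : 'rV[R]_n) :
  ~ (\bigcup_(h in [set` grid_planes n q g]) coordinate_hyperplane h.1 h.2) x ->
  forall i j, (j <= q.+1)%N -> x 0 i != g j.
Proof.
move=> nx i j jq; apply/eqP => xij; apply: nx; exists (i, g j) => //=.
by apply/allpairsP; exists (i, j); rewrite mem_enum mem_iota add0n ltnS.
Qed.

Lemma off_grid_cell n q g (x : 'rV[R]_n) : grid q g -> @cube R n x ->
  ~ (\bigcup_(h in [set` grid_planes n q g]) coordinate_hyperplane h.1 h.2) x ->
  exists2 t : 'I_n -> nat, (forall i, (t i <= q)%N) & gcell g t x.
Proof.
move=> gg cx /off_grid_planes nx.
have /fin_all_exists[t tP] i : exists j, (j <= q)%N /\ g j < x 0 i < g j.+1.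
  by have [j jq jx] := grid_locate gg (cx i) (nx i); exists j.
by exists t => i; have [] := tP i.
Qed.

Lemma tri_eta (t : 'I_3 -> nat) : t = tri (t ord0) (t (inord 1)) (t (inord 2)).
Proof.
by apply/funext; apply: forall_ord3; rewrite /tri /= ?inordK.
Qed.

Lemma Vol_gcell q g (t : 'I_3 -> nat) : grid q g -> (forall i, (t i <= q)%N) ->
  Vol (gcell g t) =
  (gwidth g (t ord0) * gwidth g (t (inord 1)) * gwidth g (t (inord 2)))%:E.
Proof.
move=> gg tq; rewrite Vol_obox.
  by rewrite big_ord3 /= /gwidth mulrA.
by move=> i; rewrite -subr_ge0 ltW// (gwidth_gt0 gg).
Qed.

(** [X] contains the disjoint union of its cells, and what is left lies in the grid planes. *)
Lemma Vol_gpattern q g (X : set 'rV[R]_3) : grid q g -> closed X ->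
  X `<=` @cube R 3 ->
  (forall t : 'I_3 -> nat, (forall i, (t i <= q)%N) ->
    gcell g t `<=` X \/ gcell g t `&` X = set0) ->
  Vol X = (volume q (gwidth g) (gpattern g X))%:E.
Proof.
move=> gg clX Xc Xg.
pose T : finType := ('I_q.+1 * 'I_q.+1 * 'I_q.+1)%type.
pose c (p : T) := gcell g (tri p.1.1 p.1.2 p.2).
pose P (p : T) := gpattern g X p.1.1 p.1.2 p.2.
pose U := \big[setU/set0]_(p : T | P p) c p.
have mc p : vmeasurable (c p) by exact: vmeasurable_obox.
have trq (p : T) : forall i, (tri p.1.1 p.1.2 p.2 i <= q)%N.
  by apply: forall_ord3; rewrite /tri /= ?inordK//= -ltnS.
have -> : Vol X = Vol U.
  have mX : vmeasurable X by exact: closed_vmeasurable.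
  have mU : vmeasurable U by exact: vmeasurable_bigsetU.
  apply: eq_Vol_null => //; last first.
    rewrite (_ : U `\` X = set0) ?Vol0//; apply/seteqP; split=> // x [].
    rewrite /U -bigcup_seq_cond => -[p /= /andP[_ /asboolP pX] cx] nX.
    by apply: nX; exact: pX.
  apply: (@Vol_null R 3 _ (grid_planes 3 q g) 1); first exact: vmeasurableD.
    move=> x [Xx _] i; have /andP[x0 x1] := Xc _ Xx i; rewrite x1 andbT.
    by apply: le_trans x0; rewrite oppr_le0.
  move=> x [Xx nU]; apply: contrapT => /(off_grid_cell gg (Xc _ Xx))[t tq xt].
  apply: nU; rewrite /U -bigcup_seq_cond.
  have [tX|tX] := Xg t tq; last first.
    by have : (gcell g t `&` X) x by []; rewrite tX.
  have tq' i : (t i < q.+1)%N by rewrite ltnS.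
  exists (Ordinal (tq' ord0), Ordinal (tq' (inord 1)), Ordinal (tq' (inord 2))).
    rewrite /= mem_index_enum /=; apply/asboolP; by rewrite -tri_eta.
  by rewrite /c /= -tri_eta.
rewrite /U Vol_bigsetU//; last 2 first.
- exact: index_enum_uniq.
- move=> p p' pp.
  have [i pi] : exists i, tri p.1.1 p.1.2 p.2 i != tri p'.1.1 p'.1.2 p'.2 i.
    apply: contrapT => H; case/eqP: pp.
    have {}H i : tri p.1.1 p.1.2 p.2 i = tri p'.1.1 p'.1.2 p'.2 i.
      by apply/eqP; apply: contrapT => /negP pi; apply: H; exists i.
    have := H ord0; have := H (inord 1); have := H (inord 2).
    rewrite /tri /= !inordK//=; case: p p' {H} => [[a b] d] [[a' b'] d'] /= h2 h1 h0.
    by congr (_, _, _); exact: val_inj.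
  exact: (gcell_disjoint gg (trq p i) (trq p' i) pi).
rewrite volumeE (eq_bigr (fun p : T =>
  (gwidth g p.1.1 * gwidth g p.1.2 * gwidth g p.2)%:E)); last first.
  by move=> p _; rewrite (Vol_gcell gg (trq p)) /tri /= !inordK.
rewrite sumEFin; congr (_%:E).
rewrite pair_bigA /= pair_bigA /= big_mkcond; apply: eq_bigr => p _.
by rewrite /P; case: gpattern; rewrite ?mulr1 ?mulr0.
Qed.

End Grid.

(** * Faces between cells of different kinds *)

Section Faces.
Context {R : realType}.
Variables (q : nat) (g : nat -> R) (X : set 'rV[R]_3).
Hypotheses (gg : grid q g) (clX : closed X).
Hypothesis Xg : forall t : 'I_3 -> nat, (forall i, (t i <= q)%N) ->
    gcell g t `<=` X \/ gcell g t `&` X = set0.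

Local Notation w := (gwidth g).

Definition gpat (t : 'I_3 -> nat) : bool := `[< gcell g t `<=` X >].

Definition incr (d : 'I_3) (t : 'I_3 -> nat) : 'I_3 -> nat :=
  fun i => if i == d then (t i).+1 else t i.

(* The face between the cells t and incr d t, shrunk by e so that distinct faces
   are at distance at least e. *)
Definition gface (e : R) (d : 'I_3) (t : 'I_3 -> nat) : set 'rV[R]_3 :=
  cbox (fun i => if i == d then g (t i).+1 else g (t i) + e)
       (fun i => if i == d then g (t i).+1 else g (t i).+1 - e).

Lemma prod3_neq (d : 'I_3) (a b : R) : 
  \prod_(i < 3) (if i == d then a else b) = a * b ^+ 2.
Proof.
rewrite (bigD1 d)//= eqxx (eq_bigr (fun=> b)) => [|i /negbTE -> //].
rewrite prodr_const; congr (_ * _ ^+ _).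
by rewrite cardC1 card_ord.
Qed.

(** Near a point of the face, the two sides of its plane belong to two cells, one inside [X] and one
    disjoint from it. The face avoids the boundary of the cube: [t d < q] makes its plane interior,
    and the shrinking keeps the other coordinates off 0 and 1. *)
Lemma gface_essential (e : R) (d : 'I_3) (t : 'I_3 -> nat) : 0 < e ->
  (t d < q)%N -> (forall i, (t i <= q)%N) -> gpat t != gpat (incr d t) ->
  gface e d t `<=` essential_boundary X `\` boundary (@cube R 3).
Proof.
move=> e0 tdq tq jump x xf; have [g0 g1 gS] := gg.
have tq' i : (incr d t i <= q)%N by rewrite /incr; case: eqP => [->|].
split; last first.
  apply: interior_cubeP => i; have := xf i; case: eqP => [->|_].
    move=> /andP[a b]; have -> : x 0 d = g (t d).+1 by apply/le_anti; rewrite a b.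
    by rewrite -g0 -g1 !(grid_lt gg)//= ?ltnS// (leq_trans tdq).
  move=> /andP[a b].
  have h0 : 0 <= g (t i) by rewrite -g0 (grid_le gg)// leqW.
  have h1 : g (t i).+1 <= 1 by rewrite -g1 (grid_le gg)// ltnS.
  lra.
have xd : x 0 d = g (t d).+1.
  by have := xf d; rewrite eqxx => /le_anti.
(* Below [e], the half boxes stay within the cells in the directions of the face; below the two
   widths, across it. *)
pose rho := Num.min e (Num.min (w (t d)) (w (t d).+1)).
have rho0 : 0 < rho by rewrite !lt_min e0 !(gwidth_gt0 gg).
(* The constant is the volume [h (2 h)^2] of a half box for [h = r / 4], divided by [r^3]. *)
apply: (@essential_boundaryI R 3 X x rho 16^-1) => //; first exact: closed_vmeasurable.
move=> r r0; rewrite !lt_min => /and3P[re rw rw'].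
pose h := r / 4; have h0 : 0 < h by rewrite divr_gt0.
pose Bm : set 'rV[R]_3 := obox (fun i => if i == d then x 0 i - h else x 0 i - h)
   (fun i => if i == d then x 0 i else x 0 i + h).
pose Bp : set 'rV[R]_3 := obox (fun i => if i == d then x 0 i else x 0 i - h)
   (fun i => if i == d then x 0 i + h else x 0 i + h).
have VBm : Vol Bm = (16^-1 * r ^+ 3)%:E.
  rewrite Vol_obox; last by move=> i; case: eqP; lra.
  rewrite (eq_bigr (fun i => if i == d then h else 2 * h)); last by move=> i _; case: eqP; lra.
  by rewrite prod3_neq /h; congr (_%:E); field.
have VBp : Vol Bp = (16^-1 * r ^+ 3)%:E.
  rewrite Vol_obox; last by move=> i; case: eqP; lra.
  rewrite (eq_bigr (fun i => if i == d then h else 2 * h)); last by move=> i _; case: eqP; lra.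
  by rewrite prod3_neq /h; congr (_%:E); field.
have Bmb : Bm `<=` eball x r.
  apply: subset_trans (@cbox_sub_eball R 3 x r h isT (ltW h0) _); last by rewrite /h; lra.
  by move=> y yB i; have := yB i; case: eqP; lra.
have Bpb : Bp `<=` eball x r.
  apply: subset_trans (@cbox_sub_eball R 3 x r h isT (ltW h0) _); last by rewrite /h; lra.
  by move=> y yB i; have := yB i; case: eqP; lra.
have wd : w (t d) = g (t d).+1 - g (t d) by [].
have wd' : w (t d).+1 = g (t d).+2 - g (t d).+1 by [].
have Bmc : Bm `<=` gcell g t.
  move=> y yB i; have := yB i; have := xf i; case: eqP => [->|_].
    rewrite xd /h; lra.
  rewrite /h; lra.
have Bpc : Bp `<=` gcell g (incr d t).
  move=> y yB i; rewrite /incr; have := yB i; have := xf i; case: eqP => [->|_].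
    rewrite xd /h; lra.
  rewrite /h; lra.
have mBm : vmeasurable Bm by exact: vmeasurable_obox.
have mBp : vmeasurable Bp by exact: vmeasurable_obox.
have inX (t' : 'I_3 -> nat) B : gpat t' -> B `<=` gcell g t' -> B `<=` eball x r ->
    B `<=` X `&` eball x r.
  by move=> /asboolP tX Bc Bb y By; split; [exact/tX/Bc|exact: Bb].
have outX (t' : 'I_3 -> nat) B : (forall i, (t' i <= q)%N) -> ~~ gpat t' ->
    B `<=` gcell g t' -> B `<=` eball x r -> B `<=` eball x r `\` X.
  move=> t'q /asboolP tX Bc Bb y By; split; first exact: Bb.
  move=> Xy; case: (Xg t'q) => // E.
  have : (gcell g t' `&` X) y by split => //; exact: Bc.
  by rewrite E.
move: jump; case Pt : (gpat t); case Pt' : (gpat (incr d t)) => // _.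
- exists Bm, Bp; split=> //; first exact: inX Pt _ _.
    by apply: outX Bpc _ => //; rewrite Pt'.
  by rewrite VBm VBp.
- exists Bp, Bm; split=> //; first exact: inX Pt' _ _.
    by apply: outX Bmc _ => //; rewrite Pt.
  by rewrite VBm VBp.
Qed.

(** In one coordinate a face is either a grid point ([b] true) or a cell shrunk by [e] at both ends.
    Two distinct such sets are at distance at least [e], since grid points are at least [2 e]
    apart. *)
Lemma gface_separated_coord (e : R) (b b' : bool) (m m' : nat) (x y : R) :
  (forall j, (j <= q)%N -> 2 * e <= w j) -> 0 < e -> (m <= q)%N -> (m' <= q)%N ->
  (b, m) != (b', m') ->
  (if b then g m.+1 else g m + e) <= x <= (if b then g m.+1 else g m.+1 - e) ->
  (if b' then g m'.+1 else g m' + e) <= y <= (if b' then g m'.+1 else g m'.+1 - e) ->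
  e <= `|x - y|.
Proof.
move=> ew e0; wlog mm : b b' m m' x y / (m <= m')%N.
  move=> H mq m'q bm hx hy; have [mm|mm] := leqP m m'; first exact: (H b b' m m').
  rewrite distrC; apply: (H b' b m' m) => //; first exact: ltnW.
  by rewrite eq_sym.
move=> mq m'q; move: mm; rewrite leq_eqVlt => /predU1P[->|mm].
  rewrite xpair_eqE eqxx andbT => bb; have := ew _ m'q; rewrite /gwidth => ewm.
  case: b b' bb => [] [] // _ /andP[x1 x2] /andP[y1 y2];
    rewrite ler_normr; apply/orP; [left|right]; lra.
move=> _ hx hy; have gmm := grid_le gg mm (leqW m'q).
have := ew _ m'q; rewrite /gwidth => ewm.
have hx' : x <= g m.+1 by case: b hx; lra.
have hy' : g m' + e <= y by case: b' hy; lra.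
by rewrite distrC ler_normr; apply/orP; left; lra.
Qed.

Lemma gface_separated (e : R) (d d' : 'I_3) (t t' : 'I_3 -> nat) :
  (forall j, (j <= q)%N -> 2 * e <= w j) -> 0 < e ->
  (forall i, (t i <= q)%N) -> (forall i, (t' i <= q)%N) ->
  (exists i, (i == d, t i) != (i == d', t' i)) ->
  separated e (gface e d t) (gface e d' t').
Proof.
move=> ew e0 tq tq' [i ne] x y xf yf; apply: le_trans (norm_le_edist x y i).
exact: (gface_separated_coord ew e0 (tq i) (tq' i) ne (xf i) (yf i)).
Qed.

Lemma gface_area (e : R) (d : 'I_3) (t : 'I_3 -> nat) :
  (forall j, (j <= q)%N -> 2 * e <= w j) -> (forall i, (t i <= q)%N) ->
  hausdorff_measure 2 (gface e d t) =
  (plate_unit * \prod_(i < 3 | i != d) (w (t i) - 2 * e))%:E.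
Proof.
move=> ew tq; rewrite (@face_area _ d); last 2 first.
- by rewrite eqxx.
- by move=> i; case: eqP => // _; have := ew _ (tq i); rewrite /gwidth; lra.
congr (_ * _)%:E; apply: eq_bigr => i /negbTE ->; rewrite /gwidth; lra.
Qed.

(* Coordinate d is j; the two other ones are k and l, in this order. *)
Definition fidx (d : 'I_3) (j k l : nat) : 'I_3 -> nat :=
  nth (tri j k l) [:: tri j k l; tri k j l; tri k l j] d.

Lemma fidx0 j k l : fidx ord0 j k l = tri j k l. Proof. by []. Qed.
Lemma fidx1 j k l : fidx (inord 1) j k l = tri k j l.
Proof. by rewrite /fidx inordK. Qed.
Lemma fidx2 j k l : fidx (inord 2) j k l = tri k l j.
Proof. by rewrite /fidx inordK. Qed.

Lemma fidx_incr d j k l : incr d (fidx d j k l) = fidx d j.+1 k l.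
Proof.
have [[E1 E2] E3] := ord3_neq.
apply/funext; move: d; apply: forall_ord3; rewrite ?fidx0 ?fidx1 ?fidx2;
  apply: forall_ord3; rewrite /incr ?eqxx ?(eq_sym ord0) ?(eq_sym (inord 2) (inord 1)) ?E1 ?E2 ?E3;
  by rewrite /tri /= ?inordK.
Qed.

Lemma fidx_d d j k l : fidx d j k l d = j.
Proof.
by move: d; apply: forall_ord3; rewrite ?fidx0 ?fidx1 ?fidx2 /tri /= ?inordK.
Qed.

Lemma fidx_le d j k l : (j <= q)%N -> (k <= q)%N -> (l <= q)%N ->
  forall i, (fidx d j k l i <= q)%N.
Proof.
move=> jq kq lq; move: d; apply: forall_ord3; rewrite ?fidx0 ?fidx1 ?fidx2;
  by apply: forall_ord3; rewrite /tri /= ?inordK.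
Qed.

Lemma prod_fidx d j k l (F : nat -> R) :
  \prod_(i < 3 | i != d) F (fidx d j k l i) = F k * F l.
Proof.
have [[E1 E2] E3] := ord3_neq.
rewrite big_ord3; move: d; apply: forall_ord3; rewrite ?fidx0 ?fidx1 ?fidx2;
  rewrite ?eqxx ?(eq_sym ord0) ?(eq_sym (inord 2) (inord 1)) ?E1 ?E2 ?E3 /=;
  by rewrite /tri /= ?inordK//= ?mulr1 ?mul1r.
Qed.

Lemma fidx_inj d j k l j' k' l' :
  (forall i, fidx d j k l i = fidx d j' k' l' i) -> [/\ j = j', k = k' & l = l'].
Proof.
move: d; apply: forall_ord3 => H; have := H ord0; have := H (inord 1);
  have := H (inord 2); by rewrite ?fidx0 ?fidx1 ?fidx2 /tri /= ?inordK//= => -> -> ->.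
Qed.

(** A pair of neighbouring cells: the direction, the index below [q] of the lower cell along it, and
    the two transverse indices. *)
Local Notation FT := ('I_3 * ('I_q * 'I_q.+1 * 'I_q.+1))%type.

Definition ft (p : FT) : 'I_3 -> nat := fidx p.1 p.2.1.1 p.2.1.2 p.2.2.

Definition is_face (p : FT) : bool := gpat (ft p) != gpat (incr p.1 (ft p)).

Lemma ft_le (p : FT) i : (ft p i <= q)%N.
Proof. by apply: fidx_le; rewrite -ltnS// (leq_trans (ltn_ord _)). Qed.

Lemma perimeter3_faces : perimeter3 q w (gpattern g X) =
  \sum_(p : FT | is_face p) w p.2.1.2 * w p.2.2.
Proof.
rewrite big_mkcond -(pair_bigA _ (fun d p => if is_face (d, p) then w p.1.2 * w p.2 else 0)) /=.
rewrite big_ord3 /= addrA.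
have E (d : 'I_3) (b : nat -> nat -> nat -> bool) :
    (forall j k l, gpat (fidx d j k l) = b j k l) ->
    edges3 q w b = \sum_(p : 'I_q * 'I_q.+1 * 'I_q.+1)
      (if is_face (d, p) then w p.1.2 * w p.2 else 0).
  move=> db.
  rewrite -(pair_bigA _ (fun jk l => if is_face (d, (jk, l)) then w jk.2 * w l else 0)) /=.
  rewrite -(pair_bigA _ (fun j k => \sum_l if is_face (d, ((j, k), l)) then w k * w l else 0)) /=.
  rewrite exchange_big; apply: eq_bigr => k _; rewrite exchange_big.
  apply: eq_bigr => l _; rewrite natr_sum mulr_sumr; apply: eq_bigr => j _.
  rewrite /is_face /ft /= fidx_incr !db; case: (_ != _); by rewrite ?mulr1 ?mulr0.
by rewrite /perimeter3; congr (_ + _ + _); apply: E => j k l;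
  rewrite ?fidx0 ?fidx1 ?fidx2.
Qed.

Lemma gface_sum (e : R) : (forall j, (j <= q)%N -> 2 * e <= w j) -> 0 < e ->
  ((plate_unit * \sum_(p : FT | is_face p) (w p.2.1.2 - 2 * e) * (w p.2.2 - 2 * e))%:E
   <= RelPer X)%E.
Proof.
move=> ew e0.
apply: (@le_trans _ _ (hausdorff_measure 2
    (\big[setU/set0]_(p : FT | is_face p) gface e p.1 (ft p)))); last first.
  apply: le_hausdorff_measure; rewrite -bigcup_seq_cond => x [p /= /andP[_ pf] xf].
  apply: (gface_essential e0 _ (@ft_le p) pf xf).
  by rewrite /ft fidx_d.
apply: le_trans (hausdorff_measure_bigsetU_separated _ e0 (index_enum_uniq _) _).
  rewrite mulr_sumr -sumEFin; apply: lee_sum => p _.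
  rewrite (gface_area _ ew (@ft_le p)) lee_fin.
  by rewrite (prod_fidx _ _ _ _ (fun j => w j - 2 * e)).
move=> p p' _ _ pp; apply: gface_separated => //; [exact: ft_le|exact: ft_le|].
apply: contrapT => H; case/eqP: pp.
have {}H i : (i == p.1, ft p i) = (i == p'.1, ft p' i).
  by apply/eqP; apply: contrapT => /negP pi; apply: H; exists i.
have dd : p.1 = p'.1 by have [+ _] := H p.1; rewrite eqxx => /esym/eqP.
case: p p' dd H => [d [[j k] l]] [d' [[j' k'] l']] /= <- H.
have [] : [/\ j = j' :> nat, k = k' :> nat & l = l' :> nat].
  by apply: (@fidx_inj d) => i; exact: (congr1 snd (H i)).
by move=> /val_inj -> /val_inj -> /val_inj ->.
Qed.

Lemma gwidth_lb : exists2 e : R, 0 < e & forall j, (j <= q)%N -> e <= w j.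
Proof.
exists (\big[Num.min/1]_(j < q.+1) w j).
  elim/big_ind : _ => //; first by move=> x y x0 y0; rewrite lt_min x0.
  by move=> j _; rewrite (gwidth_gt0 gg)// -ltnS.
by move=> j jq; rewrite -[j]/(nat_of_ord (Ordinal (jq : (j < q.+1)%N))) bigmin_le_cond.
Qed.

(** The limit of [gface_sum] as [e] tends to 0: all widths are at most 1, so shrinking costs at most
    [4 e] per face. *)
Lemma RelPer_ge_perimeter3 :
  ((plate_unit * perimeter3 q w (gpattern g X))%:E <= RelPer X)%E.
Proof.
apply/lee_addgt0Pr => eta eta0; have [m m0 mw] := gwidth_lb.
have w1 j : (j <= q)%N -> w j <= 1.
  move=> jq; rewrite -(gwidth_sum gg) (bigD1 (Ordinal (jq : (j < q.+1)%N)))//= lerDl.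
  by apply: sumr_ge0 => i _; rewrite ltW// (gwidth_gt0 gg)// -ltnS.
pose c : R := plate_unit; have c0 : 0 < c := plate_unit_gt0.
pose N : R := (#|{: FT}|)%:R + 1.
have N0 : 0 < N by rewrite ltr_wpDl.
(* The first term keeps [2 * e] below every width; the second keeps the total loss, over fewer than
   [N] faces, below [eta]. *)
pose e := Num.min (m / 2) (eta / (4 * c * N)).
have e0 : 0 < e by rewrite lt_min !divr_gt0// !mulr_gt0.
have em : e <= m / 2 by rewrite ge_min lexx.
have ee : c * (4 * e * N) <= eta.
  have : e <= eta / (4 * c * N) by rewrite ge_min lexx orbT.
  by rewrite ler_pdivlMr ?mulr_gt0//; lra.
have ew j : (j <= q)%N -> 2 * e <= w j by move=> /mw; lra.
apply: le_trans (leeD2r eta%:E (gface_sum ew e0)).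
rewrite -EFinD lee_fin -/c perimeter3_faces.
apply: le_trans (lerD (lexx _) ee).
rewrite -mulrDr ler_pM2l// -lerBlDl -sumrB.
apply: (@le_trans _ _ (\sum_(p : FT | is_face p) 4 * e)).
  apply: ler_sum => p _.
  have h1 : w p.2.1.2 <= 1 by apply: w1; rewrite -ltnS.
  have h2 : w p.2.2 <= 1 by apply: w1; rewrite -ltnS.
  have h3 := ler_wpM2l (ltW e0) h1; have h4 := ler_wpM2l (ltW e0) h2.
  have := sqr_ge0 e; lra.
rewrite sumr_const -[leLHS]mulr_natr ler_wpM2l ?mulr_ge0 ?(ltW e0)//.
by rewrite /N ler_wpDr// ler_nat max_card.
Qed.

End Faces.

(** Will move the short sides to the first coordinates, where [corner_box] has them. The permutation
    lists [P], then its complement. *)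
Lemma perm_segment (n : nat) (P : pred 'I_n) :
  exists s : 'S_n, forall i, P (s i) = (i < #|P|)%N.
Proof.
pose e := enum P ++ enum (predC P).
have sz : size e = n by rewrite size_cat -!cardE cardC card_ord.
have ue : uniq e.
  rewrite cat_uniq !enum_uniq andbT /=; apply/hasPn => i.
  by rewrite !mem_enum.
pose f (i : 'I_n) := nth i e i.
have f_inj : injective f.
  move=> i j; rewrite /f (set_nth_default i j) ?sz// => /eqP.
  by rewrite nth_uniq ?sz// => /eqP/val_inj.
exists (perm f_inj) => i; rewrite permE /f nth_cat -cardE.
case: ltnP => iP.
  by have := mem_nth i (_ : (i < size (enum P))%N); rewrite -cardE mem_enum; apply.
apply/negbTE; have := mem_nth i (_ : (i - #|P| < size (enum (predC P)))%N).
rewrite -cardE mem_enum; apply; rewrite ltn_subLR// cardC card_ord; exact: ltn_ord.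
Qed.

(** * Symmetries of the cube *)

Section CubeSymmetry.
Context {R : realType}.

Definition reflect_if (b : bool) (y : R) : R := if b then y else 1 - y.

Lemma reflect_ifK b : involutive (reflect_if b).
Proof. by case: b => y; rewrite /reflect_if// subKr. Qed.

Lemma reflect_if01 b y : (0 <= reflect_if b y <= 1) = (0 <= y <= 1).
Proof.
by case: b => //=; rewrite /reflect_if subr_ge0 gerBl andbC.
Qed.

Lemma reflect_ifB b x y : `|reflect_if b x - reflect_if b y| = `|x - y|.
Proof.
case: b; rewrite /reflect_if// distrC; congr `|_|; ring.
Qed.

Definition cube_symmetry n (s : 'S_n) (b : 'I_n -> bool) (x : 'rV[R]_n) : 'rV[R]_n :=
  \row_i reflect_if (b (s i)) (x 0 (s i)).

Definition cube_symmetry_inv n (s : 'S_n) (b : 'I_n -> bool) (y : 'rV[R]_n) : 'rV[R]_n :=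
  \row_j reflect_if (b j) (y 0 (s^-1 j)%g).

Lemma cube_symmetryK n (s : 'S_n) b :
  cancel (cube_symmetry s b) (cube_symmetry_inv s b).
Proof. by move=> x; apply/rowP => j; rewrite !mxE permKV reflect_ifK. Qed.

Lemma cube_symmetry_invK n (s : 'S_n) b :
  cancel (cube_symmetry_inv s b) (cube_symmetry s b).
Proof. by move=> x; apply/rowP => j; rewrite !mxE permK reflect_ifK. Qed.

Lemma cube_symmetry_cube n (s : 'S_n) b x :
  @cube R n x -> @cube R n (cube_symmetry s b x).
Proof. by move=> cx i; rewrite mxE reflect_if01. Qed.

Lemma cube_symmetry_inv_cube n (s : 'S_n) b x :
  @cube R n x -> @cube R n (cube_symmetry_inv s b x).
Proof. by move=> cx i; rewrite mxE reflect_if01. Qed.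

Lemma cube_symmetry_isometry n (s : 'S_n) b : cube_isometry (cube_symmetry s b).
Proof.
split.
  apply/seteqP; split=> [_ [x cx <-]|y cy]; first exact: cube_symmetry_cube.
  exists (cube_symmetry_inv s b y); first exact: cube_symmetry_inv_cube.
  exact: cube_symmetry_invK.
move=> x y _ _; congr Num.sqrt; rewrite [RHS](reindex_inj (@perm_inj _ s)) /=.
apply: eq_bigr => i _; rewrite !mxE -[LHS]real_normK ?num_real// reflect_ifB.
by rewrite real_normK ?num_real.
Qed.

Lemma cube_symmetry_continuous n (s : 'S_n) b : continuous (cube_symmetry s b).
Proof.
move=> x A /nbhs_ballP[e /= e0 eA]; apply/nbhs_ballP; exists e => // y xy.
apply: eA; apply/ball_rVP => // i; rewrite !mxE reflect_ifB.
exact: (ball_rVP x y e0).1 xy _.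
Qed.

End CubeSymmetry.

(** * From the pattern of cells to a corner box *)

Section EndInterval.
Context {R : realType}.

(** With its switch at [r], the pattern fills [[0, g r]] if [T 0] holds and [[g r, 1]] otherwise; a
    reflection in the second case makes both start at 0, with length [side]. *)
Lemma end_interval_side (q : nat) (g : nat -> R) (T : nat -> bool) : grid q g ->
  (jumps q T <= 1)%N -> forall j y, (j <= q)%N -> g j < y < g j.+1 ->
  T j = (reflect_if (T 0%N) y <= side q (gwidth g) T).
Proof.
move=> gg /jumps_le1[r /andP[r0 rq] Tr]; have [g0 g1 _] := gg.
have split_side : side q (gwidth g) T =
    (T 0%N)%:R * g r + (~~ T 0%N)%:R * (1 - g r).
  rewrite /side -(big_mkord xpredT (fun j => gwidth g j * (T j)%:R)).
  rewrite (big_cat_nat (n := r))//=; congr (_ + _).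
    have -> : g r = \sum_(0 <= j < r) gwidth g j by rewrite gwidth_sum_nat// g0 subr0.
    rewrite mulr_sumr; apply: eq_big_nat => j /andP[_ jr].
    rewrite Tr; last by rewrite -ltnS (leq_trans jr).
    by rewrite leqNgt jr addbF mulrC.
  have -> : 1 - g r = \sum_(r <= j < q.+1) gwidth g j by rewrite gwidth_sum_nat// g1.
  rewrite mulr_sumr; apply: eq_big_nat => j /andP[rj jq].
  by rewrite Tr// rj addbT mulrC.
move=> j y jq /andP[yl yu]; rewrite split_side (Tr j jq) /reflect_if.
have [rj|jr] := leqP r j.
  have h : g r < y by apply: le_lt_trans yl; apply: (grid_le gg) => //; exact: leqW.
  case: (T 0%N); rewrite /= ?mul1r ?mul0r ?addr0 ?add0r.
    by rewrite leNgt h.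
  by rewrite lerD2l lerN2 ltW.
have h : y < g r by apply: lt_le_trans yu _; exact: (grid_le gg).
case: (T 0%N); rewrite /= ?mul1r ?mul0r ?addr0 ?add0r.
  by rewrite ltW.
by rewrite lerD2l lerN2 leNgt h.
Qed.

End EndInterval.

Lemma cube_root (R : realType) (V : R) : 0 <= V -> exists2 t : R, 0 <= t & t ^+ 3 = V.
Proof.
move=> V0; exists (V `^ 3^-1); first exact: powR_ge0.
by rewrite -powR_mulrn ?powR_ge0// -powRrM mulVf ?powRr1.
Qed.

Lemma Vol_symdiff_le (R : realType) n (A B : set 'rV[R]_n) : vmeasurable A ->
  vmeasurable B -> Vol A = 0%E -> Vol B = 0%E -> Vol (A `+` B) = 0%E.
Proof.
move=> mA mB A0 B0; apply/eqP; rewrite eq_le Vol_ge0 andbT.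
apply: (@le_trans _ _ (Vol (A `|` B))).
  apply: le_Vol; last by move=> x [[]|[]]; [left|right].
    by apply: vmeasurableU; exact: vmeasurableD.
  exact: vmeasurableU.
by apply: le_trans (le_VolU mA mB) _; rewrite A0 B0 adde0.
Qed.

Theorem theorem1p7 (R : realType) (V : R) (V_half : 0 <= V <= 2^-1)
    (X : set 'rV[R]_3) (cubX : cubical X) (volX : Vol X = V%:E)
    (minX : forall Y : set 'rV[R]_3, cubical Y -> Vol Y = V%:E ->
      (RelPer X <= RelPer Y)%E) :
  exists (f : 'rV[R]_3 -> 'rV[R]_3) (a : R) (m : nat),
    [/\ cube_isometry f, 0 <= a <= 2^-1, (1 <= m <= 3)%N &
        Vol ((f @` X) `+` corner_box m a) = 0%E].
Proof.
have [coX Xc _] := cubX; have clX := compact_closed_rV coX.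
have /andP[V0 V2] := V_half.
(* A null set needs no symmetry: it agrees with the degenerate box [a = 0], [m = 1] up to measure
   0. *)
have [Vz|Vn0] := eqVneq V 0.
  exists id, 0, 1%N; split=> //; first by split=> //; rewrite image_id.
    by rewrite lexx /= invr_ge0.
  rewrite image_id; apply: Vol_symdiff_le.
  - exact: closed_vmeasurable.
  - exact: vmeasurable_cbox.
  - by rewrite volX Vz.
  - by rewrite Vol_corner_box.
have Vp : 0 < V by rewrite lt_def Vn0.
have [q [g [gg Xg]]] := cubical_grid cubX.
have [t t0 t3] := cube_root V0.
pose s := Num.sqrt V; have s0 : 0 <= s := sqrtr_ge0 V.
have s2 : s ^+ 2 = V by rewrite sqr_sqrtr.
have V1 : V <= 1 by lra.
have t1 : t <= 1 by rewrite -(@ler_pXn2r _ 3) ?nnegrE// t3 expr1n.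
have s1 : s <= 1 by rewrite -(@ler_pXn2r _ 2) ?nnegrE// s2 expr1n.
set P := perimeter3 q (gwidth g) (gpattern g X).
(* The corner box is a competitor of volume [V], and the common factor [plate_unit] cancels. *)
have upper (m : nat) (a : R) : (1 <= m <= 3)%N -> 0 <= a -> a <= 1 -> a ^+ m = V ->
    P <= m%:R * a ^+ m.-1.
  move=> m13 a0 a1 aV.
  have vY : Vol (@corner_box R 3 m a) = V%:E by rewrite Vol_corner_box ?aV//; case/andP: m13.
  have := le_trans (RelPer_ge_perimeter3 gg clX Xg) (minX _ (@cubical_corner_box R 3 m a a1) vY).
  move=> /le_trans/(_ (RelPer_corner_box m13 a0 a1)).
  by rewrite lee_fin ler_pM2l// plate_unit_gt0.
have P1 : P <= 1 by have := upper 1%N V isT V0 V1 (expr1 V); rewrite mul1r.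
have P2 : P <= 2 * s by have := upper 2%N s isT s0 s1 s2; rewrite expr1.
have P3 : P <= 3 * t ^+ 2 by exact: (upper 3%N t isT t0 t1 t3).
have vol : volume q (gwidth g) (gpattern g X) = V.
  by have := Vol_gpattern gg clX Xc Xg; rewrite volX => -[].
have [T [TJ XT [a [a01 [i0 i03 Ti0] Ta]]]] :=
  minimal_corner_box (gwidth_gt0 gg) (gwidth_sum gg) Vp V2 s0 s2 t0 t3 vol P1 P2 P3.
have sideT1 (i : 'I_3) : side q (gwidth g) (T i) <= 1.
  exact: side_le1 (gwidth_gt0 gg) (gwidth_sum gg) _.
(* [m] is the number of sides shorter than 1; all of them have length [a]. *)
have [p pP] := perm_segment (fun i : 'I_3 => (side q (gwidth g) (T i) < 1)%R).
set m := #|_| in pP.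
have m13 : (1 <= m <= 3)%N.
  apply/andP; split; last by rewrite -[X in (_ <= X)%N]card_ord max_card.
  by rewrite lt0n; apply/existsP; exists (Ordinal i03).
have m_side (i : 'I_3) : side q (gwidth g) (T (p i)) = if (i < m)%N then a else 1.
  rewrite -pP; case: ltP => [lt1|ge1]; first by apply: Ta.
  by apply/le_anti; rewrite sideT1 ge1.
pose b (i : 'I_3) := T i 0%N.
pose f := @cube_symmetry R 3 p b.
exists f, a, m; split=> //; first exact: cube_symmetry_isometry.
have cfX : compact (f @` X).
  apply: continuous_compact => //; apply: continuous_subspaceT => x.
  exact: cube_symmetry_continuous.
have mfX : vmeasurable (f @` X) by apply: closed_vmeasurable; exact: compact_closed_rV.
have mbox : vmeasurable (@corner_box R 3 m a) by exact: vmeasurable_cbox.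
(* Off the grid planes a point lies in one open cell, where membership in [X] is decided by three
   one-dimensional conditions; [f] turns each into an upper bound on one coordinate. *)
have cell_mem x : @cube R 3 x ->
    ~ (\bigcup_(h in [set` grid_planes 3 q g]) coordinate_hyperplane h.1 h.2) x ->
    (X x <-> @corner_box R 3 m a (f x)).
  move=> cx /(off_grid_cell gg cx)[u uq xu].
  have -> : X x <-> gpattern g X (u ord0) (u (inord 1)) (u (inord 2)).
    rewrite /gpattern -tri_eta; split; last by move=> /asboolP; exact.
    by move=> Xx; apply/asboolP; have [//|E] := Xg u uq;
      have : (gcell g u `&` X) x by []; rewrite E.
  have uq' i : (u i < q.+1)%N by rewrite ltnS.
  rewrite (XT (Ordinal (uq' ord0)) (Ordinal (uq' (inord 1))) (Ordinal (uq' (inord 2)))) /=.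
  have Tu (i : 'I_3) : T i (u i) =
      (reflect_if (b i) (x 0 i) <= side q (gwidth g) (T i)).
    by apply: (end_interval_side gg) (uq i) (xu i); case: (TJ i (ltn_ord i)).
  have TE : (forall i : 'I_3, T i (u i)) <->
      [&& T 0%N (u ord0), T 1%N (u (inord 1)) & T 2%N (u (inord 2))].
    split=> [H|/and3P[h0 h1 h2]]; last by apply: forall_ord3; rewrite /= ?inordK.
    by have := H ord0; have := H (inord 1); have := H (inord 2); rewrite /= !inordK// => -> -> ->.
  rewrite -TE; split=> H i.
    have /andP[x0 x1] := @cube_symmetry_cube R 3 p b x cx i.
    by rewrite -m_side x0 /= mxE -Tu.
  by have := H ((p^-1)%g i); rewrite -m_side mxE permKV Tu => /andP[].
(* These planes are the images under [f] of the grid planes, which contain all possible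
   exceptions. *)
apply: (@Vol_null R 3 _ [seq (i, reflect_if (b (p i)) (g j)) | i <- enum 'I_3, j <- iota 0 q.+2] 1).
- by apply: vmeasurableU; exact: vmeasurableD.
- have c1 y : @cube R 3 y -> forall i, - 1 <= y 0 i <= 1.
    move=> cy i; have /andP[y0 y1] := cy i; rewrite y1 andbT.
    by apply: le_trans y0; rewrite oppr_le0.
  have cbox y : corner_box m a y -> @cube R 3 y.
    move=> yb i; have /andP[y0 y1] := yb i; rewrite y0 (le_trans y1)//.
    by case: ifP => // _; have /andP[_ a2] := a01; lra.
  move=> y [[[x Xx <-] _]|[yb _]]; apply: c1; last exact: cbox.
  by apply: cube_symmetry_cube; exact: Xc.
move=> y yD; apply: contrapT => ny.
have yc : @cube R 3 y.
  case: yD => [[[x Xx <-] _]|[yb _]].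
    by apply: cube_symmetry_cube; exact: Xc.
  move=> i; have /andP[y0 y1] := yb i; rewrite y0 (le_trans y1)//.
  by case: ifP => // _; have /andP[_ a2] := a01; lra.
pose x := cube_symmetry_inv p b y.
have fx : f x = y by exact: cube_symmetry_invK.
have xc : @cube R 3 x by exact: cube_symmetry_inv_cube.
have nx : ~ (\bigcup_(h in [set` grid_planes 3 q g]) coordinate_hyperplane h.1 h.2) x.
  move=> [[k c] /allpairsP[[i j] [_ jq [-> ->]]] xij]; apply: ny.
  exists ((p^-1)%g i, reflect_if (b (p (p^-1%g i))) (g j)).
    by apply/allpairsP; exists ((p^-1)%g i, j); rewrite mem_enum.
  by rewrite /coordinate_hyperplane /= -fx mxE permKV xij.
have XE := cell_mem x xc nx.
case: yD => [[[x' Xx' fx'] nyb]|[yb nXy]].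
  apply: nyb; rewrite -fx; apply/XE.
  by rewrite (_ : x = x')// /x -fx' cube_symmetryK.
by apply: nXy; exists x => //; apply/XE; rewrite fx.
Qed.
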